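(* Assume in addition $\mathbb E Y_0^3<\infty$ and $\mathbb E\varepsilon_1^3<\infty$. Then $\sqrt n(\tilde\alpha_n-\alpha)\to\mathcal N(0,\sigma_{\alpha,\varepsilon}^2)$ in distribution. Moreover, conditionally on the values $(Y_{s_1-1},Y_{s_2-1})$, $$\begin{bmatrix}\sqrt n\big(\tilde\theta_{1,n}-(Y_{s_1}-\alpha Y_{s_1-1}-\mu_\varepsilon)\big)\\ \sqrt n\big(\tilde\theta_{2,n}-(Y_{s_2}-\alpha Y_{s_2-1}-\mu_\varepsilon)\big)\end{bmatrix}\to\mathcal N\Big(\begin{bmatrix}0\\0\end{bmatrix},\sigma_{\alpha,\varepsilon}^2\begin{bmatrix}Y_{s_1-1}^2&Y_{s_1-1}Y_{s_2-1}\\ Y_{s_1-1}Y_{s_2-1}&Y_{s_2-1}^2\end{bmatrix}\Big).$$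
   Context: Let $\alpha\in(0,1)$. Let $(\varepsilon_k)_{k\in\mathbb N}$ be i.i.d. non-negative integer-valued random variables with $\mathbb E\varepsilon_1^2<\infty$ and $\mathbb P(\varepsilon_1\ne 0)>0$; write $\mu_\varepsilon=\mathbb E\varepsilon_1$ (assumed known), $\sigma_\varepsilon^2=\operatorname{Var}\varepsilon_1$. For each $k\in\mathbb N$ let $(\xi_{k,j})_{j\in\mathbb N}$ be i.i.d. Bernoulli random variables with mean $\alpha$, these sequences being mutually independent and independent of $(\varepsilon_k)$. The INAR(1) Markov chain $X_k=\sum_{j=1}^{X_{k-1}}\xi_{k,j}+\varepsilon_k$ has a unique stationary distribution; $\tilde X$ denotes a random variable with it, and $\sigma_{\alpha,\varepsilon}^2=\frac{\alpha(1-\alpha)\mathbb E\tilde X^3+\sigma_\varepsilon^2\mathbb E\tilde X^2}{(\mathbb E\tilde X^2)^2}$. Two innovational outliers: fix known $s_1\ne s_2$ in $\mathbb N$ and $\theta_1,\theta_2\in\mathbb N$; $Y_0$ non-negative integer-valued, independent of all $\xi_{k,j},\varepsilon_k$; $Y_k=\sum_{j=1}^{Y_{k-1}}\xi_{k,j}+\varepsilon_k+\delta_{k,s_1}\theta_1+\delta_{k,s_2}\theta_2$. Define $\tilde\alpha_n=\frac{\sum_{k=1,k\notin\{s_1,s_2\}}^n(Y_k-\mu_\varepsilon)Y_{k-1}}{\sum_{k=1,k\notin\{s_1,s_2\}}^nY_{k-1}^2}$ when the denominator is positive (and $0$ otherwise), and $\tilde\theta_{i,n}=Y_{s_i}-\tilde\alpha_nY_{s_i-1}-\mu_\varepsilon$,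 $i=1,2$. Conditional convergence: for random vectors $\zeta_n$ and a random vector $\eta$ with values in $\mathbb Z_+^d$, ''conditionally on the values $\eta$, $\zeta_n\to\mathcal N(0,\Sigma(\eta))$'' means: for every $m$ with $\mathbb P(\eta=m)>0$, the conditional distribution of $\zeta_n$ given $\{\eta=m\}$ converges weakly to $\mathcal N(0,\Sigma(m))$. *)

(* Defs.v *)
From HB Require Import structures.
From mathcomp Require Import all_boot all_order all_algebra.
From mathcomp Require Import all_classical all_reals all_analysis.
Set Implicit Arguments. Unset Strict Implicit. Unset Printing Implicit Defensive.
Import Order.TTheory GRing.Theory Num.Theory.
Import numFieldNormedType.Exports.
Local Open Scope classical_set_scope.
Local Open Scope ring_scope.

Inductive inar_idx := IY0 | IEps of nat | IXi of nat & nat.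

Definition inar_idx_eqb (a b : inar_idx) : bool :=
  match a, b with
  | IY0, IY0 => true
  | IEps k, IEps k' => k == k'
  | IXi k j, IXi k' j' => (k == k') && (j == j')
  | _, _ => false
  end.
Lemma inar_idx_eqP : Equality.axiom inar_idx_eqb.
Proof.
case=> [|k|k j] [|k'|k' j'] /=; try by constructor.
- by apply: (iffP eqP) => [->|[]].
- by apply: (iffP andP) => [[/eqP-> /eqP->]|[-> ->]].
Qed.
HB.instance Definition _ := hasDecEq.Build inar_idx inar_idx_eqP.

Definition inar_idx_valid (i : inar_idx) : bool :=
  match i with IY0 => true | IEps k => (0 < k)%N | IXi k j => ((0 < k) && (0 < j))%N end.

Definition inar_prim {T : Type} (Y0 : T -> nat) (eps : nat -> T -> nat)
    (xi : nat -> nat -> T -> bool) (i : inar_idx) : T -> nat :=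
  match i with
  | IY0 => Y0
  | IEps k => eps k
  | IXi k j => fun t => nat_of_bool (xi k j t)
  end.

Definition mutually_independent_discrete {d} {T : measurableType d}
    {R : realType} (P : probability T R) {I : eqType} (ok : pred I)
    (W : I -> T -> nat) : Prop :=
  forall (s : seq I), uniq s -> all ok s -> forall v : I -> nat,
    P (\bigcap_(i in [set i | i \in s]) (W i @^-1` [set v i])) =
    (\prod_(i <- s) P (W i @^-1` [set v i]))%E.

Fixpoint Yproc {T : Type} (Y0 : T -> nat) (eps : nat -> T -> nat)
    (xi : nat -> nat -> T -> bool) (s1 s2 th1 th2 : nat) (k : nat) (t : T) : nat :=
  match k with
  | 0 => Y0 t
  | k'.+1 =>
      (\sum_(1 <= j < (Yproc Y0 eps xi s1 s2 th1 th2 k' t).+1) nat_of_bool (xi k'.+1 j t))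
      + eps k'.+1 t + (k'.+1 == s1) * th1 + (k'.+1 == s2) * th2
  end.

Definition alpha_tilde {T : Type} {R : realType} (Y : nat -> T -> nat)
    (mu : R) (s1 s2 n : nat) (t : T) : R :=
  let num := \sum_(1 <= k < n.+1 | (k != s1) && (k != s2))
               ((Y k t)%:R - mu) * (Y k.-1 t)%:R in
  let den := \sum_(1 <= k < n.+1 | (k != s1) && (k != s2))
               ((Y k.-1 t)%:R) ^+ 2 in
  if 0 < den then num / den else 0.

Definition theta_tilde {T : Type} {R : realType} (Y : nat -> T -> nat)
    (mu : R) (s1 s2 si n : nat) (t : T) : R :=
  (Y si t)%:R - alpha_tilde Y mu s1 s2 n t * (Y si.-1 t)%:R - mu.

(** Expectation of g(N(0,v)) for v >= 0, with N(0,v) the law of sqrt(v) Z,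
    Z standard normal. *)
Definition gauss1_expect {R : realType} (v : R) (g : R -> R) : \bar R :=
  (\int[normal_prob 0 1]_x (g (Num.sqrt v * x))%:E)%E.

Definition cvg_dist_normal1 {d} {T : measurableType d} {R : realType}
    (P : probability T R) (Z : nat -> T -> R) (v : R) : Prop :=
  forall g : R -> R, continuous g -> (exists M : R, forall x, `|g x| <= M) ->
    (fun n => (\int[P]_t (g (Z n t))%:E)%E) @ \oo --> gauss1_expect v g.

(** Conditional convergence in distribution of 2-dimensional Z_n given the
    event B (with P B > 0) to N(0, Sigma), N(0,Sigma) being the law of A W
    where W is a standard 2-dimensional normal vector and A A^T = Sigma
    (this law does not depend on the choice of A). *)
Definition mat2_apply {R : pzRingType} (A : 'M[R]_2) (z : R * R) : R * R :=
  (A 0 0 * z.1 + A 0 1 * z.2, A 1 0 * z.1 + A 1 1 * z.2).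

Definition cond_cvg_dist_normal2 {d} {T : measurableType d} {R : realType}
    (P : probability T R) (B : set T) (Z : nat -> T -> R * R) (Sigma : 'M[R]_2)
    : Prop :=
  forall g : R * R -> R, continuous g -> (exists M : R, forall x, `|g x| <= M) ->
  forall A : 'M[R]_2, A *m A^T = Sigma ->
    (fun n => ((\int[P]_(t in B) (g (Z n t))%:E) * ((fine (P B))^-1)%:E)%E)
      @ \oo -->
    (\int[(normal_prob (0:R) 1 \x normal_prob (0:R) 1)%E]_w (g (mat2_apply A w))%:E)%E.

(** Transition kernel of the INAR(1) chain X_k = sum_{j<=X_{k-1}} xi_{k,j} + eps_k,
    computed from the model variables of step 1:
    K n m = P(sum_{j=1}^n xi_{1,j} + eps_1 = m). *)
Definition inar_kernel {d} {T : measurableType d} {R : realType}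
    (P : probability T R) (eps : nat -> T -> nat) (xi : nat -> nat -> T -> bool)
    (n m : nat) : R :=
  fine (P [set t | (\sum_(1 <= j < n.+1) nat_of_bool (xi 1 j t)) + eps 1 t = m]%N).

Definition inar_stationary {d} {T : measurableType d} {R : realType}
    (P : probability T R) (eps : nat -> T -> nat) (xi : nat -> nat -> T -> bool)
    (pi : nat -> R) : Prop :=
  [/\ forall n, 0 <= pi n,
      (\sum_(n <oo) (pi n)%:E = 1)%E &
      forall m, (\sum_(n <oo) (pi n * inar_kernel P eps xi n m)%:E = (pi m)%:E)%E].

Definition dist_moment {R : realType} (pi : nat -> R) (k : nat) : R :=
  fine (\sum_(n <oo) ((n%:R : R) ^+ k * pi n)%:E)%E.

Definition rv_mean {d} {T : measurableType d} {R : realType}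
    (P : probability T R) (X : T -> nat) : R :=
  fine (\int[P]_t ((X t)%:R : R)%:E)%E.
Definition rv_var {d} {T : measurableType d} {R : realType}
    (P : probability T R) (X : T -> nat) : R :=
  fine (\int[P]_t ((((X t)%:R : R) - rv_mean P X) ^+ 2)%:E)%E.

Definition sigma2_ae {R : realType} (alpha sig2eps : R) (pi : nat -> R) : R :=
  (alpha * (1 - alpha) * dist_moment pi 3 + sig2eps * dist_moment pi 2)
    / (dist_moment pi 2) ^+ 2.

(* Main.v *)
Require Import Defs.
From HB Require Import structures.
From mathcomp Require Import all_boot all_order all_algebra.
From mathcomp Require Import all_classical all_reals all_analysis.
From mathcomp Require Import measurable_realfun ring lra.
Import Order.TTheory GRing.Theory Num.Theory.
Import numFieldNormedType.Exports.
Local Open Scope classical_set_scope.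
Local Open Scope ring_scope.

(** Write [M_k = Y_k - alpha Y_{k-1} - mu]. Apart from finitely many indices, the
    error of the estimator is [sum M_k Y_{k-1} / sum Y_{k-1}^2]. Its numerator is a
    martingale, and the conditional variances [h (Y_{k-1})] of its increments, where
    [h y = alpha (1 - alpha) y^3 + sigma^2 y^2], average to the mean of [h] under
    the stationary law.

    Ergodicity comes from the contraction [|K^N f x - K^N f 0| <= 2 |f| alpha^N x] of
    the kernel [K] on bounded [f]: truncating the Neumann series gives [g] with
    [f - ell f] close to [g - K g], and summation by parts turns this into a law
    of large numbers for [sum w_k f (Y_k)] with slowly varying adapted weights [w_k].

    For the limit theorem one telescopes [E (b exp (l k) cos (r S_k + c))], with [r]
    of order [n^(-1/2)] and [l = r^2 E h / 2]; by Taylor's formula the drift is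
    [w_k (E h - h (Y_k))], which the weighted law of large numbers kills. The weight
    [b] is either 1 or the indicator of the conditioning event, which is determined
    by time [max s1 s2]; so the same argument gives the conditional statement. The
    errors of both outlier estimators are multiples of that of the
    autoregressive parameter, hence the rank-one covariance. *)

(** * Convergence in distribution through cosines *)

(** The conditional variance of an increment of the numerator is cubic in the state, so under third
    moments it is merely integrable and no second moment argument applies to it. Both the laws of
    large numbers for unbounded functions and the Lindeberg step therefore go through truncation at
    a level [c], which is harmless because [Y k ^ 3] is uniformly integrable. That is read off from
    the moments: the means of [Y k ^ p] obey affine recursions whose limits turn out to be the
    moments of [pi]. The latter are first shown finite, by comparing truncated moments of [pi] with
    limits along the chain; stationarity then determines them.

    Conditional expectations are replaced by sums. The state space is countable, so a path up to
    time [k] takes countably many values, and an integral splits over histories, on each of which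
    the next step is driven by independent noise. Cosines with a phase take the place of complex
    characteristic functions. *)

Lemma continuous_unif_segment {R : realType} (g : R -> R) (a b e : R) :
  continuous g -> 0 < e ->
  exists2 dl : R, 0 < dl & forall x y, a <= x <= b -> `|x - y| < dl -> `|g x - g y| <= e.
Proof.
move=> cg e0.
have e20 : 0 < e / 2 by rewrite divr_gt0.
(* Compactness in near-covering form: what holds near each point of the segment for all small [dl]
   holds on the whole segment for one [dl]. Only [x] is confined to the segment; [y] may leave
   it. *)
have /compact_near_coveringP/(_ R (0^'+) (fun dl x =>
  forall y, `|x - y| < dl -> `|g x - g y| <= e)) := @segment_compact R a b.
case.
  move=> x _.
  have /cvgrPdist_lt /(_ _ e20) := cg x.
  move=> [r /= r0 xr].
  have r20 : 0 < r / 2 by rewrite divr_gt0.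
  exists (ball x (r / 2), [set d | d < r / 2]) => /=.
    split; first exact: nbhsx_ballx.
    exact: nbhs_right_lt.
  move=> [x' dl] /= [] xx' dlr y x'y.
  have -> : g x' - g y = (g x - g y) - (g x - g x') by ring.
  rewrite (le_trans (ler_normB _ _))// (splitr e) lerD// ltW// xr//=.
    rewrite (_ : x - y = (x - x') + (x' - y)); last by ring.
    rewrite (le_lt_trans (ler_normD _ _))// (splitr r) ltrD//.
    exact: lt_trans dlr.
  by rewrite (lt_trans xx')// ltr_pdivrMr// ltr_pMr// ltrDl.
move=> dl /= dl0 H.
exists (dl / 2); first by rewrite divr_gt0.
move=> x y xab xy.
apply: (H (dl / 2)) => //=; rewrite ?divr_gt0//.
  by rewrite sub0r normrN gtr0_norm ?divr_gt0// ltr_pdivrMr// ltr_pMr// ltrDl.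
Qed.

(** * Bernstein's theorem and approximation by trigonometric polynomials *)

(** The mean of [f] at a binomial variable with parameters [n] and [x], by conditioning on the first
    trial. All estimates then go by induction, without binomial coefficients. *)
Fixpoint bernstein {R : realType} (n : nat) (x : R) (f : nat -> R) : R :=
  if n is n'.+1 then (1 - x) * bernstein n' x f + x * bernstein n' x (f \o S)
  else f 0%N.

Lemma bernsteinD {R : realType} n (x : R) f g :
  bernstein n x (fun k => f k + g k) = bernstein n x f + bernstein n x g.
Proof.
elim: n f g => //= n IH f g.
by rewrite IH (IH (f \o S) (g \o S)); ring.
Qed.

Lemma bernsteinZ {R : realType} n (x : R) c f :
  bernstein n x (fun k => c * f k) = c * bernstein n x f.
Proof. by elim: n f => //= n IH f; rewrite IH (IH (f \o S)); ring. Qed.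

Lemma bernstein_cst {R : realType} n (x : R) c : bernstein n x (fun=> c) = c.
Proof. by elim: n => //= n IH; rewrite /comp IH; ring. Qed.

Lemma bernstein_le {R : realType} n (x : R) f g : 0 <= x <= 1 ->
  (forall k, f k <= g k) -> bernstein n x f <= bernstein n x g.
Proof.
move=> /andP[x0 x1]; elim: n f g => //= n IH f g fg.
by rewrite lerD// ler_wpM2l// ?subr_ge0// IH// => k /=.
Qed.

Lemma bernstein_norm {R : realType} n (x : R) f g : 0 <= x <= 1 ->
  (forall k, `|f k| <= g k) -> `|bernstein n x f| <= bernstein n x g.
Proof.
move=> x01 fg; rewrite ler_norml; apply/andP; split.
  rewrite -mulN1r -bernsteinZ; apply: bernstein_le => // k.
  by rewrite mulN1r; have := fg k; rewrite ler_norml => /andP[].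
by apply: bernstein_le => // k; exact: le_trans (ler_norm _) (fg k).
Qed.

(** Variance plus squared bias of the binomial law. The centre [a] is general because the induction
    moves it to [a - 1]. *)
Lemma bernstein_sqr {R : realType} n (x a : R) :
  bernstein n x (fun k => (k%:R - a) ^+ 2) =
  n%:R * x * (1 - x) + (n%:R * x - a) ^+ 2.
Proof.
elim: n a => /= [|n IH] a; first by ring.
rewrite IH (_ : _ \o S = fun k => (k%:R - (a - 1)) ^+ 2); last first.
  by apply/funext => k /=; rewrite -natr1; ring.
by rewrite IH -natr1; ring.
Qed.

(** Chebyshev's argument: where [k / n] is at least [dl] away from [u], the constant [2 M] is
    dominated by [2 M (k / n - u)^2 / dl^2], whose mean is at most [2 M / (n dl^2)] since
    [u (1 - u) <= 1]. *)
Lemma bernstein_approx {R : realType} (G : R -> R) (M dl e : R) n (u : R) :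
  0 <= u <= 1 -> 0 < dl -> (0 < n)%N -> (forall x, `|G x| <= M) ->
  (forall y, `|u - y| < dl -> `|G u - G y| <= e) ->
  `|bernstein n u (fun k => G (k%:R / n%:R)) - G u| <=
     e + 2 * M / (n%:R * dl ^+ 2).
Proof.
move=> u01 dl0 n0 GM Gu.
have M0 : 0 <= M by exact: le_trans (GM 0).
have e0 : 0 <= e by apply: le_trans (Gu u _); rewrite // subrr normr0.
have n0' : 0 < n%:R :> R by rewrite ltr0n.
rewrite -[G u]mul1r -[X in X * G u](bernstein_cst n u) mulrC -bernsteinZ -mulN1r.
rewrite -bernsteinZ -bernsteinD.
apply: (@le_trans _ _ (bernstein n u (fun k =>
  e + 2 * M / dl ^+ 2 / n%:R ^+ 2 * (k%:R - n%:R * u) ^+ 2))).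
  apply: bernstein_norm => // k.
  rewrite mulr1 mulN1r distrC.
  have [kd|kd] := ltP `|u - k%:R / n%:R| dl.
    rewrite (le_trans (Gu _ kd))// lerDl mulr_ge0 ?sqr_ge0//.
    by rewrite !(sqr_ge0, divr_ge0, mulr_ge0).
  rewrite (le_trans (ler_normB _ _))//.
  apply: (@le_trans _ _ (2 * M)).
    by have := GM u; have := GM (k%:R / n%:R); lra.
  apply: ler_wpDl => //.
  have -> : 2 * M / dl ^+ 2 / n%:R ^+ 2 * (k%:R - n%:R * u) ^+ 2 =
     2 * M * ((u - k%:R / n%:R) ^+ 2 / dl ^+ 2).
    by field; rewrite !gt_eqF.
  rewrite ler_peMr ?mulr_ge0// ler_pdivlMr ?exprn_gt0// mul1r.
  by rewrite -[leRHS]real_normK ?num_real// lerXn2r// nnegrE ltW.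
rewrite bernsteinD bernstein_cst bernsteinZ bernstein_sqr lerD2l subrr expr0n/= addr0.
have -> : 2 * M / dl ^+ 2 / n%:R ^+ 2 * (n%:R * u * (1 - u)) =
  2 * M / (n%:R * dl ^+ 2) * (u * (1 - u)).
  by field; rewrite !gt_eqF.
rewrite ler_piMr ?(sqr_ge0, divr_ge0, mulr_ge0)//.
by move/andP: u01 => [u0 u1]; rewrite mulr_ile1// ?subr_ge0// lerBlDr lerDl.
Qed.

(** The phase [c] brings in constants and sines and closes the span under products, so a Bernstein
    polynomial evaluated at a sine stays inside. *)
Inductive trigpoly {R : realType} : (R -> R) -> Prop :=
| trigpoly_cos t c : trigpoly (fun x => cos (t * x + c))
| trigpolyD f g : trigpoly f -> trigpoly g -> trigpoly (f \+ g)
| trigpolyZ a f : trigpoly f -> trigpoly (fun x => a * f x).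

Lemma trigpoly_cst {R : realType} (a : R) : trigpoly (fun=> a).
Proof.
have := trigpolyZ a _ (trigpoly_cos 0 0).
by congr trigpoly; apply/funext => x; rewrite mul0r addr0 cos0 mulr1.
Qed.

Lemma trigpolyM {R : realType} (f g : R -> R) :
  trigpoly f -> trigpoly g -> trigpoly (fun x => f x * g x).
Proof.
elim=> [t c|{}f f' _ IH _ IH'|a {}f _ IH] tg; last 2 first.
- have := trigpolyD _ _ (IH tg) (IH' tg).
  by congr trigpoly; apply/funext => x /=; rewrite mulrDl.
- have := trigpolyZ a _ (IH tg).
  by congr trigpoly; apply/funext => x /=; rewrite mulrA.
elim: tg => [t' c'|{}g g' _ IH _ IH'|a {}g _ IH]; last 2 first.
- have := trigpolyD _ _ IH IH'.
  by congr trigpoly; apply/funext => x /=; rewrite mulrDr.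
- have := trigpolyZ a _ IH.
  by congr trigpoly; apply/funext => x /=; rewrite mulrCA.
have := trigpolyD _ _ (trigpolyZ 2^-1 _ (trigpoly_cos (t + t') (c + c')))
  (trigpolyZ 2^-1 _ (trigpoly_cos (t - t') (c - c'))).
congr trigpoly; apply/funext => x /=.
rewrite (_ : (t + t') * x + _ = (t * x + c) + (t' * x + c')); last by ring.
rewrite (_ : (t - t') * x + _ = (t * x + c) - (t' * x + c')); last by ring.
by rewrite cosD cosB; field.
Qed.

Lemma trigpoly_bernstein {R : realType} n (u : R -> R) f :
  trigpoly u -> trigpoly (fun x => bernstein n (u x) f).
Proof.
move=> tu; elim: n f => /= [|n IH] f; first exact: trigpoly_cst.
apply: (trigpolyD (fun x => (1 - u x) * bernstein n (u x) f)).
  apply: trigpolyM => //; apply: (trigpolyD (fun=> 1)); first exact: trigpoly_cst.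
  have := trigpolyZ (-1) _ tu.
  by congr trigpoly; apply/funext => x /=; rewrite mulN1r.
exact: trigpolyM.
Qed.

(** Bernstein approximation of [g] in the variable [u = (1 + sin (x / (2 K))) / 2]. For [|x| <= K]
    the angle is at most 1/2, where the sine is invertible. The bound [M] on [p] holds on the whole
    line, which controls the mass outside [[-K, K]]. *)
Lemma trigpoly_approx {R : realType} (g : R -> R) (M K e : R) :
  continuous g -> (forall x, `|g x| <= M) -> 0 < K -> 0 < e ->
  exists p, [/\ trigpoly p, (forall x, `|p x| <= M) &
    forall x, `|x| <= K -> `|g x - p x| <= e].
Proof.
move=> cg gM K0 e0.
have M0 : 0 <= M by exact: le_trans (gM 0).
have pi2 : 2^-1 < pi / 2 :> R.
  by have := pi_ge2 R; lra.
pose s : R := sin 2^-1.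
have s0 : 0 < s by apply: sin_gt0_pihalf; rewrite invr_gt0 ltr0n.
have s1 : s < 1.
  rewrite -[ltRHS](@sin_pihalf R) ltr_sin//.
    by rewrite in_itv/=; apply/andP; split; lra.
  by rewrite in_itv/=; apply/andP; split; lra.
have L0 : 0 < 2 * K by rewrite mulr_gt0.
(* Clamping to [[-s, s]] with [s = sin (1/2) < 1] keeps the argument of [asin] away from the
   endpoints, so [G] is continuous everywhere; for [|x| <= K] it changes nothing. *)
pose G (u : R) : R := g (2 * K * asin (Num.max (- s) (Num.min s (2 * u - 1)))).
have cG : continuous G.
  move=> u; apply: (@continuous_comp _ _ _ (fun u : R => 2 * K * asin (Num.max (- s) (Num.min s (2 * u - 1)))) g); last exact: cg.
  apply: (@continuousM _ _ (cst (2 * K))); first exact: cvg_cst.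
  apply: (@continuous_comp _ _ _ (fun u : R => (Num.max (- s) (Num.min s (2 * u - 1)))) asin).
    apply: (@continuous_max _ _ (cst (- s))); first exact: cvg_cst.
    apply: (@continuous_min _ _ (cst s)); first exact: cvg_cst.
    apply: (@cvgB _ R^o); last exact: cvg_cst.
    by apply: (@cvgM _ _ _ _ (cst 2)); [exact: cvg_cst|exact: cvg_id].
  apply: continuous_asin; rewrite lt_max gt_max; apply/andP; split; first by apply/orP; left; lra.
  by rewrite gt_min; apply/andP; split; [lra|apply/orP; left; lra].
have GM x : `|G x| <= M by exact: gM.
have e20 : 0 < e / 2 by rewrite divr_gt0.
have [dl dl0 Gdl] := continuous_unif_segment G 0 1 (e / 2) cG e20.
have [n n0 nE] : exists2 n, (0 < n)%N & 2 * M / (n%:R * dl ^+ 2) <= e / 2.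
  exists (Num.truncn (2 * M / (dl ^+ 2 * (e / 2)))).+1 => //.
  set N := (Num.truncn _).+1%:R; rewrite ler_pdivrMr ?mulr_gt0 ?exprn_gt0//.
  rewrite (_ : e / 2 * _ = N * (dl ^+ 2 * (e / 2))); last by ring.
  rewrite -ler_pdivrMr ?mulr_gt0 ?exprn_gt0// ltW//.
  exact: truncnS_gt.
pose u (x : R) := 2^-1 + 2^-1 * sin (x / (2 * K)).
have u01 x : 0 <= u x <= 1.
  have := sin_max (x / (2 * K)); rewrite ler_norml /u => /andP[? ?].
  by apply/andP; split; lra.
exists (fun x => bernstein n (u x) (fun k => G (k%:R / n%:R))); split.
- apply: trigpoly_bernstein.
  have := trigpolyD _ _ (trigpoly_cst 2^-1) (trigpolyZ 2^-1 _ (trigpoly_cos (2 * K)^-1 (- (pi / 2)))).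
  by congr trigpoly; apply/funext => x /=; rewrite /u cosBpihalf (mulrC _ x).
- move=> x; rewrite -[leRHS](bernstein_cst n (u x)); apply: bernstein_norm => //.
- move=> x xK.
  have -> : g x = G (u x).
    rewrite /G /u (_ : 2 * _ - 1 = sin (x / (2 * K))); last by field.
    have : `|x / (2 * K)| <= 2^-1.
      by rewrite normrM normfV (gtr0_norm L0) ler_pdivrMr// mulrA mulVf// mul1r.
    rewrite ler_norml => /andP[x1 x2].
    have xs : - s <= sin (x / (2 * K)) <= s.
      by rewrite /s -sinN !leNgt !ltr_sin -?leNgt ?x1// in_itv/=; apply/andP; split; lra.
    move/andP: xs => [xs1 xs2].
    rewrite (min_idPr xs2) (max_idPr xs1) sinK.
      by rewrite mulrC divfK ?gt_eqF.
    by rewrite in_itv/=; apply/andP; split; lra.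
  rewrite distrC (le_trans (bernstein_approx G M dl (e / 2) n (u x) (u01 x) dl0 n0 GM _))//.
    by move=> y; apply: Gdl.
  by rewrite [leRHS]splitr lerD2l.
Qed.

(** * The cosine transform of the standard normal law *)

Lemma integral_normal_prob {R : realType} (m s : R) (f : R -> \bar R) :
  (normal_prob m s).-integrable setT f ->
  (\int[normal_prob m s]_x f x =
   \int[lebesgue_measure]_x (f x * (normal_pdf m s x)%:E))%E.
Proof.
move=> intf.
have dom := normal_prob_dominates m s.
have mf := measurable_int _ intf.
rewrite -(Radon_Nikodym_change_of_variables dom)//=.
apply: ae_eq_integral => //.
- apply: emeasurable_funM => //; apply: (measurable_int lebesgue_measure).
- apply: emeasurable_funM => //=; apply/measurable_EFinP.
  exact: measurable_normal_pdf.
- apply: ae_eqe_mul2l => /=.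
  rewrite Radon_NikodymE//=.
  case: cid => /= h [h1 h2 h3].
  apply: integral_ae_eq => //=.
  + by apply/measurable_EFinP; exact: measurable_normal_pdf.
  + by move=> E E01 mE; rewrite -h3.
Qed.

Lemma normal_pdf01E {R : realType} (x : R) :
  normal_pdf 0 1 x = normal_peak 1 * expR (- (x ^+ 2 / 2)).
Proof. by rewrite normal_pdfE ?oner_eq0// /normal_fun subr0 expr1n mulNr. Qed.

Global Instance is_derive_normal_pdf01 {R : realType} (x : R) :
  is_derive x 1 (normal_pdf 0 1) (- x * normal_pdf 0 1 x).
Proof.
rewrite (_ : normal_pdf 0 1 = fun y : R => normal_peak 1 * expR (- (y ^+ 2 / 2))).
  apply: is_derive_eq.
  by rewrite /GRing.scale/= /GRing.scale/=; field.
by apply/funext => y; rewrite normal_pdf01E.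
Qed.

Lemma continuous_normal_pdf01 {R : realType} : continuous (normal_pdf (0 : R) 1).
Proof. by apply: continuous_normal_pdf; rewrite oner_eq0. Qed.

Lemma cvg_normal_pdf01 {R : realType} : normal_pdf (0 : R) 1 x @[x --> +oo] --> 0.
Proof.
rewrite (_ : normal_pdf 0 1 = fun y : R => normal_peak 1 * expR (- (y ^+ 2 / 2))).
  rewrite -(mulr0 (normal_peak 1)); apply: cvgM; first exact: cvg_cst.
  apply: (cvg_comp (fun x : R => x ^+ 2 / 2) (fun x => expR (- x))); last exact: cvgr_expR.
  by apply: gt0_cvgMly; [rewrite invr_gt0|exact: cvgr_expr2].
by apply/funext => y; rewrite normal_pdf01E.
Qed.

Lemma normal_pdf01N {R : realType} (x : R) : normal_pdf 0 1 (- x) = normal_pdf 0 1 x.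
Proof. by rewrite !normal_pdf01E sqrrN. Qed.

(** On the positive half-line [- normal_pdf 0 1] is an antiderivative of the integrand; symmetry
    does the rest. *)
Lemma integrable_norm_normal_pdf {R : realType} :
  lebesgue_measure.-integrable setT (fun x : R => (`|x| * normal_pdf 0 1 x)%:E).
Proof.
have cf : continuous (fun x : R => `|x| * normal_pdf 0 1 x).
  move=> x; apply: cvgM; last exact: continuous_normal_pdf01.
  exact: (@norm_continuous _ R^o).
have f0 (x : R) : 0 <= `|x| * normal_pdf 0 1 x by rewrite mulr_ge0 ?normal_pdf_ge0.
apply/integrableP; split.
  by apply/measurable_EFinP; exact: continuous_measurable_fun.
under eq_integral do rewrite /= ger0_norm//.
rewrite ge0_symfun_integralT//; last by move=> x /=; rewrite normrN normal_pdf01N.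
rewrite (_ : [set x | _] = `[0, +oo[%classic); last first.
  by apply/seteqP; split => x/=; rewrite in_itv/= andbT.
rewrite (_ : (\int[_]_(x in _) _ = (0 : R)%:E - (- normal_pdf 0 1 0)%:E)%E).
  by rewrite -EFinB -EFinM ltry.
apply: (@ge0_continuous_FTC2y _ (fun x => `|x| * normal_pdf 0 1 x) (fun x => - normal_pdf 0 1 x)) => //.
- exact: continuous_subspaceT.
- by rewrite -[X in _ --> X]oppr0; apply: (@cvgN _ R^o); exact: cvg_normal_pdf01.
- apply: cvg_at_right_filter; apply: (@cvgN _ R^o); exact: continuous_normal_pdf01.
- move=> x; rewrite in_itv/= andbT => x0.
  rewrite derive1E derive_val.
  by rewrite gtr0_norm// mulNr opprK.
Qed.

Lemma le_integrableR {d} {T : measurableType d} {R : realType}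
    (mu : {measure set T -> \bar R}) (f g : T -> R) :
  measurable_fun setT f -> (forall x, `|f x| <= g x) ->
  mu.-integrable setT (EFin \o g) -> mu.-integrable setT (EFin \o f).
Proof.
move=> mf fg; apply: le_integrable => //.
  exact/measurable_EFinP.
by move=> x _; rewrite lee_fin (le_trans (fg x))// ler_norm.
Qed.

(** The integrand is the derivative of [sin (t x + c)] times the density, which vanishes at both
    infinities. This integration by parts is what produces the differential equation of the cosine
    transform. *)
Lemma integral_ddx_sin_normal_pdf {R : realType} (t c : R) :
  \int[lebesgue_measure]_x ((t * cos (t * x + c) - x * sin (t * x + c)) * normal_pdf 0 1 x) = 0.
Proof.
set f := fun x : R => _.
pose F (x : R) := sin (t * x + c) * normal_pdf 0 1 x.
have dF (x : R) : is_derive x (1 : R) F (f x).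
  apply: is_derive_eq; rewrite /f /GRing.scale/= /GRing.scale/= !mulr1 ; ring.
have cf : continuous f.
  have ct (u : R -> R) : continuous u -> continuous (fun x => u (t * x + c)).
    move=> cu x; apply: (@continuous_comp _ _ _ (fun x => t * x + c) u); last exact: cu.
    by apply: (@cvgD _ R^o); [apply: (@cvgM _ _ _ _ (cst t)); [exact: cvg_cst|exact: cvg_id]|exact: cvg_cst].
  move=> x; apply: cvgM; last exact: continuous_normal_pdf01.
  apply: (@cvgB _ R^o).
    apply: (@cvgM _ _ _ _ (cst t)); first exact: cvg_cst.
    exact: (ct cos (@continuous_cos R)).
  apply: cvgM; first exact: cvg_id.
  exact: (ct sin (@continuous_sin R)).
have mf : measurable_fun setT f by exact: continuous_measurable_fun.
have fub x : `|f x| <= `|t| * normal_pdf 0 1 x + `|x| * normal_pdf 0 1 x.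
  rewrite /f normrM (ger0_norm (normal_pdf_ge0 _ _ _)) -mulrDl ler_wpM2r ?normal_pdf_ge0//.
  rewrite (le_trans (ler_normB _ _))// !normrM lerD// ler_piMr// ?cos_max ?sin_max//.
have intg : lebesgue_measure.-integrable setT (EFin \o (fun x : R => `|t| * normal_pdf 0 1 x + `|x| * normal_pdf 0 1 x)).
  rewrite /comp; under eq_fun do rewrite EFinD EFinM.
  apply: integrableD => //; last exact: integrable_norm_normal_pdf.
  by apply: integrableZl => //; exact: integrable_normal_pdf.
(* The integrals over [[-n, n]] are given by the fundamental theorem and converge, by domination, to
   the integral over the line. *)
pose fn (n : nat) := f \_ (`[- n%:R, n%:R]).
have [] := @dominated_convergence _ _ _ (@lebesgue_measure R) setT measurableT
  (fun n => EFin \o fn n) (EFin \o f)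
  (EFin \o (fun x : R => `|t| * normal_pdf 0 1 x + `|x| * normal_pdf 0 1 x)).
- move=> n; apply/measurable_EFinP; rewrite /fn.
  by apply/measurable_restrict => //; rewrite setTI; exact: measurable_funS mf.
- exact/measurable_EFinP.
- apply: aeW => /= x _; apply: cvg_EFin; first exact: nearW.
  apply: cvg_near_cst; near=> n; rewrite /= /fn patchE ifT//.
  rewrite inE/= in_itv/= -ler_norml.
  near: n; exact: nbhs_infty_ger.
- exact: intg.
- apply: aeW => /= x n _; rewrite lee_fin /fn patchE; case: ifPn => // _.
  by rewrite normr0 (le_trans _ (fub x)).
move=> _ _ cv.
suff cv0 : (\int[lebesgue_measure]_x (fn n x)%:E)%E @[n --> \oo] --> 0%E.
  rewrite /Rintegral; have := cvg_unique _ cv cv0 => /= -> //.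
have Fn : (fun n : nat => (F n%:R - F (- n%:R))%:E) @ \oo --> (0 : R)%:E.
  apply: cvg_EFin; first exact: nearW.
  apply: norm_cvg0.
  apply: (@squeeze_cvgr _ _ _ _ (cst 0) (fun n : nat => 2 * normal_pdf (0:R) 1 n%:R)).
  - apply: nearW => n /=; rewrite normr_ge0/= /F normal_pdf01N -mulrBl normrM.
    rewrite (ger0_norm (normal_pdf_ge0 _ _ _)) ler_wpM2r ?normal_pdf_ge0//.
    rewrite (le_trans (ler_normB _ _))//.
    by have := sin_max (t * n%:R + c); have := sin_max (t * - n%:R + c); lra.
  - exact: cvg_cst.
  - rewrite -[X in _ --> X](mulr0 2); apply: cvgM; first exact: cvg_cst.
    by apply: (cvg_comp _ _ cvgr_idn); exact: cvg_normal_pdf01.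
apply: cvg_trans Fn; apply: near_eq_cvg; near=> n.
have n0 : (0 < n)%N by near: n; exact: nbhs_infty_gt.
rewrite EFinB -(@continuous_FTC2 _ f F)//.
- by rewrite integral_mkcond restrict_EFin.
- by rewrite gtrN// ltr0n.
- exact: continuous_subspaceT.
- have cF : continuous F.
    by move=> x; apply/differentiable_continuous/derivable1_diffP; exact: ex_derive.
  split => //.
  + by apply: cvg_at_right_filter; exact: cF.
  + by apply: cvg_at_left_filter; exact: cF.
- by move=> x _; rewrite derive1E derive_val.
Unshelve. all: by end_near. Qed.

Lemma integrableRZ {d} {T : measurableType d} {R : realType}
    (mu : {measure set T -> \bar R}) (a : R) (f : T -> R) :
  mu.-integrable setT (EFin \o f) -> mu.-integrable setT (EFin \o (fun x => a * f x)).
Proof. by move=> intf; exact: (integrableZl measurableT a intf). Qed.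

Lemma integrableRD {d} {T : measurableType d} {R : realType}
    (mu : {measure set T -> \bar R}) (f g : T -> R) :
  mu.-integrable setT (EFin \o f) -> mu.-integrable setT (EFin \o g) ->
  mu.-integrable setT (EFin \o (fun x => f x + g x)).
Proof. by move=> intf intg; exact: (integrableD measurableT intf intg). Qed.

Lemma integrableRB {d} {T : measurableType d} {R : realType}
    (mu : {measure set T -> \bar R}) (f g : T -> R) :
  mu.-integrable setT (EFin \o f) -> mu.-integrable setT (EFin \o g) ->
  mu.-integrable setT (EFin \o (fun x => f x - g x)).
Proof. by move=> intf intg; exact: (integrableB measurableT intf intg). Qed.

Lemma continuous_cos_affine {R : realType} (t c : R) : continuous (fun x => cos (t * x + c)).
Proof.
move=> x; apply: (@continuous_comp _ _ _ (fun x => t * x + c) cos); last exact: continuous_cos.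
by apply: (@cvgD _ R^o); [apply: (@cvgM _ _ _ _ (cst t)); [exact: cvg_cst|exact: cvg_id]|exact: cvg_cst].
Qed.

Lemma integrable_bounded {d} {T : measurableType d} {R : realType}
    (P : probability T R) (f : T -> R) (M : R) :
  measurable_fun setT f -> (forall x, `|f x| <= M) ->
  P.-integrable setT (EFin \o f).
Proof.
move=> mf fM; apply: (le_integrableR P f (cst M)) => //.
exact: finite_measure_integrable_cst.
Qed.

Lemma integrable_cstR {d} {T : measurableType d} {R : realType} (P : probability T R)
    (c : R) : P.-integrable setT (EFin \o (fun=> c)).
Proof. by apply: (integrable_bounded P _ `|c|). Qed.

Lemma integrable_indicR {d} {T : measurableType d} {R : realType} (P : probability T R)
    (A : set T) : measurable A -> P.-integrable setT (EFin \o (\1_A : T -> R)).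
Proof.
move=> mA; apply: (integrable_bounded P _ 1) => // t.
by rewrite indicE normr_nat lern1 leq_b1.
Qed.

(** As a function of [t] the integral [J] solves [J' = - t J], so [J t] times [exp (t^2 / 2)] is
    constant, equal to [J 0 = cos c]. *)
Lemma normal_cos_lebesgue {R : realType} (t c : R) :
  \int[lebesgue_measure]_x (cos (t * x + c) * normal_pdf 0 1 x) =
  expR (- (t ^+ 2 / 2)) * cos c.
Proof.
pose J (t : R) := \int[lebesgue_measure]_x (cos (t * x + c) * normal_pdf 0 1 x).
have mcos (s : R) : measurable_fun setT (fun x : R => cos (s * x + c) * normal_pdf 0 1 x).
  apply: measurable_funM; last exact: measurable_normal_pdf.
  by apply: continuous_measurable_fun; exact: continuous_cos_affine.
have intJ (s : R) : lebesgue_measure.-integrable setT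
    (EFin \o (fun x : R => cos (s * x + c) * normal_pdf 0 1 x)).
  apply: (@le_integrableR _ _ _ (@lebesgue_measure R) _ (normal_pdf (0 : R) 1)) => //; last exact: integrable_normal_pdf.
    exact: mcos.
  move=> x; rewrite normrM (ger0_norm (normal_pdf_ge0 _ _ _)).
  by rewrite ler_piMl ?normal_pdf_ge0// cos_max.
have dcos (s x : R) : is_derive (s : R) (1 : R) (fun s : R => cos (s * x + c) * normal_pdf 0 1 x)
    (- x * sin (s * x + c) * normal_pdf 0 1 x).
  by apply: is_derive_eq; rewrite /GRing.scale/= /GRing.scale/=; ring.
pose f (s x : R) := cos (s * x + c) * normal_pdf 0 1 x.
have d1f (s x : R) : partial1of2 f s x = - x * sin (s * x + c) * normal_pdf 0 1 x.
  by rewrite partial1of2E /f derive_val.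
have Gub (s x : R) : `|- x * sin (s * x + c) * normal_pdf 0 1 x| <= `|x| * normal_pdf 0 1 x.
  rewrite !normrM normrN (ger0_norm (normal_pdf_ge0 _ _ _)) ler_wpM2r ?normal_pdf_ge0//.
  by rewrite ler_piMr// sin_max.
have dJ (s : R) : is_derive s (1 : R) J (- s * J s).
  have Is : (`]s - 1, s + 1[%classic : set R) s.
    by rewrite /= in_itv/= ltrDl ltrBlDr ltrDl ltr01.
  have derf1 (x : R) (y : measurableTypeR R) :
    (`]s - 1, s + 1[%classic : set R) x -> [set: measurableTypeR R] y -> derivable (f ^~ y) x 1.
    by move=> _ _; exact: ex_derive.
  have G0 (y : measurableTypeR R) : 0 <= `|y : R| * normal_pdf 0 1 (y : R).
    by rewrite mulr_ge0// normal_pdf_ge0.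
  have Gub' (x : R) (y : measurableTypeR R) :
    (`]s - 1, s + 1[%classic : set R) x -> [set: measurableTypeR R] y ->
    `|partial1of2 f x y| <= `|y : R| * normal_pdf 0 1 (y : R).
    by move=> _ _; rewrite d1f.
  have H1 := @differentiation_under_integral R _ _ (@lebesgue_measure R) f setT measurableT
    s (s - 1) (s + 1) Is (fun x _ => intJ x) derf1 _ G0 integrable_norm_normal_pdf Gub'.
  have H2 := @derivable_under_integral R _ _ (@lebesgue_measure R) f setT measurableT
    s (s - 1) (s + 1) Is (fun x _ => intJ x) derf1 _ G0 integrable_norm_normal_pdf Gub'.
  apply: DeriveDef; first exact: H2.
  rewrite -derive1E H1.
  transitivity (\int[lebesgue_measure]_x ((s * cos (s * x + c) - x * sin (s * x + c)) * normal_pdf 0 1 x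
      - s * (cos (s * x + c) * normal_pdf 0 1 x))).
    by apply: eq_Rintegral => y _; rewrite d1f; ring.
  have ints : lebesgue_measure.-integrable setT
      (EFin \o (fun x : R => s * (cos (s * x + c) * normal_pdf 0 1 x))).
    exact: integrableRZ.
  rewrite RintegralB//.
    by rewrite integral_ddx_sin_normal_pdf RintegralZl// sub0r mulNr.
  rewrite (_ : (fun x => _) = (fun x : R => - x * sin (s * x + c) * normal_pdf 0 1 x + s * (cos (s * x + c) * normal_pdf 0 1 x))); last first.
    by apply/funext => x; ring.
  apply: integrableRD => //.
  apply: (@le_integrableR _ _ _ (@lebesgue_measure R) _ _ _ (Gub s)); last exact: integrable_norm_normal_pdf.
  suff m0 : measurable_fun setT (fun x : R => - x * sin (s * x + c) * normal_pdf 0 1 x) by exact: m0.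
  apply: continuous_measurable_fun.
  by move=> x; apply/differentiable_continuous/derivable1_diffP; exact: ex_derive.
pose H (s : R) := J s * expR (s ^+ 2 / 2).
have dH (s : R) : is_derive s (1 : R) H 0.
  apply: is_derive_eq; rewrite /GRing.scale/=; by field.
have := is_derive_0_is_cst t 0 dH.
rewrite /H expr0n/= mul0r expR0 mulr1 => H0.
rewrite -/(J t) -[LHS]mulr1 -[X in _ * X](expRxMexpNx_1 (t ^+ 2 / 2)) mulrA H0 mulrC.
congr (_ * _); rewrite /J.
transitivity (\int[lebesgue_measure]_x (cos c * normal_pdf (0 : R) 1 x)).
  by apply: eq_Rintegral => x _; rewrite mul0r add0r.
rewrite RintegralZl//; last exact: integrable_normal_pdf.
by rewrite /Rintegral integral_normal_pdf mulr1.
Qed.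

Lemma normal_cos {R : realType} (t c : R) :
  \int[normal_prob 0 1]_x cos (t * x + c) = expR (- (t ^+ 2 / 2)) * cos c.
Proof.
rewrite -normal_cos_lebesgue /Rintegral integral_normal_prob//.
apply: (@integrable_bounded _ _ _ (normal_prob 0 1) _ 1); last by move=> x; exact: cos_max.
by apply: continuous_measurable_fun; exact: continuous_cos_affine.
Qed.

(** * Tightness and the continuity theorem *)

Lemma Rintegral_indic {d} {T : measurableType d} {R : realType}
    (P : probability T R) (A : set T) : measurable A ->
  \int[P]_x \1_A x = fine (P A).
Proof. by move=> mA; rewrite /Rintegral integral_indic// setIT. Qed.

Lemma Rintegral_prob_cst {d} {T : measurableType d} {R : realType}
    (P : probability T R) (c : R) : \int[P]_x c = c.
Proof.
rewrite Rintegral_cst//.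
rewrite (_ : fine _ = 1) ?mulr1//.
by rewrite -[RHS]/(fine 1%E); congr fine; exact: probability_setT.
Qed.

Lemma measurable_gt_norm {d} {T : measurableType d} {R : realType} (X : T -> R) (K : R) :
  measurable_fun setT X -> measurable [set x | K < `|X x|].
Proof.
move=> mX.
have mN : measurable_fun setT (fun x => `|X x|) by exact: measurableT_comp.
have := measurable_fun_ltr (@measurable_cst _ _ T R setT K) mN.
move=> /(_ measurableT [set true]); rewrite setTI => /(_ I); congr measurable.
Qed.

Lemma tight1 {d} {T : measurableType d} {R : realType}
    (P : probability T R) (X : T -> R) (e : R) : measurable_fun setT X -> 0 < e ->
  exists2 K : R, 0 < K & fine (P [set x | K < `|X x|]) <= e.
Proof.
move=> mX e0.
pose F (n : nat) : set T := [set x | n%:R < `|X x|].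
have mF n : measurable (F n) by exact: measurable_gt_norm.
have F0 : \bigcap_n F n = set0.
  rewrite -subset0 => x Fx.
  have := Fx (Num.truncn `|X x|).+1 I; rewrite /F/=.
  by rewrite ltNge ltW// truncnS_gt.
have := @nonincreasing_cvg_mu _ _ _ P F.
rewrite F0 measure0 => /(_ _ mF measurable0) H.
have {}H : (P \o F) n @[n --> \oo] --> 0%E.
  apply: H; first by rewrite (le_lt_trans (probability_le1 _ _))// ltry.
  move=> n m nm; apply/subsetPset => x; rewrite /F/=; apply: le_lt_trans.
  by rewrite ler_nat.
have : (fun n => fine (P (F n))) @ \oo --> 0 by exact: fine_cvg.
move=> /cvgr0Pnorm_le/(_ _ e0)[N _ HN].
exists N.+1%:R => //.
by rewrite (le_trans (ler_norm _))// (HN N.+1)/=.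
Qed.

Lemma Rintegral_indic_le {d} {T : measurableType d} {R : realType} (P : probability T R)
    (f : T -> R) (A : set T) (c M : R) : measurable_fun setT f -> measurable A ->
  (forall t, 0 <= f t <= c + M * \1_A t) -> \int[P]_t f t <= c + M * fine (P A).
Proof.
move=> mf mA fA.
have i1 := integrable_indicR P _ mA; have ic := integrable_cstR P c.
have i2 := integrableRD _ _ _ ic (integrableRZ _ M _ i1).
have i3 : P.-integrable setT (EFin \o f).
  apply: (le_integrableR P _ _ mf _ i2) => t.
  by have /andP[h1 h2] := fA t; rewrite ger0_norm.
rewrite -(Rintegral_indic P _ mA) -(RintegralZl _ _ i1)// -[c](Rintegral_prob_cst P).
rewrite -(RintegralD _ ic (integrableRZ _ M _ i1))//; apply: le_Rintegral => // t _.
by case/andP: (fA t).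
Qed.

Lemma integral_approx {d} {T : measurableType d} {R : realType}
    (P : probability T R) (w X : T -> R) (g q : R -> R) (K M e e' : R) :
  measurable_fun setT w -> (forall x, 0 <= w x <= 1) ->
  measurable_fun setT X -> measurable_fun setT g -> measurable_fun setT q ->
  (forall x, `|g x| <= M) -> (forall x, `|q x| <= M) ->
  (forall x, `|x| <= K -> `|g x - q x| <= e) -> 0 <= e ->
  fine (P [set x | K < `|X x|]) <= e' ->
  `|\int[P]_x (w x * g (X x)) - \int[P]_x (w x * q (X x))| <= e + 2 * M * e'.
Proof.
move=> mw w01 mX mg mq gM qM gq e0 PK.
have M0 : 0 <= M by exact: le_trans (gM 0).
have wb (h : R -> R) : (forall x, `|h x| <= M) -> forall x, `|w x * h (X x)| <= M.
  move=> hM x; rewrite normrM -[leRHS]mul1r ler_pM//.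
  by case/andP: (w01 x) => w0 w1; rewrite ger0_norm.
have mwh (h : R -> R) : measurable_fun setT h -> measurable_fun setT (fun x => w x * h (X x)).
  by move=> mh; apply: measurable_funM => //; exact: measurableT_comp.
have ig : P.-integrable setT (EFin \o (fun x => w x * g (X x))).
  exact: (integrable_bounded _ _ M (mwh _ mg) (wb _ gM)).
have iq : P.-integrable setT (EFin \o (fun x => w x * q (X x))).
  exact: (integrable_bounded _ _ M (mwh _ mq) (wb _ qM)).
rewrite -RintegralB//.
have iB := integrableRB _ _ _ ig iq.
rewrite (le_trans (le_normr_Rintegral _ iB))//.
have mK := measurable_gt_norm X K mX.
apply: (@le_trans _ _ (e + 2 * M * fine (P [set x | K < `|X x|]))); last first.
  by rewrite lerD2l ler_wpM2l// mulr_ge0.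
apply: Rintegral_indic_le => //.
  by apply: measurableT_comp => //; apply: measurable_funB; exact: mwh.
move=> x; rewrite normr_ge0/= -mulrBr normrM.
rewrite (le_trans (_ : _ <= `|g (X x) - q (X x)|))//.
  by case/andP: (w01 x) => w0 w1; rewrite ler_piMl// ger0_norm.
rewrite indicE; have [xK|xK] := ltP K `|X x|.
  rewrite mem_set// mulr1 (le_trans (ler_normB _ _))//.
  by have := gM (X x); have := qM (X x); lra.
rewrite memNset ?mulr0 ?addr0; last by apply/negP; rewrite -leNgt.
exact: gq.
Qed.

Lemma trigpoly_continuous {R : realType} (p : R -> R) : trigpoly p -> continuous p.
Proof.
elim=> [t c|f g _ cf _ cg|a f _ cf] x; first exact: continuous_cos_affine.
- by apply: (@cvgD _ R^o); [exact: cf|exact: cg].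
- by apply: (@cvgM _ _ _ _ (cst a)); [exact: cvg_cst|exact: cf].
Qed.

Lemma trigpoly_bounded {R : realType} (p : R -> R) : trigpoly p ->
  exists M : R, forall x, `|p x| <= M.
Proof.
elim=> [t c|f g _ [M fM] _ [M' gM]|a f _ [M fM]].
- by exists 1 => x; exact: cos_max.
- by exists (M + M') => x; rewrite (le_trans (ler_normD _ _))// lerD.
- by exists (`|a| * M) => x; rewrite normrM ler_wpM2l.
Qed.

(* Levy's continuity theorem: tightness and the density of trigonometric
   polynomials replace the inversion formula. *)
Lemma cvg_normal_cos {d} {T : measurableType d} {R : realType}
    (P : probability T R) (w : T -> R) (X : nat -> T -> R) (p v : R) :
  measurable_fun setT w -> (forall x, 0 <= w x <= 1) ->
  (forall n, measurable_fun setT (X n)) -> 0 <= v -> 0 <= p ->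
  (forall t c, (fun n => \int[P]_x (w x * cos (t * X n x + c))) @ \oo -->
     p * (expR (- (t ^+ 2 * v / 2)) * cos c)) ->
  (forall e : R, 0 < e -> exists2 K : R, 0 < K &
     forall n, fine (P [set x | K < `|X n x|]) <= e) ->
  forall g : R -> R, continuous g -> (exists M : R, forall x, `|g x| <= M) ->
  (fun n => \int[P]_x (w x * g (X n x))) @ \oo -->
    p * \int[normal_prob 0 1]_x g (Num.sqrt v * x).
Proof.
move=> mw w01 mX v0 p0 Hcos tight g cg [M gM].
have M0 : 0 <= M by exact: le_trans (gM 0).
have wb (h : R -> R) n (M' : R) : (forall x, `|h x| <= M') -> forall x, `|w x * h (X n x)| <= M'.
  move=> hM x; rewrite normrM -[leRHS]mul1r ler_pM//.
  by case/andP: (w01 x) => w0 w1; rewrite ger0_norm.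
have mwh (h : R -> R) n : measurable_fun setT h -> measurable_fun setT (fun x => w x * h (X n x)).
  by move=> mh; apply: measurable_funM => //; exact: measurableT_comp.
have ms : measurable_fun setT (fun x : R => Num.sqrt v * x).
  exact: measurable_funM.
have msh (h : R -> R) : measurable_fun setT h ->
    measurable_fun setT (fun x : R => h (Num.sqrt v * x)).
  by move=> mh; exact: measurableT_comp.
have ims (h : R -> R) (M' : R) : continuous h -> (forall x, `|h x| <= M') ->
    (normal_prob 0 1).-integrable setT (EFin \o (fun x : R => h (Num.sqrt v * x))).
  move=> ch hM; apply: (@integrable_bounded _ _ _ (normal_prob 0 1) _ M') => //.
  exact: (msh _ (continuous_measurable_fun ch)).
have iwh (h : R -> R) (M' : R) n : continuous h -> (forall x, `|h x| <= M') ->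
    P.-integrable setT (EFin \o (fun x => w x * h (X n x))).
  move=> ch hM; apply: (integrable_bounded _ _ M'); last exact: wb.
  exact: (mwh _ _ (continuous_measurable_fun ch)).
have Htrig q : trigpoly q -> (fun n => \int[P]_x (w x * q (X n x))) @ \oo -->
    p * \int[normal_prob 0 1]_x q (Num.sqrt v * x).
  elim=> [t c|f h tf IHf th IHh|a f tf IHf].
  - have -> : \int[normal_prob 0 1]_x cos (t * (Num.sqrt v * x) + c) =
        expR (- (t ^+ 2 * v / 2)) * cos c.
      rewrite -[in RHS](sqr_sqrtr v0) -exprMn -normal_cos.
      by apply: eq_Rintegral => x _; rewrite mulrA.
    exact: Hcos.
  - have [cf ch] := (trigpoly_continuous _ tf, trigpoly_continuous _ th).
    have [[Mf fM] [Mh hM]] := (trigpoly_bounded _ tf, trigpoly_bounded _ th).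
    rewrite RintegralD//; [|exact: ims fM|exact: ims hM].
    rewrite mulrDr [X in X @ _ --> _](_ : _ =
        (fun n => \int[P]_x (w x * f (X n x)) + \int[P]_x (w x * h (X n x)))).
      exact: (@cvgD _ R^o).
    apply/funext => n; rewrite -RintegralD//; [|exact: iwh fM|exact: iwh hM].
    by apply: eq_Rintegral => x _; rewrite mulrDr.
  - have cf := trigpoly_continuous _ tf; have [Mf fM] := trigpoly_bounded _ tf.
    rewrite RintegralZl//; last exact: ims fM.
    rewrite mulrCA [X in X @ _ --> _](_ : _ =
        (fun n => a * \int[P]_x (w x * f (X n x)))).
      by apply: (@cvgM _ _ _ _ (cst a)) => //; exact: cvg_cst.
    apply/funext => n; rewrite -RintegralZl//; last exact: iwh fM.
    by apply: eq_Rintegral => x _; rewrite mulrCA.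
apply/cvgrPdist_le => eps eps0.
(* [D] is the sum of the coefficients of [e] in the final three-term estimate: [1 + 2 M] for the
   chain, [p] times that for the normal law, and 1 for the trigonometric polynomial. *)
pose D : R := (1 + 2 * M) * (1 + p) + 1.
have D0 : 0 < D by rewrite ltr_wpDl// mulr_ge0 ?addr_ge0 ?mulr_ge0.
pose e := eps / D.
have e0 : 0 < e by rewrite divr_gt0.
have [K1 K10 HK1] := tight _ e0.
have [K2 K20 HK2] := @tight1 _ _ _ (normal_prob 0 1) _ e ms e0.
have K0 : 0 < Num.max K1 K2 by rewrite lt_max K10.
have [q [tq qM gq]] := trigpoly_approx g M _ e cg gM K0 e0.
have cq := trigpoly_continuous _ tq.
have [mg mq] := (continuous_measurable_fun cg, continuous_measurable_fun cq).
have := Htrig _ tq => /cvgrPdist_le /(_ _ e0).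
apply: filterS => n Hn.
have A1 : `|\int[P]_x (w x * g (X n x)) - \int[P]_x (w x * q (X n x))| <= e + 2 * M * e.
  apply: (integral_approx P w (X n) g q K1) => //.
    by move=> x xK; apply: gq; rewrite le_max xK.
  exact: ltW.
have A2 : `|\int[normal_prob 0 1]_x g (Num.sqrt v * x) - \int[normal_prob 0 1]_x q (Num.sqrt v * x)|
    <= e + 2 * M * e.
  have := @integral_approx _ _ _ (normal_prob 0 1) (cst 1) (fun x : R => Num.sqrt v * x) g q K2 M e e.
  have E (h : R -> R) : \int[normal_prob 0 1]_x (cst 1 x * h (Num.sqrt v * x)) =
      \int[normal_prob 0 1]_x h (Num.sqrt v * x).
    by apply: eq_Rintegral => x _; rewrite mul1r.
  rewrite !E; apply => //.
    by move=> x; rewrite ler01 lexx.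
    by move=> x xK; apply: gq; rewrite le_max xK orbT.
  exact: ltW.
move: Hn A1 A2.
set a1 := \int[P]_x _; set a2 := \int[P]_x _; set b1 := \int[_]_x _; set b2 := \int[_]_x _.
move=> Hn A1 A2.
have -> : p * b2 - a2 = p * (b2 - b1) + (p * b1 - a1) - (a2 - a1) by ring.
rewrite (le_trans (ler_normB _ _))//.
have -> : eps = p * (e + 2 * M * e) + e + (e + 2 * M * e).
  by rewrite /e /D; field; rewrite gt_eqF.
rewrite lerD// (le_trans (ler_normD _ _))// lerD// normrM (ger0_norm p0) ler_wpM2l//.
Qed.

Lemma normal2_linear_comb {R : realType} (a b v : R) (G : R -> R) :
  a ^+ 2 + b ^+ 2 = v -> continuous G -> (exists M : R, forall x, `|G x| <= M) ->
  \int[(normal_prob (0 : R) 1 \x normal_prob (0 : R) 1)%E]_w G (a * w.1 + b * w.2) =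
  \int[normal_prob 0 1]_x G (Num.sqrt v * x).
Proof.
move=> abv cG bG.
have v0 : 0 <= v by rewrite -abv addr_ge0// sqr_ge0.
pose N2 : probability _ R := (normal_prob (0 : R) 1 \x normal_prob (0 : R) 1)%E.
pose X (w : R * R) : R := a * w.1 + b * w.2.
have mX : measurable_fun setT X.
  by apply: measurable_funD; apply: measurable_funM.
have mcX t c : measurable_fun setT (fun w => cos (t * X w + c)).
  apply: (measurableT_comp (f := fun x => cos (t * x + c))) => //.
  by apply: continuous_measurable_fun; exact: continuous_cos_affine.
have Hcos t c : \int[N2]_w cos (t * X w + c) = expR (- (t ^+ 2 * v / 2)) * cos c.
  have icX : N2.-integrable setT (EFin \o (fun w => cos (t * X w + c))).
    by apply: (@integrable_bounded _ _ _ N2 _ 1 (mcX t c)) => w; exact: cos_max.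
  have inner (x : R) : (\int[normal_prob 0 1]_y (cos (t * X (x, y) + c))%:E)%E =
      (expR (- ((t * b) ^+ 2 / 2)) * cos (t * a * x + c))%:E.
    rewrite -normal_cos fineK.
      by apply: eq_integral => y _; rewrite /X/=; congr (cos _)%:E; ring.
    apply: integrable_fin_num => //.
    apply: (@integrable_bounded _ _ _ (normal_prob 0 1) _ 1); last by move=> y; exact: cos_max.
    by apply: continuous_measurable_fun; exact: continuous_cos_affine.
  rewrite /Rintegral -(integral12_prod_meas1 icX) /fubini_F.
  under eq_integral do rewrite inner.
  rewrite -/(Rintegral _ _ _) RintegralZl//; last first.
    apply: (@integrable_bounded _ _ _ (normal_prob 0 1) _ 1); last by move=> y; exact: cos_max.
    by apply: continuous_measurable_fun; exact: continuous_cos_affine.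
  rewrite normal_cos mulrA -expRD; congr (expR _ * _).
  by rewrite -abv; field.
(* Applied to a constant sequence, the continuity theorem says that a law is determined by its
   cosine transform. *)
have := @cvg_normal_cos _ _ _ N2 (cst 1) (fun=> X) 1 v _ _ _ v0 ler01.
have E (h : R -> R) : \int[N2]_x (cst 1 x * h (X x)) = \int[N2]_x h (X x).
  by apply: eq_Rintegral => x _; rewrite mul1r.
move=> /(_ (measurable_cst _) _ (fun=> mX)).
have w01 (x : R * R) : 0 <= cst (1 : R) x <= 1 by rewrite /= ler01 lexx.
move=> /(_ w01) H.
have {}H : (fun n : nat => \int[N2]_x (cst 1 x * G (X x))) @ \oo -->
    1 * \int[normal_prob 0 1]_x G (Num.sqrt v * x).
  apply: H => //.
  - move=> t c; rewrite (_ : (fun=> _) = (fun=> 1 * (expR (- (t ^+ 2 * v / 2)) * cos c))).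
      exact: cvg_cst.
    by apply/funext => n; rewrite (E (fun x => cos (t * x + c))) Hcos mul1r.
  - move=> e e0; have [K K0 HK] := tight1 N2 X e mX e0.
    by exists K.
rewrite mul1r E in H.
have <- := cvg_lim (@Rhausdorff R) H.
by apply/esym; apply: lim_cst; exact: Rhausdorff.
Qed.

(* A square root [A] of the rank-one matrix [v m m^T] has both rows
   proportional to a single vector of squared length [v]. *)
Lemma sqrt_rank1 {R : realType} (A : 'M[R]_2) (m1 m2 v : R) :
  A *m A^T = v *: \matrix_(i < 2, j < 2)
    ((if i == 0 then m1 else m2) * (if j == 0 then m1 else m2)) -> 0 <= v ->
  exists a b : R, a ^+ 2 + b ^+ 2 = v /\
    (A 0 0 = - m1 * a /\ A 0 1 = - m1 * b) /\ (A 1 0 = - m2 * a /\ A 1 1 = - m2 * b).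
Proof.
move=> /matrixP AA v0.
have := AA 0 0; rewrite !mxE !big_ord_recl big_ord0 !mxE/= => A00.
have := AA 0 1; rewrite !mxE !big_ord_recl big_ord0 !mxE/= => A01.
have := AA 1 1; rewrite !mxE !big_ord_recl big_ord0 !mxE/= => A11.
move: A00 A01 A11; rewrite !addr0.
rewrite (_ : lift ord0 ord0 = 1 :> 'I_2); last exact/val_inj.
move: (A 0 0) (A 0 1) (A 1 0) (A 1 1) => x y z w H00 H01 H11.
have sq0 (r s : R) : r ^+ 2 + s ^+ 2 = 0 -> r = 0 /\ s = 0.
  move=> /eqP; rewrite paddr_eq0 ?sqr_ge0// !sqrf_eq0 => /andP[/eqP -> /eqP ->].
  by [].
have [m10|m10] := eqVneq m1 0; last first.
  exists (- x / m1), (- y / m1).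
  have [z0 w0] : z - m2 / m1 * x = 0 /\ w - m2 / m1 * y = 0.
    apply: sq0.
    have -> : (z - m2 / m1 * x) ^+ 2 + (w - m2 / m1 * y) ^+ 2 =
      (z * z + w * w) - 2 * (m2 / m1) * (x * z + y * w) + (m2 / m1) ^+ 2 * (x * x + y * y) by ring.
    by rewrite H00 H01 H11; field.
  split.
    have -> : (- x / m1) ^+ 2 + (- y / m1) ^+ 2 = (x * x + y * y) / m1 ^+ 2 by field.
    by rewrite H00; field.
  split; first by split; field.
  by split; [rewrite -[LHS]subr0 -z0|rewrite -[LHS]subr0 -w0]; field.
have [x0 y0] : x = 0 /\ y = 0.
  by apply: sq0; rewrite !expr2 H00 m10; ring.
have [m20|m20] := eqVneq m2 0; last first.
  exists (- z / m2), (- w / m2); split.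
    have -> : (- z / m2) ^+ 2 + (- w / m2) ^+ 2 = (z * z + w * w) / m2 ^+ 2 by field.
    by rewrite H11; field.
  by split; [rewrite x0 y0 m10; split; ring|split; field].
have [z0 w0] : z = 0 /\ w = 0.
  by apply: sq0; rewrite !expr2 H11 m20; ring.
exists (Num.sqrt v), 0; split; first by rewrite sqr_sqrtr// expr0n/= addr0.
by rewrite x0 y0 z0 w0 m10 m20; split; split; ring.
Qed.

(** * Taylor bounds, Markov's inequality and Slutsky's lemma *)

(** The mean value theorem loses the factor [1 / (p + 1)] of an integration, but a bound on a
    derivative of any order climbs back to the function one power at a time. *)
Lemma taylor_step {R : realType} (f f' : R -> R) (B : R) p (x : R) :
  (forall y : R, is_derive y (1 : R) f (f' y)) ->
  f 0 = 0 -> (forall y, `|f' y| <= B * `|y| ^+ p) -> `|f x| <= B * `|x| ^+ p.+1.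
Proof.
move=> df f0 f'B.
have cf a b : {within `[a, b], continuous f}.
  apply: derivable_within_continuous => y _; exact: ex_derive.
have B0 : 0 <= B.
  by have := le_trans (normr_ge0 _) (f'B 1); rewrite normr1 expr1n mulr1.
suff [y yx ->] : exists2 y, `|y| <= `|x| & `|f x| = `|f' y| * `|x|.
  rewrite exprSr mulrA ler_wpM2r// (le_trans (f'B y))// ler_wpM2l//.
  by rewrite lerXn2r ?nnegrE.
have [x0|x0] := leP 0 x.
  have [y] := MVT_segment x0 (fun y _ => df y) (cf _ _).
  rewrite in_itv/= f0 !subr0 => /andP[y0 yx] ->.
  by exists y; rewrite ?normrM// !ger0_norm.
have [y] := MVT_segment (ltW x0) (fun y _ => df y) (cf _ _).
rewrite in_itv/= f0 !sub0r => /andP[xy y0] E.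
exists y; first by rewrite !ler0_norm ?lerN2// ltW.
by rewrite -normrN E normrM normrN.
Qed.

(** Both bounds are needed: the cubic one serves where the chain is below the truncation level, the
    quadratic one above it, where the cube of an increment need not be integrable. *)
Lemma cos_taylor {R : realType} (A x : R) :
  `|cos (A + x) - (cos A - x * sin A - x ^+ 2 / 2 * cos A)| <= Num.min (`|x| ^+ 3) (2 * x ^+ 2).
Proof.
pose f2 (y : R) := cos A - cos (A + y).
pose f1 (y : R) := sin A + y * cos A - sin (A + y).
pose f0 (y : R) := cos (A + y) - (cos A - y * sin A - y ^+ 2 / 2 * cos A).
have d2 y : is_derive y (1:R) f2 (sin (A + y)).
  by rewrite /f2; apply: is_derive_eq; rewrite /GRing.scale/=; ring.
have d1 y : is_derive y (1:R) f1 (f2 y).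
  by rewrite /f1; apply: is_derive_eq; rewrite /f2 /GRing.scale/=; ring.
have d0 y : is_derive y (1:R) f0 (f1 y).
  by rewrite /f0; apply: is_derive_eq; rewrite /f1 /GRing.scale/=; field.
have f00 : f0 0 = 0 by rewrite /f0 addr0 mul0r expr0n/= !mul0r !subr0 subrr.
have f10 : f1 0 = 0 by rewrite /f1 mul0r !addr0 subrr.
have f20 : f2 0 = 0 by rewrite /f2 addr0 subrr.
have H2 y : `|f2 y| <= 1 * `|y| ^+ 1.
  apply: (taylor_step _ _ _ _ _ d2 f20) => z; rewrite mul1r expr0 ler_norml.
  by rewrite sin_geN1 sin_le1.
have H2' y : `|f2 y| <= 2 * `|y| ^+ 0.
  rewrite expr0 mulr1 /f2 (le_trans (ler_normB _ _))//.
  by apply: (@le_trans _ _ (1 + 1)) => //; rewrite lerD// ler_norml cos_geN1 cos_le1.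
rewrite le_min -[X in X && _]/(`|f0 x| <= _) -[X in _ && X]/(`|f0 x| <= _); apply/andP; split.
  rewrite -[leRHS]mul1r; apply: (taylor_step _ _ _ _ _ d0 f00) => y.
  exact: (taylor_step _ _ _ _ _ d1 f10).
rewrite -[x ^+ 2]real_normK ?num_real//; apply: (taylor_step _ _ _ _ _ d0 f00) => y.
exact: (taylor_step _ _ _ _ _ d1 f10).
Qed.

Lemma lip_cos {R : realType} (x y : R) : `|cos x - cos y| <= `|x - y|.
Proof.
have := taylor_step (fun z => cos (y + z) - cos y) (fun z => - sin (y + z)) 1 0 (x - y).
rewrite [y + (x - y)]addrC subrK [1 * `|x - y| ^+ 1]mul1r expr1; apply.
- by move=> z; apply: is_derive_eq; rewrite /GRing.scale/=; ring.
- by rewrite addr0 subrr.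
- by move=> z; rewrite expr0 mulr1 normrN ler_norml sin_geN1 sin_le1.
Qed.

(** From [exp (-l) <= 1 / (1 + l)] and [(1 - l + l^2) (1 + l) = 1 + l^3]. *)
Lemma expRN_approx {R : realType} (l : R) : 0 <= l -> `|1 - l - expR (- l)| <= l ^+ 2.
Proof.
move=> l0; have h1 := expR_ge1Dx (- l); have h2 := expR_ge1Dx l.
have e0 := expR_gt0 l.
rewrite ler0_norm; last by rewrite subr_le0.
suff : expR (- l) <= 1 - l + l ^+ 2 by lra.
rewrite expRN -[_^-1]mul1r ler_pdivrMr//.
apply: (@le_trans _ _ ((1 - l + l ^+ 2) * (1 + l))).
  by rewrite (_ : _ * _ = 1 + l ^+ 3) ?lerDl ?exprn_ge0//; ring.
rewrite ler_wpM2l//; have : 0 <= (l - 1 / 2) ^+ 2 by exact: sqr_ge0.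
by nra.
Qed.

Lemma expR_sub1_le {R : realType} (l : R) : expR l - 1 <= l * expR l.
Proof.
have h := expR_ge1Dx (- l); have e0 := expR_gt0 l.
have : (1 - l) * expR l <= expR (- l) * expR l by rewrite ler_wpM2r// ltW.
by rewrite -expRD addNr expR0; lra.
Qed.

Lemma markov_gt_norm {d} {T : measurableType d} {R : realType} (P : probability T R)
    (X : T -> R) (K : R) : measurable_fun setT X -> 0 < K ->
  P.-integrable setT (EFin \o X) ->
  fine (P [set t | K < `|X t|]) <= K^-1 * \int[P]_t `|X t|.
Proof.
move=> mX K0 iX; have mK := measurable_gt_norm X K mX.
have iN := integrable_norm iX; have iZ := integrableRZ P K^-1 _ iN.
rewrite -(Rintegral_indic P _ mK) -(RintegralZl _ _ iN)//.
apply: le_Rintegral => //; first exact: integrable_indicR.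
move=> t _; rewrite indicE; case: (boolP (t \in _)); last first.
  by move=> _; rewrite /= mulr_ge0// invr_ge0 ltW.
by rewrite inE/= => h; rewrite ler_pdivlMl// mulr1 ltW.
Qed.

Lemma prob_setU_le {d} {T : measurableType d} {R : realType} (P : probability T R)
    (A B : set T) : measurable A -> measurable B ->
  fine (P (A `|` B)) <= fine (P A) + fine (P B).
Proof.
move=> mA mB; rewrite -fineD ?fin_num_measure//; apply: fine_le.
- by rewrite fin_num_measure//; exact: measurableU.
- by rewrite fin_numD !fin_num_measure.
- exact: measureU2.
Qed.

Lemma prob_subset_le {d} {T : measurableType d} {R : realType} (P : probability T R)
    (A B : set T) : measurable A -> measurable B -> A `<=` B -> fine (P A) <= fine (P B).
Proof.
by move=> mA mB AB; apply: fine_le; rewrite ?fin_num_measure//; apply: le_measure => //; rewrite inE.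
Qed.

Lemma slutsky_ratio_bound {R : realType} (u a w v q K dl : R) : 0 < v -> 0 < q -> dl <= v / 2 ->
  `|u| <= K -> `|a| <= K -> `|w - v| <= dl -> 0 < w /\
  `|u / v - (u + a / q) / w| <= 2 * K * dl / v ^+ 2 + 2 * K / (v * q).
Proof.
move=> v0 q0 dv uK aK wv; have w2 : v / 2 <= w.
  by move: wv; rewrite ler_norml => /andP[h _]; lra.
have w0 : 0 < w by rewrite (lt_le_trans _ w2)// divr_gt0.
have K0 : 0 <= K by exact: le_trans uK.
split=> //; rewrite (_ : u / v - _ = (u * (w - v) / v - a / q) / w); last first.
  by field; rewrite !gt_eqF.
rewrite normrM normfV (gtr0_norm w0).
have -> : 2 * K * dl / v ^+ 2 + 2 * K / (v * q) = (K * dl / v + K / q) / (v / 2).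
  by field; rewrite !gt_eqF.
rewrite ler_pM ?invr_ge0 ?(ltW w0)//; last by rewrite lef_pV2 ?posrE// divr_gt0.
rewrite (le_trans (ler_normB _ _))// !normrM !normfV (gtr0_norm v0) (gtr0_norm q0).
by rewrite lerD// ler_wpM2r ?invr_ge0 ?(ltW v0) ?(ltW q0)// ler_pM.
Qed.

(** Since [U] is tight, [V] tends to [v] in probability and [A] is one fixed variable, [Z] and
    [U / v] lie within the modulus of continuity of [G] outside three events of small probability.
    The formula for [Z] is asked only where [V] is positive, as elsewhere the estimator takes a
    default value. *)
Lemma slutsky {d} {T : measurableType d} {R : realType} (P : probability T R)
    (U V Z : nat -> T -> R) (A : T -> R) (v : R) (G : R -> R) (N0 : nat) :
  0 < v -> measurable_fun setT A -> (forall n, measurable_fun setT (U n)) ->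
  (forall n, measurable_fun setT (V n)) -> (forall n, measurable_fun setT (Z n)) ->
  (forall e, 0 < e -> exists2 K, 0 < K & forall n, fine (P [set t | K < `|U n t|]) <= e) ->
  (forall dl e, 0 < dl -> 0 < e -> exists N, forall n, (N <= n)%N ->
     fine (P [set t | dl < `|V n t - v|]) <= e) ->
  (forall n t, (N0 <= n)%N -> 0 < V n t -> Z n t = (U n t + A t / Num.sqrt n%:R) / V n t) ->
  continuous G -> (exists M, forall x, `|G x| <= M) ->
  forall e : R, 0 < e -> exists N, forall n, (N <= n)%N ->
    \int[P]_t `|G (U n t / v) - G (Z n t)| <= e.
Proof.
move=> v0 mA mU mV mZ tU cV ZE cG [M GM] e e0.
have M0 : 0 <= M by exact: le_trans (GM 0).
(* Three bad events of probability at most [e1], each costing [2 M], amount to [6 M e1 <= e / 2]. *)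
pose e1 := e / (2 * (6 * M + 1)).
have M1 : 0 < 6 * M + 1 by rewrite ltr_wpDl// mulr_ge0.
have e10 : 0 < e1 by rewrite divr_gt0// mulr_gt0.
have [K1 K10 HK1] := tU e1 e10.
have [K2 K20 HK2] := tight1 P A _ mA e10.
pose K := K1 + K2.
have K0 : 0 < K by exact: addr_gt0.
have [dl dl0 Hdl] := continuous_unif_segment _ (- (K / v)) (K / v) _ cG (divr_gt0 e0 (ltr0Sn _ 1)).
(* [d1] keeps the denominator above [v / 2] and makes the first term of [slutsky_ratio_bound] at
   most [dl / 4]; [N2] does so for the second. *)
pose d1 := Num.min (v / 2) (dl * v ^+ 2 / (8 * K)).
have d10 : 0 < d1 by rewrite lt_min !divr_gt0 ?mulr_gt0 ?exprn_gt0.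
have [N1 HN1] := cV d1 e1 d10 e10.
pose N2 := (Num.truncn ((8 * K / (v * dl)) ^+ 2)).+1.
have HN2 n : (N2 <= n)%N -> 8 * K / (v * dl) <= Num.sqrt n%:R.
  move=> n2; have x0 : 0 <= 8 * K / (v * dl) by rewrite divr_ge0 ?mulr_ge0 ?ltW.
  rewrite -[leLHS](ger0_norm x0) -sqrtr_sqr ler_sqrt// (le_trans (ltW (truncnS_gt _)))//.
  by rewrite ler_nat.
exists (maxn (maxn N0 1) (maxn N1 N2)) => n.
rewrite (geq_max n (maxn N0 1)) (geq_max n N0) (geq_max n N1) => /andP[/andP[n0 n1] /andP[nN1 nN2]].
have q0 : 0 < Num.sqrt n%:R :> R by rewrite sqrtr_gt0 ltr0n.
pose BU := [set t | K1 < `|U n t|]; pose BA := [set t | K2 < `|A t|].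
pose BV := [set t | d1 < `|V n t - v|].
have mBU : measurable BU by exact: measurable_gt_norm.
have mBA : measurable BA by exact: measurable_gt_norm.
have mBV : measurable BV.
  by apply: (measurable_gt_norm (fun t => V n t - v)); exact: measurable_funB.
have mcG := continuous_measurable_fun cG.
apply: (@le_trans _ _ (e / 2 + 2 * M * fine (P ((BU `|` BA) `|` BV)))).
  apply: Rintegral_indic_le; last 1 first.
  - move=> t; rewrite normr_ge0/= indicE; case: (boolP (t \in _)) => [_|].
      rewrite mulr1 (le_trans (ler_normB _ _))// (le_trans (lerD (GM _) (GM _)))//.
      by rewrite mulr2n mulrDl mul1r lerDr divr_ge0// ltW.
    rewrite notin_setE /= !not_orE /BU/BA/BV/= => -[[]] /negP; rewrite -leNgt => hU /negP.
    rewrite -leNgt => hA /negP; rewrite -leNgt => hV.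
    have uK : `|U n t| <= K by rewrite (le_trans hU)// lerDl ltW.
    have aK : `|A t| <= K by rewrite (le_trans hA)// lerDr ltW.
    have [|w0 h] := slutsky_ratio_bound (U n t) (A t) (V n t) v (Num.sqrt n%:R) K d1 v0 q0 _ uK aK hV.
      by rewrite /d1 ge_min lexx.
    rewrite mulr0 addr0 ZE//; apply: Hdl.
      rewrite -ler_norml normrM normfV (gtr0_norm v0) ler_pM2r// invr_gt0//.
    apply: (le_lt_trans h).
    have h1 : 2 * K * d1 / v ^+ 2 <= dl / 4.
      rewrite ler_pdivrMr ?exprn_gt0// -ler_pdivlMl ?mulr_gt0// /d1 ge_min; apply/orP; right.
      by rewrite (_ : dl * _ / _ = (2 * K)^-1 * (dl / 4 * v ^+ 2))//; field; rewrite gt_eqF.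
    have h2 : 2 * K / (v * Num.sqrt n%:R) <= dl / 4.
      have := HN2 n nN2; rewrite !ler_pdivrMr ?mulr_gt0//.
      by lra.
    by lra.
  - by apply: measurableT_comp => //; apply: measurable_funB; apply: measurableT_comp => //; exact: measurable_funM.
  - by apply: measurableU => //; exact: measurableU.
have h1 : fine (P ((BU `|` BA) `|` BV)) <= 3 * e1.
  rewrite (le_trans (prob_setU_le _ _ _ _ _))//; first exact: measurableU.
  have := prob_setU_le P _ _ mBU mBA; have := HK1 n; have := HN1 n nN1; move: HK2.
  by rewrite -/BU -/BA -/BV; lra.
have h2 : 2 * M * fine (P ((BU `|` BA) `|` BV)) <= 2 * M * (3 * e1) by rewrite ler_wpM2l// mulr_ge0.
have h3 : 2 * M * (3 * e1) <= e / 2.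
  rewrite (_ : 2 * M * (3 * e1) = e / 2 * (6 * M / (6 * M + 1))); last first.
    by rewrite /e1; field; rewrite gt_eqF.
  by rewrite ler_piMr ?divr_ge0 ?(ltW e0)// ler_pdivrMr// mul1r lerDl.
by lra.
Qed.

(** * The chain and its transition operator *)

Section discrete_integral.
Context {d} {T : measurableType d} {R : realType} (mu : {measure set T -> \bar R}).

(** Measurable level sets suffice for a variable with countably many values: whatever factors
    through it is then measurable. *)
Definition discrete (N : T -> nat) := forall m, measurable (N @^-1` [set m]).

Lemma measurable_discrete_preimage (N : T -> nat) {U : Type} (X : T -> U) :
  discrete N -> (forall t t', N t = N t' -> X t = X t') ->
  forall V, measurable (X @^-1` V).
Proof.
move=> dN NX V.
rewrite (_ : X @^-1` V = \bigcup_(m in [set m | exists2 t, N t = m & V (X t)]) (N @^-1` [set m])).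
  by apply: bigcup_measurable => m _; exact: dN.
apply/seteqP; split => [t Vt|t [m [t' Nt' Vt']] Nt].
  by exists (N t) => //; exists t.
by rewrite /= (NX t t')// Nt'.
Qed.

Lemma measurable_discrete (N : T -> nat) {d'} {U : measurableType d'} (X : T -> U) :
  discrete N -> (forall t t', N t = N t' -> X t = X t') -> measurable_fun setT X.
Proof. by move=> dN NX _ V mV; rewrite setTI; exact: (measurable_discrete_preimage N X). Qed.

Lemma ge0_integral_discrete (N : T -> nat) (D : set T) (f : T -> \bar R) :
  discrete N -> measurable D -> measurable_fun setT f -> (forall t, (0 <= f t)%E) ->
  (\int[mu]_(t in D) f t = \sum_(0 <= m <oo) \int[mu]_(t in D `&` N @^-1` [set m]) f t)%E.
Proof.
move=> dN mD mf f0.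
have {1}-> : D = \bigcup_m (D `&` N @^-1` [set m]).
  by apply/seteqP; split => [t Dt|t [m _ []]//]; exists (N t).
rewrite ge0_integral_bigcup//.
- by move=> m; exact: measurableI.
- exact: measurable_funTS.
- by move=> i j _ _ [t [[_ /= <-] [_ /= <-]]].
Qed.

Lemma ge0_integral_discrete_comp (N : T -> nat) (D : set T) (f : nat -> \bar R) :
  discrete N -> measurable D -> (forall m, (0 <= f m)%E) ->
  (\int[mu]_(t in D) f (N t) = \sum_(0 <= m <oo) f m * mu (D `&` N @^-1` [set m]))%E.
Proof.
move=> dN mD f0.
rewrite (ge0_integral_discrete _ _ _ dN)//; last by apply: (measurable_discrete N) => // t t' ->.
apply: eq_eseriesr => m _.
have mDN : measurable (D `&` N @^-1` [set m]) by exact: measurableI.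
rewrite -integral_cst//; apply: eq_integral => t; rewrite inE => -[_ /= ->//].
Qed.

End discrete_integral.

Lemma discreteD {d} {T : measurableType d} (M N : T -> nat) :
  discrete M -> discrete N -> discrete (fun t => M t + N t)%N.
Proof.
move=> dM dN m.
have mM : measurable_fun setT M by exact: (measurable_discrete M).
have mN : measurable_fun setT N by exact: (measurable_discrete N).
by rewrite -[X in measurable X]setTI; exact: (measurable_fun_addn mM mN).
Qed.

Section inar.
Context {d} {T : measurableType d} {R : realType} (P : probability T R) (alpha : R).
Context (eps : nat -> T -> nat) (xi : nat -> nat -> T -> bool) (Y0 : T -> nat).
Context (s1 s2 th1 th2 : nat).
Context (alpha01 : 0 < alpha < 1).
Context (meps : forall k m, measurable (eps k @^-1` [set m])).
Context (mxi : forall k j, measurable (xi k j @^-1` [set true])).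
Context (mY0 : forall m, measurable (Y0 @^-1` [set m])).
Context (indep : mutually_independent_discrete P inar_idx_valid (inar_prim Y0 eps xi)).
Context (ident : forall k m, (0 < k)%N -> P (eps k @^-1` [set m]) = P (eps 1%N @^-1` [set m])).
Context (bern : forall k j, (0 < k)%N -> (0 < j)%N -> P (xi k j @^-1` [set true]) = alpha%:E).

Local Notation W := (inar_prim Y0 eps xi).
Local Notation Y := (Yproc Y0 eps xi s1 s2 th1 th2).

(** * Independence of the noise and the Markov property *)

Definition pr (A : set T) : R := fine (P A).

Lemma prE A : measurable A -> (pr A)%:E = P A.
Proof. by move=> mA; rewrite fineK// fin_num_measure. Qed.

Lemma pr_ge0 A : 0 <= pr A. Proof. exact: fine_ge0. Qed.

Lemma prU A B : measurable A -> measurable B -> A `&` B = set0 ->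
  pr (A `|` B) = pr A + pr B.
Proof.
by move=> mA mB AB; apply: EFin_inj; rewrite EFinD !prE ?measureU//; exact: measurableU.
Qed.

Lemma discrete_prim i : discrete (W i).
Proof.
case: i => [|k|k j] m //=.
rewrite (_ : _ @^-1` _ = xi k j @^-1` [set b | nat_of_bool b = m]); last by [].
have mx : measurable_fun setT (xi k j).
  by apply: (@measurable_fun_bool _ _ setT (xi k j) true); rewrite setTI.
by rewrite -[X in measurable X]setTI; exact: mx.
Qed.

(** Cylinder events as lists of prescribed values, so that one noise variable at a time can be put
    in front. *)
Fixpoint point_event (l : seq (inar_idx * nat)) : set T :=
  if l is (i, a) :: l' then W i @^-1` [set a] `&` point_event l' else setT.

Lemma measurable_point_event l : measurable (point_event l).
Proof.
elim: l => [|[i a] l IH] /=; first exact: measurableT.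
by apply: measurableI => //; exact: discrete_prim.
Qed.

(** [IY0] has time 0, which excludes the initial value from every list starting at a positive
    time. *)
Definition from_time k (l : seq (inar_idx * nat)) :=
  [&& uniq (unzip1 l), all inar_idx_valid (unzip1 l) &
    all (fun i => k <= match i with IY0 => 0 | IEps j => j | IXi j _ => j end)%N (unzip1 l)].

Lemma pr_point_event l : uniq (unzip1 l) -> all inar_idx_valid (unzip1 l) ->
  pr (point_event l) = \prod_(p <- l) pr (W p.1 @^-1` [set p.2]).
Proof.
move=> ul vl.
pose v i := nth 0%N (unzip2 l) (index i (unzip1 l)).
have vE p : p \in l -> v p.1 = p.2.
  move=> pl; pose x0 := (IY0, 0%N).
  rewrite /v -(nth_index x0 pl); set n := index p l.
  have nl : (n < size l)%N by rewrite index_mem.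
  rewrite -(nth_map _ IY0 fst)// index_uniq ?size_map//.
  by rewrite (nth_map x0).
have ptE l' t : point_event l' t <-> forall p, p \in l' -> W p.1 t = p.2.
  elim: l' => [|[i a] l' IH] //=; split.
    move=> [/= Wi /IH H] p; rewrite inE => /predU1P[->//|]; exact: H.
  move=> H; split; first by apply: (H (i, a)); rewrite mem_head.
  by apply/IH => p pl'; apply: H; rewrite inE pl' orbT.
have -> : point_event l = \bigcap_(i in [set i | i \in unzip1 l]) (W i @^-1` [set v i]).
  apply/seteqP; split => t.
    by move=> /ptE H i /= /mapP[p pl ->]; rewrite vE// H.
  by move=> H; apply/ptE => p pl; rewrite -vE//; apply: H; exact: map_f.
rewrite /pr indep// big_map.
rewrite (eq_big_seq (fun p => (pr (W p.1 @^-1` [set p.2]))%:E)).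
  by rewrite prodEFin.
by move=> p pl; rewrite vE// prE//; exact: discrete_prim.
Qed.

Lemma pr_point_event_cons i a l : uniq (i :: unzip1 l) -> all inar_idx_valid (i :: unzip1 l) ->
  pr (point_event ((i, a) :: l)) = pr (W i @^-1` [set a]) * pr (point_event l).
Proof.
move=> ul vl; rewrite !pr_point_event// ?big_cons//.
  by case/andP: ul.
by case/andP: vl.
Qed.

(** The law of [eps 1] convolved with [n] Bernoulli laws, one at a time. *)
Fixpoint kern n m : R :=
  if n is n'.+1 then (1 - alpha) * kern n' m + alpha * (if m is m'.+1 then kern n' m' else 0)
  else pr (eps 1%N @^-1` [set m]).

Definition branch k n : T -> nat := fun t => (\sum_(1 <= j < n.+1) nat_of_bool (xi k j t) + eps k t)%N.

Lemma discrete_branch k n : discrete (branch k n).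
Proof.
elim: n => [|n IH] m.
  by rewrite (_ : branch k 0 = eps k)//; apply/funext => t; rewrite /branch big_geq.
rewrite (_ : branch k n.+1 = fun t => branch k n t + W (IXi k n.+1) t)%N.
  by apply: discreteD => //; exact: discrete_prim.
by apply/funext => t; rewrite /branch [in LHS]big_nat_recr//= addnAC.
Qed.

Definition indep_from k A := measurable A /\ forall l, from_time k l -> pr (A `&` point_event l) = pr A * pr (point_event l).

Lemma pr_xi k j (b : bool) : (0 < k)%N -> (0 < j)%N ->
  pr (W (IXi k j) @^-1` [set nat_of_bool b]) = if b then alpha else 1 - alpha.
Proof.
move=> k0 j0.
have E1 : W (IXi k j) @^-1` [set 1%N] = xi k j @^-1` [set true].
  by apply/seteqP; split => t /=; case: (xi k j t).
have E0 : W (IXi k j) @^-1` [set 0%N] = ~` (xi k j @^-1` [set true]).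
  by apply/seteqP; split => t /=; case: (xi k j t).
case: b => /=; rewrite /pr.
  by rewrite E1 bern.
by rewrite E0 probability_setC// bern.
Qed.

(** Induction on [n]: [xi k n.+1] leaves the branching sum and joins the list [l], which must
    therefore stay general. The two non-membership conditions keep the list free of repetitions. *)
Lemma pr_branch k A : (0 < k)%N -> indep_from k A -> forall n m l, from_time k l ->
  IEps k \notin unzip1 l -> (forall j, (0 < j <= n)%N -> IXi k j \notin unzip1 l) ->
  pr (A `&` branch k n @^-1` [set m] `&` point_event l) = pr A * kern n m * pr (point_event l).
Proof.
move=> k0 [mA iA]; elim => [|n IH] m l gl el xl.
  have gl' : from_time k ((IEps k, m) :: l).
    by move: gl => /and3P[u v w]; rewrite /from_time/= el u k0 v leqnn w.
  rewrite (_ : _ `&` point_event l = A `&` point_event ((IEps k, m) :: l)); last first.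
    rewrite /= setIA; congr (_ `&` _ `&` _).
    by rewrite (_ : branch k 0 = eps k)//; apply/funext => t; rewrite /branch big_geq.
  rewrite iA// pr_point_event_cons; [|by case/and3P: gl'..].
  by rewrite mulrA /= /pr ident.
have xnl : IXi k n.+1 \notin unzip1 l by apply: xl; rewrite ltn0Sn leqnn.
pose lb b := (IXi k n.+1, nat_of_bool b) :: l.
have glb b : from_time k (lb b).
  by move: gl => /and3P[u v w]; rewrite /from_time/= xnl u k0 v leqnn w.
have elb b : IEps k \notin unzip1 (lb b) by rewrite /= inE.
have xlb b j : (0 < j <= n)%N -> IXi k j \notin unzip1 (lb b).
  move=> /andP[j0 jn]; rewrite /= inE negb_or xl ?j0 ?(leq_trans jn)// andbT.
  by apply/eqP => -[jE]; rewrite jE ltnn in jn.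
have mI m' b : measurable (A `&` branch k n @^-1` [set m'] `&` point_event (lb b)).
  apply: measurableI; last exact: measurable_point_event.
  by apply: measurableI => //; exact: discrete_branch.
have prlb b : pr (point_event (lb b)) = (if b then alpha else 1 - alpha) * pr (point_event l).
  by rewrite pr_point_event_cons ?pr_xi//; case/and3P: (glb b).
have blkE t : branch k n.+1 t = (branch k n t + W (IXi k n.+1) t)%N.
  by rewrite /branch [in LHS]big_nat_recr//= addnAC.
have IHb m' b : pr (A `&` branch k n @^-1` [set m'] `&` point_event (lb b)) =
    pr A * kern n m' * ((if b then alpha else 1 - alpha) * pr (point_event l)).
  by rewrite (IH _ _ (glb b) (elb b) (xlb b)) prlb.
case: m => [|m].
  rewrite (_ : _ `&` point_event l = A `&` branch k n @^-1` [set 0%N] `&` point_event (lb false)); last first.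
    apply/seteqP; split => t /=; rewrite /preimage/= blkE /=.
      by move=> [[At /eqP]]; rewrite addn_eq0 => /andP[/eqP -> /eqP ->].
    by move=> [[At ->] [-> pl]].
  by rewrite IHb /=; ring.
rewrite (_ : _ `&` point_event l = (A `&` branch k n @^-1` [set m.+1] `&` point_event (lb false)) `|`
   (A `&` branch k n @^-1` [set m] `&` point_event (lb true))); last first.
  apply/seteqP; split => t /=; rewrite /preimage/= blkE /=.
    move=> [[At]]; case: (xi k n.+1 t) => /=.
      by rewrite addn1 => -[->] pl; right.
    by rewrite addn0 => -> pl; left.
  by move=> [[[At ->] [-> pl]]|[[At ->] [-> pl]]]; rewrite ?addn0 ?addn1.
rewrite prU//; last first.
  by rewrite -subset0 => t /= [[_ [-> _]] [_ []]].
by rewrite !IHb /=; ring.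
Qed.

Definition shift k := ((k == s1) * th1 + (k == s2) * th2)%N.

Lemma YprocS k t : Y k.+1 t = (branch k.+1 (Y k t) t + shift k.+1)%N.
Proof. by rewrite /branch /shift /= addnA. Qed.

Local Arguments Yproc : simpl never.

Definition hist k (h : nat -> nat) : set T := [set t | forall i, (i <= k)%N -> Y i t = h i].

Lemma histS k h : hist k.+1 h =
  if (shift k.+1 <= h k.+1)%N then hist k h `&` branch k.+1 (h k) @^-1` [set (h k.+1 - shift k.+1)%N]
  else set0.
Proof.
case: leqP => hs; apply/seteqP; split => t //=.
- move=> H; split; first by move=> i ik; apply: H; exact: leqW.
  by rewrite /preimage/= -(H k (leqnSn k)) -(H k.+1 (leqnn _)) YprocS addnK.
- move=> [H]; rewrite /preimage/= => B i; rewrite leq_eqVlt => /predU1P[->|]; last exact: H.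
  by rewrite YprocS (H k (leqnn k)) B subnK.
- move=> /(_ k.+1 (leqnn _)); rewrite YprocS => E.
  by move: hs; rewrite -E ltnNge leq_addl.
Qed.

Lemma pr_point_event_nil : pr (point_event [::]) = 1.
Proof. by rewrite pr_point_event// big_nil. Qed.

Lemma pr_branch_nil k A n m : (0 < k)%N -> indep_from k A ->
  pr (A `&` branch k n @^-1` [set m]) = pr A * kern n m.
Proof.
move=> k0 iA; have := pr_branch k A k0 iA n m [::] isT isT (fun _ _ => isT).
by rewrite pr_point_event_nil mulr1 /= setIT.
Qed.

(** A history up to time [k] involves noise of times at most [k] only. One more time step intersects
    it with a branching event, which [pr_branch] factors out both with and without a cylinder of
    later noise. *)
Lemma indep_from_hist k h : indep_from k.+1 (hist k h).
Proof.
elim: k => [|k IH].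
  have -> : hist 0 h = W IY0 @^-1` [set h 0%N].
    by apply/seteqP; split => t /= => [/(_ 0%N)|H [|//]]; [exact|].
  split; first exact: mY0.
  move=> l gl; rewrite -/(point_event ((IY0, h 0%N) :: l)) pr_point_event_cons//.
    by case/and3P: gl => u v w; rewrite /= u andbT; apply/negP => /(allP w).
  by case/and3P: gl.
rewrite histS; case: ifPn => _; last first.
  split; first exact: measurable0.
  by move=> l gl; rewrite set0I /pr measure0 mul0r.
split; first by apply: measurableI; [case: IH|exact: discrete_branch].
move=> l /and3P[u v w].
rewrite pr_branch_nil// pr_branch//.
- by apply/and3P; split => //; apply: sub_all w => i; exact: ltnW.
- by apply/negP => /(allP w); rewrite ltnn.
- by move=> j _; apply/negP => /(allP w); rewrite ltnn.
Qed.

Lemma indep_from_setT : indep_from 1 setT.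
Proof.
split; first exact: measurableT.
by move=> l gl; rewrite setTI /pr probability_setT mul1r.
Qed.

Lemma kernE n m : kern n m = pr (branch 1 n @^-1` [set m]).
Proof.
rewrite -[RHS]/(pr (_ @^-1` _)) -[in RHS](setTI (branch 1 n @^-1` _)) pr_branch_nil//; last exact: indep_from_setT.
by rewrite /pr probability_setT mul1r.
Qed.

(* Functions of the path up to time [k]: what the filtration generated by the
   process can see, stated extensionally. *)
Definition adapted k {U : Type} (X : T -> U) :=
  forall t t', (forall i, (i <= k)%N -> Y i t = Y i t') -> X t = X t'.

(** Finite paths in [nat] are countable, so a single natural number records the past, and integrals
    become sums over its values. *)
Definition code k t := pickle (mkseq (Y^~ t) k.+1).

Lemma code_eq k t t' : code k t = code k t' <-> (forall i, (i <= k)%N -> Y i t = Y i t').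
Proof.
split.
  move=> /(pcan_inj pickleK) E i ik.
  by have := congr1 (nth 0%N ^~ i) E; rewrite !nth_mkseq.
by move=> H; rewrite /code; congr pickle; apply/eq_in_map => i; rewrite mem_iota => /H.
Qed.

Lemma code_hist k t : code k @^-1` [set code k t] = hist k (Y^~ t).
Proof. by apply/seteqP; split => t' /= /code_eq. Qed.

Lemma discrete_code k : discrete (code k).
Proof.
move=> m; have [[t mE]|nE] := pselect (exists t, code k t = m).
  by rewrite -mE code_hist; case: (indep_from_hist k (Y^~ t)).
rewrite (_ : _ @^-1` _ = set0)//.
by rewrite -subset0 => t /= H; apply: nE; exists t.
Qed.

Lemma measurable_adapted k {d'} {U : measurableType d'} (X : T -> U) :
  adapted k X -> measurable_fun setT X.
Proof.
move=> aX; apply: (measurable_discrete (code k)); first exact: discrete_code.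
by move=> t t' /code_eq; exact: aX.
Qed.

Lemma adaptedY k i : (i <= k)%N -> adapted k (Y i).
Proof. by move=> ik t t'; exact. Qed.

Lemma adaptedW j k {U : Type} (X : T -> U) : (j <= k)%N -> adapted j X -> adapted k X.
Proof. by move=> jk aX t t' H; apply: aX => i ij; apply: H; exact: leq_trans jk. Qed.

Lemma discreteY k : discrete (Y k).
Proof.
move=> m; have := @measurable_adapted k _ _ (Y k) (adaptedY k k (leqnn k)).
by move=> H; rewrite -[X in measurable X]setTI; exact: H.
Qed.

Lemma ge0_integral_discrete_pr (N : T -> nat) (D : set T) (f : nat -> \bar R) :
  discrete N -> measurable D -> (forall m, (0 <= f m)%E) ->
  (\int[P]_(t in D) f (N t) =
   \sum_(0 <= m <oo) f m * (pr (D `&` N @^-1` [set m]))%:E)%E.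
Proof.
move=> dN mD f0; rewrite ge0_integral_discrete_comp//.
apply: eq_eseriesr => m _; congr (_ * _)%E; apply/esym/prE.
exact: measurableI.
Qed.

Lemma integral_cst_pr (D : set T) (c : \bar R) : measurable D ->
  (\int[P]_(t in D) c = c * (pr D)%:E)%E.
Proof. by move=> mD; rewrite prE//; exact: integral_cst. Qed.

(** The Markov property in integrated form. On each history [F] and [Y k] are frozen, and the noise
    of time [k.+1], independent of the history, is replaced by that of time 1 at a separately
    integrated [t']. *)
Lemma tower k (F : T -> nat -> \bar R) :
  (forall t m, (0 <= F t m)%E) -> (forall m, adapted k (F^~ m)) ->
  (\int[P]_t F t (Y k.+1 t) =
   \int[P]_t \int[P]_t' F t (branch 1 (Y k t) t' + shift k.+1)%N)%E.
Proof.
move=> F0 aF.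
have mG : measurable_fun setT (fun t => \int[P]_t' F t (branch 1 (Y k t) t' + shift k.+1)%N)%E.
  apply: (@measurable_adapted k) => t t' H; apply: eq_integral => u _.
  by rewrite (H k (leqnn k)); exact: aF.
rewrite (ge0_integral_discrete P (code k) setT)//; [|exact: discrete_code|..]; last first.
  apply: (@measurable_adapted k.+1) => t t' H.
  by rewrite (H k.+1 (leqnn _)); apply: aF => i ik; apply: H; exact: leqW.
rewrite [RHS](ge0_integral_discrete P (code k) setT)//; [|exact: discrete_code|]; last first.
  by move=> t; exact: integral_ge0.
apply: eq_eseriesr => c _; rewrite setTI.
have [[t0 cE]|nE] := pselect (exists t, code k t = c); last first.
  rewrite (_ : code k @^-1` _ = set0) ?integral_set0//.
  by rewrite -subset0 => t /= H; apply: nE; exists t.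
rewrite -cE code_hist; set h := Y^~ t0.
have [mh _] := indep_from_hist k h.
have hF t m : hist k h t -> F t m = F t0 m.
  by move=> ht; apply: aF => i ik; exact: ht.
transitivity (\int[P]_(t in hist k h) F t0 (branch k.+1 (h k) t + shift k.+1)%N)%E.
  apply: eq_integral => t; rewrite inE => ht.
  by rewrite hF// YprocS (ht k (leqnn k)).
pose c0 := (\int[P]_t' F t0 (branch 1 (h k) t' + shift k.+1)%N)%E.
rewrite [RHS](_ : _ = \int[P]_(t in hist k h) cst c0 t)%E; last first.
  apply: eq_integral => t; rewrite inE => ht; apply: eq_integral => t' _.
  by rewrite hF// (ht k (leqnn k)).
rewrite (integral_cst_pr _ c0 mh) muleC /c0.
rewrite (ge0_integral_discrete_pr (branch k.+1 (h k)) _ (fun m => F t0 (m + shift k.+1)%N))//; last first.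
  exact: discrete_branch.
rewrite (ge0_integral_discrete_pr (branch 1 (h k)) setT (fun m => F t0 (m + shift k.+1)%N))//; last first.
  exact: discrete_branch.
rewrite -nneseriesZl; last by move=> m _; rewrite mule_ge0// lee_fin pr_ge0.
apply: eq_eseriesr => m _; rewrite setTI muleCA; congr (_ * _)%E.
by rewrite -EFinM -kernE (pr_branch_nil k.+1)//; exact: indep_from_hist.
Qed.

(** * Functions of cubic growth and the moments of one transition *)

Context (eps3 : (\int[P]_t (((eps 1%N t)%:R : R) ^+ 3)%:E < +oo)%E).

(** The growth that finite third moments make integrable; [cubic_Kop] shows that the kernel
    preserves it. *)
Definition cubic (f : nat -> R) := exists C : R, forall x, `|f x| <= C * (1 + x%:R) ^+ 3.

Lemma cubicD f g : cubic f -> cubic g -> cubic (fun x => f x + g x).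
Proof.
move=> [C fC] [D gD]; exists (C + D) => x.
by rewrite mulrDl (le_trans (ler_normD _ _))// lerD.
Qed.

Lemma cubicZ a f : cubic f -> cubic (fun x => a * f x).
Proof.
by move=> [C fC]; exists (`|a| * C) => x; rewrite normrM -mulrA ler_wpM2l.
Qed.

Lemma cubic_bounded f (M : R) : (forall x, `|f x| <= M) -> cubic f.
Proof.
move=> fM; have M0 : 0 <= M by exact: le_trans (fM 0%N).
by exists M => x; rewrite (le_trans (fM x))// ler_peMr// exprn_ege1// lerDl.
Qed.

Lemma cubic_cst (c : R) : cubic (fun=> c).
Proof. exact: (@cubic_bounded _ `|c|). Qed.

Lemma cubicX p : (p <= 3)%N -> cubic (fun x => x%:R ^+ p).
Proof.
move=> p3; exists 1 => x; rewrite mul1r ger0_norm ?exprn_ge0//.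
apply: (@le_trans _ _ ((1 + x%:R) ^+ p)); first by rewrite lerXn2r ?nnegrE ?addr_ge0// lerDr.
by apply: ler_weXn2l => //; rewrite lerDl.
Qed.

Lemma cubic_id : cubic (fun x => x%:R).
Proof. by have [C H] := cubicX 1 isT; exists C => x; have := H x; rewrite expr1. Qed.

Lemma cubic_cube : cubic (fun x => (1 + x%:R) ^+ 3).
Proof. by exists 1 => x; rewrite mul1r ger0_norm// exprn_ge0// addr_ge0. Qed.

Lemma cubic_addn f a : cubic f -> cubic (fun x => f (x + a)%N).
Proof.
move=> [C fC]; exists (C * (1 + a%:R) ^+ 3) => x.
have C0 : 0 <= C by have := le_trans (normr_ge0 _) (fC 0%N); rewrite addr0 expr1n mulr1.
rewrite (le_trans (fC _))// -mulrA ler_wpM2l// -exprMn lerXn2r ?nnegrE ?addr_ge0 ?mulr_ge0 ?addr_ge0//.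
have : 0 <= a%:R * x%:R :> R by rewrite mulr_ge0.
by rewrite natrD; lra.
Qed.

Lemma cubic_succ f : cubic f -> cubic (f \o S).
Proof.
by move=> /(cubic_addn _ 1); congr cubic; apply/funext => x /=; rewrite addn1.
Qed.

Lemma cube1p (x : nat) : (1 + x%:R : R) ^+ 3 <= 1 + 8 * x%:R ^+ 3.
Proof.
case: x => [|x]; first by rewrite expr0n/= mulr0 !addr0 expr1n.
apply: (@le_trans _ _ ((2 * x.+1%:R) ^+ 3)); last first.
  by rewrite (_ : (2 * _) ^+ 3 = 8 * x.+1%:R ^+ 3) ?lerDr//; ring.
rewrite lerXn2r ?nnegrE ?addr_ge0 ?mulr_ge0//.
have : 1 <= x.+1%:R :> R by rewrite ler1n.
lra.
Qed.

Lemma measurable_fun_nat (N : T -> nat) (f : nat -> R) : discrete N ->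
  measurable_fun setT (fun t => f (N t)).
Proof. by move=> dN; apply: (measurable_discrete N) => // t t' ->. Qed.

Lemma integrable_cubic (N : T -> nat) f : discrete N -> cubic f ->
  (\int[P]_t (((N t)%:R : R) ^+ 3)%:E < +oo)%E ->
  P.-integrable setT (EFin \o (fun t => f (N t))).
Proof.
move=> dN [C fC] iN.
have C0 : 0 <= C by have := le_trans (normr_ge0 _) (fC 0%N); rewrite addr0 expr1n mulr1.
apply: (@le_integrableR _ _ _ P _ (fun t => C * 1 + C * 8 * (N t)%:R ^+ 3)).
- exact: measurable_fun_nat.
- move=> t; rewrite (le_trans (fC _))// -mulrA -mulrDr ler_wpM2l//.
  exact: cube1p.
apply: (integrableRD P (fun=> C * 1)); first exact: integrable_cstR.
apply: (integrableRZ P _ (fun t => (N t)%:R ^+ 3)).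
apply/integrableP; split.
  apply/measurable_EFinP.
  exact: (measurable_fun_nat N (fun x => x%:R ^+ 3)).
rewrite (eq_integral (fun t => ((N t)%:R ^+ 3)%:E))//.
by move=> t _; rewrite /= ger0_norm// exprn_ge0.
Qed.

Lemma integrable_eps f : cubic f -> P.-integrable setT (EFin \o (fun t => f (eps 1%N t))).
Proof. by move=> cf; apply: integrable_cubic. Qed.

Lemma branch_le n t : (branch 1 n t <= n + eps 1%N t)%N.
Proof.
rewrite leq_add2r (leq_trans (leq_sum _ (fun j _ => leq_b1 (xi 1 j t))))//.
by rewrite sum_nat_const_nat subn1 muln1.
Qed.

Lemma integrable_branch n f : cubic f -> P.-integrable setT (EFin \o (fun t => f (branch 1 n t))).
Proof.
move=> [C fC].
have C0 : 0 <= C by have := le_trans (normr_ge0 _) (fC 0%N); rewrite addr0 expr1n mulr1.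
apply: (@le_integrableR _ _ _ P _ (fun t => C * (1 + (eps 1%N t + n)%:R) ^+ 3)).
- exact: measurable_fun_nat (discrete_branch 1 n).
- move=> t; rewrite (le_trans (fC _))// ler_wpM2l// lerXn2r ?nnegrE ?addr_ge0//.
  by rewrite lerD2l ler_nat addnC branch_le.
apply: (integrable_eps (fun x => C * (1 + (x + n)%:R) ^+ 3)).
by apply: (cubicZ C); apply: (cubic_addn (fun x => (1 + x%:R) ^+ 3)) cubic_cube.
Qed.

Definition Kop (f : nat -> R) n : R := \int[P]_t f (branch 1 n t).

Lemma KopD f g n : cubic f -> cubic g -> Kop (fun x => f x + g x) n = Kop f n + Kop g n.
Proof. by move=> cf cg; rewrite /Kop RintegralD//; exact: integrable_branch. Qed.

Lemma KopZ a f n : cubic f -> Kop (fun x => a * f x) n = a * Kop f n.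
Proof. by move=> cf; rewrite /Kop RintegralZl//; exact: integrable_branch. Qed.

Lemma Kop_cst (c : R) n : Kop (fun=> c) n = c.
Proof. exact: Rintegral_prob_cst. Qed.

Lemma Kop_le f g n : cubic f -> cubic g -> (forall x, f x <= g x) -> Kop f n <= Kop g n.
Proof.
by move=> cf cg fg; apply: le_Rintegral => //; exact: integrable_branch.
Qed.

Lemma Kop_norm f g n : cubic f -> cubic g -> (forall x, `|f x| <= g x) -> `|Kop f n| <= Kop g n.
Proof.
move=> cf cg fg; rewrite ler_norml; apply/andP; split.
  rewrite -mulN1r -KopZ//; apply: Kop_le => //; first exact: cubicZ.
  by move=> x; have := fg x; rewrite mulN1r ler_norml => /andP[].
by apply: Kop_le => // x; exact: le_trans (ler_norm _) (fg x).
Qed.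

(** Splits on the value of [xi 1 n.+1], which is independent of [branch 1 n]. *)
Lemma ge0_integral_branchS n (f : nat -> \bar R) : (forall x, (0 <= f x)%E) ->
  (\int[P]_t f (branch 1 n.+1 t) =
   (1 - alpha)%:E * (\int[P]_t f (branch 1 n t)) + alpha%:E * (\int[P]_t f (branch 1 n t).+1))%E.
Proof.
move=> f0.
pose D (b : bool) := W (IXi 1 n.+1) @^-1` [set nat_of_bool b].
have mD b : measurable (D b) by exact: discrete_prim.
have DT : setT = D false `|` D true.
  by apply/seteqP; split => t //= _; rewrite /D /preimage/=; case: (xi 1 n.+1 t); [right|left].
have mf : measurable_fun setT (fun t => f (branch 1 n.+1 t)).
  by apply: (measurable_discrete (branch 1 n.+1)) (discrete_branch 1 n.+1) _ => t t' ->.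
rewrite [in LHS]DT ge0_integral_setU//; first last.
- by apply/disj_setPS => t; rewrite /D /preimage/= => -[->].
- exact: measurable_funTS.
have key (b : bool) (g : nat -> \bar R) : (forall x, (0 <= g x)%E) ->
   (\int[P]_(t in D b) g (branch 1 n t) =
    (if b then alpha else 1 - alpha)%:E * \int[P]_t g (branch 1 n t))%E.
  move=> g0.
  rewrite !ge0_integral_discrete_pr//; [|exact: discrete_branch..].
  rewrite -nneseriesZl; last by move=> m _; rewrite mule_ge0// lee_fin pr_ge0.
  apply: eq_eseriesr => m _; rewrite muleCA setTI; congr (_ * _)%E.
  rewrite -EFinM -kernE; congr EFin.
  have := pr_branch 1 setT isT indep_from_setT n m [:: (IXi 1 n.+1, nat_of_bool b)].
  rewrite /from_time/= setTI setIT setIC => ->//.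
    by rewrite /pr probability_setT mul1r -/(pr _) pr_xi// mulrC.
  by move=> j /andP[_ jn]; rewrite inE; apply/eqP => -[jE]; rewrite jE ltnn in jn.
have blkE t : branch 1 n.+1 t = (branch 1 n t + W (IXi 1 n.+1) t)%N.
  by rewrite /branch [in LHS]big_nat_recr//= addnAC.
congr (_ + _)%E.
- rewrite -(key false)//; apply: eq_integral => t; rewrite inE /D/= => E.
  by rewrite blkE /= E addn0.
- rewrite -(key true (f \o S))//=; apply: eq_integral => t; rewrite inE /D/= => E.
  by rewrite blkE /= E addn1.
Qed.

Lemma KopS f n : cubic f -> Kop f n.+1 = (1 - alpha) * Kop f n + alpha * Kop (f \o S) n.
Proof.
have pos g : cubic g -> (forall x, 0 <= g x) ->
    Kop g n.+1 = (1 - alpha) * Kop g n + alpha * Kop (g \o S) n.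
  move=> cg g0; apply: EFin_inj; rewrite EFinD !EFinM /Kop /Rintegral.
  have ig m h : cubic h -> (\int[P]_t (h (branch 1 m t))%:E)%E \is a fin_num.
    by move=> ch; apply: integrable_fin_num => //; exact: integrable_branch.
  rewrite !fineK ?ig//; last exact: cubic_succ.
  exact: (ge0_integral_branchS n (EFin \o g)).
move=> cf; have [C fC] := cf.
(* Adding a nonnegative majorant [g] reduces the signed case to the nonnegative one. *)
pose g x : R := C * (1 + x%:R) ^+ 3.
have cg : cubic g by exact: cubicZ cubic_cube.
have cfg : cubic (fun x => f x + g x) by exact: cubicD.
have g0 x : 0 <= g x by exact: le_trans (fC x).
have fg0 x : 0 <= f x + g x.
  by have := fC x; rewrite ler_norml -/(g x) -subr_ge0 opprK addrC => /andP[].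
have := pos _ cfg fg0; rewrite KopD// KopD// (_ : _ \o S = fun x => f x.+1 + g x.+1)//.
rewrite (KopD (f \o S) (g \o S)); [|exact: cubic_succ..].
by rewrite (pos _ cg g0); lra.
Qed.

(** Differencing in the starting point becomes [alpha] times differencing in [f]. On monomials the
    degree drops, which yields the moment polynomials; on bounded functions the factor [alpha] is
    the contraction. *)
Lemma KopSD f n : cubic f -> Kop f n.+1 = Kop f n + alpha * Kop (fun x => f x.+1 - f x) n.
Proof.
move=> cf; rewrite KopS// (_ : Kop (fun x => f x.+1 - f x) n = Kop (f \o S) n - Kop f n); first by ring.
rewrite -mulN1r -KopZ// -KopD//; [|exact: cubic_succ|exact: cubicZ].
by congr Kop; apply/funext => x; rewrite mulN1r.
Qed.

Local Notation mu := (rv_mean P (eps 1%N)).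
Local Notation sig2e := (rv_var P (eps 1%N)).

Lemma branch0 t : branch 1 0 t = eps 1%N t.
Proof. by rewrite /branch big_geq. Qed.

Lemma Kop0 f : Kop f 0 = \int[P]_t f (eps 1%N t).
Proof. by apply: eq_Rintegral => t _; rewrite branch0. Qed.

Lemma Kop_mean0 : Kop (fun x => x%:R) 0 = mu.
Proof. by rewrite Kop0. Qed.

Lemma mu_ge0 : 0 <= mu.
Proof. by rewrite -Kop_mean0; apply: Rintegral_ge0 => t _. Qed.

Definition e2 := Kop (fun x => x%:R ^+ 2) 0.
Definition e3 := Kop (fun x => x%:R ^+ 3) 0.

Lemma cubic_linear a b c : cubic (fun x => a * x%:R ^+ 2 + b * x%:R + c).
Proof.
apply: cubicD; last exact: cubic_cst.
by apply: cubicD; apply: cubicZ; [exact: cubicX|exact: cubic_id].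
Qed.

Lemma Kop_linear a b c n : Kop (fun x => a * x%:R ^+ 2 + b * x%:R + c) n =
  a * Kop (fun x => x%:R ^+ 2) n + b * Kop (fun x => x%:R) n + c.
Proof.
have c1 := cubicZ b _ cubic_id; have c2 := cubicZ a _ (cubicX 2 isT).
rewrite (KopD (fun x => a * x%:R ^+ 2 + b * x%:R) (fun=> c)); [|exact: cubicD|exact: cubic_cst].
by rewrite (KopD _ _ _ c2 c1) (KopZ a _ _ (cubicX 2 isT)) (KopZ b _ _ cubic_id) Kop_cst.
Qed.

Lemma Kop_mean n : Kop (fun x => x%:R) n = alpha * n%:R + mu.
Proof.
elim: n => [|n IH]; first by rewrite Kop_mean0 mulr0 add0r.
rewrite KopSD; last exact: cubic_id.
rewrite (_ : Kop (fun x => x.+1%:R - x%:R) n = 1) ?IH.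
  by rewrite -natr1; ring.
by rewrite -[RHS](Kop_cst _ n); congr Kop; apply/funext => x; rewrite -natr1; ring.
Qed.

Lemma Kop_sqr n : Kop (fun x => x%:R ^+ 2) n =
  alpha ^+ 2 * n%:R ^+ 2 + (alpha * (1 - alpha) + 2 * alpha * mu) * n%:R + e2.
Proof.
elim: n => [|n IH]; first by rewrite expr0n/= !mulr0 !add0r.
rewrite KopSD; last exact: cubicX.
rewrite (_ : Kop (fun x => x.+1%:R ^+ 2 - x%:R ^+ 2) n = 2 * Kop (fun x => x%:R) n + 1).
  by rewrite IH Kop_mean -natr1; ring.
rewrite -[RHS]add0r -(mul0r (Kop (fun x => x%:R ^+ 2) n)) addrA -Kop_linear.
by congr Kop; apply/funext => x; rewrite -natr1; ring.
Qed.

(** The coefficients of [n^2], and next of [n], in the third moment of a transition from [n]; see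
    [Kop_cube]. *)
Definition k32 := 3 * alpha ^+ 2 * (1 - alpha) + 3 * alpha ^+ 2 * mu.
Definition k31 := alpha * (1 - alpha) * (1 - 2 * alpha) + 3 * alpha * (1 - alpha) * mu + 3 * alpha * e2.

Lemma Kop_cube n : Kop (fun x => x%:R ^+ 3) n =
  alpha ^+ 3 * n%:R ^+ 3 + k32 * n%:R ^+ 2 + k31 * n%:R + e3.
Proof.
elim: n => [|n IH]; first by rewrite !expr0n/= !mulr0 !add0r.
rewrite KopSD; last exact: cubicX.
rewrite (_ : Kop (fun x => x.+1%:R ^+ 3 - x%:R ^+ 3) n =
    3 * Kop (fun x => x%:R ^+ 2) n + 3 * Kop (fun x => x%:R) n + 1).
  by rewrite IH Kop_sqr Kop_mean -natr1 /k32 /k31; ring.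
rewrite -Kop_linear; congr Kop; apply/funext => x; rewrite -natr1; ring.
Qed.

Lemma rv_varE : sig2e = e2 - mu ^+ 2.
Proof.
rewrite /rv_var -/(Rintegral P setT (fun t => ((eps 1%N t)%:R - mu) ^+ 2)).
rewrite -(Kop0 (fun x => (x%:R - mu) ^+ 2)).
rewrite (_ : (fun x => _) = fun x : nat => 1 * x%:R ^+ 2 + (- 2 * mu) * x%:R + mu ^+ 2).
  by rewrite Kop_linear Kop_mean0 -/e2; ring.
by apply/funext => x; ring.
Qed.

Lemma sig2e_ge0 : 0 <= sig2e.
Proof. by apply: Rintegral_ge0 => t _; exact: sqr_ge0. Qed.

Lemma Kop_mart n : Kop (fun x => x%:R - alpha * n%:R - mu) n = 0.
Proof.
rewrite (_ : (fun x => _) = fun x : nat => 0 * x%:R ^+ 2 + 1 * x%:R + (- (alpha * n%:R) - mu)).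
  by rewrite Kop_linear Kop_mean; ring.
by apply/funext => x; ring.
Qed.

Lemma Kop_mart_sqr n : Kop (fun x => (x%:R - alpha * n%:R - mu) ^+ 2) n =
  alpha * (1 - alpha) * n%:R + sig2e.
Proof.
rewrite (_ : (fun x => _) = fun x : nat => 1 * x%:R ^+ 2 + (- 2 * (alpha * n%:R + mu)) * x%:R + (alpha * n%:R + mu) ^+ 2).
  by rewrite Kop_linear Kop_mean Kop_sqr rv_varE; ring.
by apply/funext => x; ring.
Qed.

(** * Contraction of the kernel and the approximate Poisson equation *)

Lemma Kop_bounded f (M : R) : (forall x, `|f x| <= M) -> forall n, `|Kop f n| <= M.
Proof.
move=> fM n; rewrite -[leRHS](Kop_cst M n); apply: Kop_norm => //.
  exact: cubic_bounded fM.
exact: cubic_cst.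
Qed.

Lemma iter_Kop_bounded f (M : R) N : (forall x, `|f x| <= M) ->
  forall x, `|iter N Kop f x| <= M.
Proof. by move=> fM; elim: N => //= N IH x; exact: Kop_bounded. Qed.

(** By [KopSD] each application of the kernel multiplies the bound on unit increments by [alpha]; it
    starts from the trivial [2 M]. *)
Lemma iter_Kop_lip f (M : R) N : (forall x, `|f x| <= M) ->
  forall x, `|iter N Kop f x.+1 - iter N Kop f x| <= alpha ^+ N * (2 * M).
Proof.
have /andP[a0 a1] := alpha01.
move=> fM; elim: N => [|N IH] x /=.
  rewrite expr0 mul1r (le_trans (ler_normB _ _))//.
  by have := fM x; have := fM x.+1; lra.
have cK : cubic (iter N Kop f) by apply: cubic_bounded; exact: iter_Kop_bounded.
have E x' : `|iter N Kop f x'.+1 - iter N Kop f x'| <= alpha ^+ N * (2 * M) by exact: IH.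
rewrite KopSD// [_ + _ * _]addrC addrK normrM (gtr0_norm a0) exprS -mulrA ler_wpM2l ?(ltW a0)//.
exact: Kop_bounded.
Qed.

Lemma iter_Kop_dist0 f (M : R) N : (forall x, `|f x| <= M) ->
  forall x, `|iter N Kop f x - iter N Kop f 0| <= alpha ^+ N * (2 * M) * x%:R.
Proof.
move=> fM; elim=> [|x IH]; first by rewrite subrr normr0 mulr0.
rewrite (_ : _ - _ = (iter N Kop f x.+1 - iter N Kop f x) + (iter N Kop f x - iter N Kop f 0)); last by ring.
rewrite (le_trans (ler_normD _ _))// -[x.+1%:R]natr1 mulrDr mulr1 addrC lerD//.
exact: iter_Kop_lip.
Qed.

(* Limit law of the chain, seen on bounded functions: the kernel contracts the
   Lipschitz seminorm by [alpha], and bounded functions on [nat] are Lipschitz. *)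
Definition ell f : R := limn (fun N => iter N Kop f 0).

Lemma cvg_ell f (M : R) : (forall x, `|f x| <= M) -> (fun N => iter N Kop f 0) @ \oo --> ell f.
Proof.
have /andP[a0 a1] := alpha01.
move=> fM.
have M0 : 0 <= M by exact: le_trans (fM 0%N).
pose u N := iter N Kop f 0.
(* [u N.+1] averages [iter N Kop f] over one innovation, and that function is within [2 M alpha^N x]
   of its value at 0; the innovation has mean [mu]. *)
have step N : `|u N.+1 - u N| <= (2 * M * mu) * alpha ^+ N.
  rewrite /u /= -[X in _ - X](Kop_cst _ 0) -mulN1r -KopZ; last exact: cubic_cst.
  have cK : cubic (iter N Kop f) by apply: cubic_bounded; exact: iter_Kop_bounded.
  rewrite -KopD//; last exact: cubic_cst.
  rewrite -Kop_mean0 -mulrA (mulrC (Kop _ _)) mulrA -KopZ; last exact: cubic_id.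
  apply: Kop_norm.
  - by apply: cubicD => //; exact: cubic_cst.
  - by apply: cubicZ; exact: cubic_id.
  - by move=> x; rewrite mulN1r (mulrC (2 * M)); exact: iter_Kop_dist0.
have -> : (fun N => iter N Kop f 0) = fun N => u 0%N + series (fun k => u k.+1 - u k) N.
  apply/funext => N; rewrite /series/= telescope_sumr//; rewrite /u; ring.
suff : cvgn (series (fun k => u k.+1 - u k)).
  move=> cs; rewrite /ell (_ : (fun N => iter N Kop f 0) = fun N => u 0%N + series (fun k => u k.+1 - u k) N).
    by apply: (@is_cvgD _ R^o) => //; exact: is_cvg_cst.
  by apply/funext => N; rewrite /series/= telescope_sumr//; rewrite /u; ring.
apply: normed_cvg.
apply: (@series_le_cvg _ _ (fun N => (2 * M * mu) * alpha ^+ N)) => //.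
- by move=> n /=.
- by move=> n; rewrite mulr_ge0 ?exprn_ge0 ?(ltW a0)// mulr_ge0 ?mu_ge0// mulr_ge0.
- by apply: is_cvg_geometric_series; rewrite gtr0_norm.
Qed.

Lemma iter_Kop_ell f (M : R) (e : R) : (forall x, `|f x| <= M) -> 0 < e ->
  \forall N \near \oo, forall x, `|iter N Kop f x - ell f| <= e * (1 + x%:R).
Proof.
have /andP[a0 a1] := alpha01.
move=> fM e0; have /cvgrPdist_le/(_ _ e0) H := cvg_ell f M fM.
have : (fun N => alpha ^+ N * (2 * M)) @ \oo --> 0 * (2 * M).
  apply: cvgM; last exact: cvg_cst.
  by apply: cvg_expr; rewrite gtr0_norm.
rewrite mul0r => /cvgr0Pnorm_le/(_ _ e0) H'.
near=> N => x.
rewrite (_ : _ - _ = (iter N Kop f x - iter N Kop f 0) - (ell f - iter N Kop f 0)); last by ring.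
rewrite (le_trans (ler_normB _ _))// mulrDr mulr1 addrC lerD//.
  by near: N.
rewrite (le_trans (iter_Kop_dist0 f M N fM x))// ler_wpM2r//.
by rewrite (le_trans (ler_norm _))//; near: N.
Unshelve. all: by end_near. Qed.

(** For [g] the sum of [iter j Kop f] over [j < N], [g - Kop g] telescopes to [f - iter N Kop f].
    Stopping at a finite [N] keeps [g] bounded, whereas the contraction controls the full series of
    [iter j Kop f - ell f] only up to linear growth. *)
Lemma approx_poisson f (M : R) (e : R) : (forall x, `|f x| <= M) -> 0 < e ->
  exists g : nat -> R, (exists G : R, forall x, `|g x| <= G) /\
    forall x, `|f x - ell f - (g x - Kop g x)| <= e * (1 + x%:R).
Proof.
move=> fM e0; have [N _ /(_ N (leqnn N)) HN] := iter_Kop_ell f M e fM e0.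
have M0 : 0 <= M by exact: le_trans (fM 0%N).
pose g n x := \sum_(0 <= j < n) iter j Kop f x.
have gb n x : `|g n x| <= n%:R * M.
  rewrite (le_trans (ler_norm_sum _ _ _))// (@le_trans _ _ (\sum_(0 <= j < n) M))//.
    by apply: ler_sum => j _; exact: iter_Kop_bounded.
  by rewrite big_const_nat subn0 iter_addr_0 mulr_natl.
have gE n x : g n x - Kop (g n) x = f x - iter n Kop f x.
  elim: n => [|n IH].
    by rewrite /g (_ : (fun x => _) = fun=> 0) ?Kop_cst ?big_geq ?subrr//; apply/funext => y; rewrite big_geq.
  have gS y : g n.+1 y = g n y + iter n Kop f y by rewrite /g big_nat_recr.
  rewrite (_ : g n.+1 = fun y => g n y + iter n Kop f y); last exact/funext.
  rewrite KopD; last 2 first.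
  - exact: cubic_bounded (gb n).
  - by apply: cubic_bounded; exact: iter_Kop_bounded.
  have -> (a b c d' : R) : a + b - (c + d') = (a - c) + (b - d') by ring.
  by rewrite IH /=; ring.
exists (g N); split; first by exists (N%:R * M) => x; exact: gb.
move=> x; rewrite gE (_ : _ - _ = iter N Kop f x - ell f) ?HN//.
by ring.
Qed.

(** * Third moments along the chain and the tower property for signed functions *)

Context (Y03 : (\int[P]_t (((Y0 t)%:R : R) ^+ 3)%:E < +oo)%E).

Lemma cubic_ge0 (f : nat -> R) (C : R) : (forall x, `|f x| <= C * (1 + x%:R) ^+ 3) -> 0 <= C.
Proof. by move=> fC; have := le_trans (normr_ge0 _) (fC 0%N); rewrite addr0 expr1n mulr1. Qed.

Lemma integrable_adapted k (X : T -> R) (g : T -> R) : adapted k X ->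
  (forall t, `|X t| <= g t) -> P.-integrable setT (EFin \o g) -> P.-integrable setT (EFin \o X).
Proof. by move=> aX; apply: le_integrableR; exact: measurable_adapted aX. Qed.

Definition Kbound := Kop (fun x => (1 + x%:R) ^+ 3) 0.

(** The branching sum is at most [n + eps] and [1 + n + e <= (1 + n) (1 + e)], so the growth
    constant is multiplied by the mean of [(1 + eps)^3]. *)
Lemma Kop_cubic f (C : R) : (forall x, `|f x| <= C * (1 + x%:R) ^+ 3) ->
  forall n, `|Kop f n| <= C * Kbound * (1 + n%:R) ^+ 3.
Proof.
move=> fC n; have C0 := cubic_ge0 _ _ fC.
have cf : cubic f by exists C.
rewrite (le_trans (le_normr_Rintegral _ (integrable_branch n _ cf)))//.
rewrite (_ : C * Kbound * _ = \int[P]_t (C * (1 + n%:R) ^+ 3 * (1 + (eps 1%N t)%:R) ^+ 3)); last first.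
  rewrite RintegralZl//; last exact: (integrable_eps _ cubic_cube).
  by rewrite /Kbound Kop0; ring.
apply: le_Rintegral => //.
- exact: (integrable_norm (integrable_branch n _ cf)).
- apply: (integrableRZ P _ (fun t => (1 + (eps 1%N t)%:R) ^+ 3)).
  exact: (integrable_eps _ cubic_cube).
- move=> t _; rewrite (le_trans (fC _))// -mulrA ler_wpM2l// -exprMn.
  rewrite lerXn2r ?nnegrE ?mulr_ge0 ?addr_ge0//.
  have : (branch 1 n t)%:R <= n%:R + (eps 1%N t)%:R :> R by rewrite -natrD ler_nat branch_le.
  have : 0 <= n%:R * (eps 1%N t)%:R :> R by rewrite mulr_ge0.
  by move: (branch 1 n t)%:R => b; lra.
Qed.

Lemma cubic_Kop f : cubic f -> cubic (Kop f).
Proof. by move=> [C fC]; exists (C * Kbound) => n; exact: Kop_cubic. Qed.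

Lemma adapted_tower k (F : T -> nat -> R) : (forall m, adapted k (F^~ m)) ->
  adapted k (fun t => Kop (fun x => F t (x + shift k.+1)%N) (Y k t)).
Proof.
move=> aF t t' H; rewrite (H k (leqnn k)); congr Kop.
by apply/funext => x; exact: aF.
Qed.

Lemma adapted_next k (F : T -> nat -> R) : (forall m, adapted k (F^~ m)) ->
  adapted k.+1 (fun t => F t (Y k.+1 t)).
Proof.
move=> aF t t' H; rewrite (H k.+1 (leqnn _)); apply: aF => i ik; apply: H.
exact: leqW.
Qed.

Lemma ge0_tower_cubic k (F : T -> nat -> R) : (forall t m, 0 <= F t m) ->
  (forall m, adapted k (F^~ m)) -> (forall t, cubic (F t)) ->
  (\int[P]_t (F t (Y k.+1 t))%:E =
   \int[P]_t (Kop (fun x => F t (x + shift k.+1)%N) (Y k t))%:E)%E.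
Proof.
move=> F0 aF cF; rewrite (tower k (fun t m => (F t m)%:E))//; last first.
  by move=> m t t' H; congr EFin; exact: aF.
apply: eq_integral => t _; rewrite /Kop /Rintegral fineK//.
by apply: integrable_fin_num => //; apply: integrable_branch (cubic_addn _ _ (cF t)).
Qed.

(** The nonnegative tower identity holds before integrability is known, so finiteness passes from
    one time to the next. *)
Lemma Y_cube k : (\int[P]_t (((Y k t)%:R : R) ^+ 3)%:E < +oo)%E.
Proof.
elim: k => [|k IH]; first exact: Y03.
rewrite (ge0_tower_cubic k (fun _ m => m%:R ^+ 3))//; last by move=> t; exact: cubicX.
  have : P.-integrable setT (EFin \o (fun t => Kop (fun x => (x + shift k.+1)%:R ^+ 3) (Y k t))).
    apply: (integrable_cubic (Y k)) IH; first exact: discreteY.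
    exact: cubic_Kop (cubic_addn (fun x => x%:R ^+ 3) _ (cubicX 3 isT)).
  move=> /integrableP[_]; apply: le_lt_trans; apply: ge0_le_integral => //.
  - move=> t _; rewrite lee_fin; apply: Rintegral_ge0 => t' _; exact: exprn_ge0.
  - apply/measurable_EFinP; apply: (measurable_adapted k).
    by apply: (adapted_tower k (fun _ m => m%:R ^+ 3)).
  - apply: measurableT_comp => //; apply/measurable_EFinP; apply: (measurable_adapted k).
    by apply: (adapted_tower k (fun _ m => m%:R ^+ 3)).
  - by move=> t _ /=; rewrite lee_fin ler_norm.
Qed.

Lemma integrable_Y k f : cubic f -> P.-integrable setT (EFin \o (fun t => f (Y k t))).
Proof. by move=> cf; apply: integrable_cubic => //; [exact: discreteY|exact: Y_cube]. Qed.

Lemma integrable_next k (F : T -> nat -> R) (C : R) :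
  (forall m, adapted k (F^~ m)) -> (forall t m, `|F t m| <= C * (1 + m%:R) ^+ 3) ->
  P.-integrable setT (EFin \o (fun t => F t (Y k.+1 t))).
Proof.
move=> aF FC; apply: (integrable_adapted k.+1 _ (fun t => C * (1 + (Y k.+1 t)%:R) ^+ 3)).
- exact: adapted_next.
- by move=> t; exact: FC.
- exact: (integrable_Y k.+1 _ (cubicZ C _ cubic_cube)).
Qed.

Lemma integrable_tower k (F : T -> nat -> R) (C : R) :
  (forall m, adapted k (F^~ m)) -> (forall t m, `|F t m| <= C * (1 + m%:R) ^+ 3) ->
  P.-integrable setT (EFin \o (fun t => Kop (fun x => F t (x + shift k.+1)%N) (Y k t))).
Proof.
move=> aF FC.
pose D := C * (1 + (shift k.+1)%:R) ^+ 3.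
apply: (integrable_adapted k _ (fun t => D * Kbound * (1 + (Y k t)%:R) ^+ 3)).
- exact: adapted_tower.
- move=> t; apply: Kop_cubic => x.
  have C0 := cubic_ge0 _ _ (FC t).
  rewrite (le_trans (FC t _))// /D -mulrA ler_wpM2l// -exprMn.
  rewrite lerXn2r ?nnegrE ?mulr_ge0 ?addr_ge0// natrD.
  have : 0 <= (shift k.+1)%:R * x%:R :> R by rewrite mulr_ge0.
  lra.
- exact: (integrable_Y k _ (cubicZ (D * Kbound) _ cubic_cube)).
Qed.

Lemma tower_cubic k (F : T -> nat -> R) (C : R) :
  (forall m, adapted k (F^~ m)) -> (forall t m, `|F t m| <= C * (1 + m%:R) ^+ 3) ->
  \int[P]_t F t (Y k.+1 t) = \int[P]_t Kop (fun x => F t (x + shift k.+1)%N) (Y k t).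
Proof.
move=> aF FC.
have cF t : cubic (F t) by exists C; exact: FC.
(* The signed identity is the difference of the nonnegative ones for [F + G] and for [G]. *)
pose G (t : T) (m : nat) : R := C * (1 + m%:R) ^+ 3.
have aG m : adapted k (G^~ m) by move=> t t' _.
have cG t : cubic (G t) by exact: cubicZ cubic_cube.
have G0 t m : 0 <= G t m by exact: le_trans (FC t m).
have GC t m : `|G t m| <= C * (1 + m%:R) ^+ 3 by rewrite ger0_norm.
have aFG m : adapted k (fun t => F t m + G t m).
  by move=> t t' H; rewrite (aF m t t' H).
have FG0 t m : 0 <= F t m + G t m.
  by have := FC t m; rewrite ler_norml -/(G t m) -subr_ge0 opprK addrC => /andP[].
have := ge0_tower_cubic k (fun t m => F t m + G t m) FG0 aFG (fun t => cubicD _ _ (cF t) (cG t)).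
move=> /(congr1 fine); rewrite -!/(Rintegral _ _ _).
have := ge0_tower_cubic k G G0 aG cG.
move=> /(congr1 fine); rewrite -!/(Rintegral _ _ _) => EG.
rewrite RintegralD//; [|exact: integrable_next FC|exact: integrable_next GC].
rewrite (_ : (fun t => Kop _ _) = fun t => Kop (fun x => F t (x + shift k.+1)%N) (Y k t) + Kop (fun x => G t (x + shift k.+1)%N) (Y k t)); last first.
  apply/funext => t; rewrite KopD//; first exact: (cubic_addn _ _ (cF t)).
  exact: (cubic_addn _ _ (cG t)).
rewrite RintegralD//; [|exact: integrable_tower FC|exact: integrable_tower GC].
by rewrite EG; exact: addIr.
Qed.

Local Notation s0 := (maxn s1 s2).

(** The condition bears on the time of the starting state: the step from [Y s0] to [Y s0.+1] is
    already free of outliers. *)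
Lemma shift0 k : (s0 <= k)%N -> shift k.+1 = 0%N.
Proof.
rewrite geq_max => /andP[k1 k2]; rewrite /shift.
have -> : (k.+1 == s1) = false by apply/eqP => E; rewrite -E ltnn in k1.
by have -> : (k.+1 == s2) = false by apply/eqP => E; rewrite -E ltnn in k2.
Qed.

Lemma tower0 k (F : T -> nat -> R) (C : R) : (s0 <= k)%N ->
  (forall m, adapted k (F^~ m)) -> (forall t m, `|F t m| <= C * (1 + m%:R) ^+ 3) ->
  \int[P]_t F t (Y k.+1 t) = \int[P]_t Kop (F t) (Y k t).
Proof.
move=> sk aF FC; rewrite (tower_cubic k F C)//; apply: eq_Rintegral => t _.
by rewrite shift0//; congr Kop; apply/funext => x; rewrite addn0.
Qed.

(** * Moments, stationary law and laws of large numbers *)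

(** Each step shrinks the distance to the fixed point by the factor [a], up to an error
    [(e / 2) (1 - a)]; these errors add up geometrically to at most [e / 2]. *)
Lemma cvg_affine_rec (u b : nat -> R) (a beta : R) k0 : 0 <= a < 1 ->
  (forall k, (k0 <= k)%N -> u k.+1 = a * u k + b k) -> b @ \oo --> beta ->
  u @ \oo --> beta / (1 - a).
Proof.
move=> /andP[a0 a1] uE bcv.
have a10 : 0 < 1 - a by rewrite subr_gt0.
apply/cvgrPdist_le => e ep.
have e1 : 0 < e / 2 * (1 - a) by rewrite mulr_gt0// divr_gt0.
move/cvgrPdist_le : bcv => /(_ _ e1)[K1 _ HK].
pose K := maxn k0 K1.
pose v k : R := `|u k - beta / (1 - a)|.
have step j : v (K + j)%N <= a ^+ j * v K + e / 2.
  elim: j => [|j IH]; first by rewrite addn0 expr0 mul1r lerDl divr_ge0// ltW.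
  rewrite addnS /v uE; last by rewrite (leq_trans (leq_maxl k0 K1))// leq_addr.
  have -> : a * u (K + j)%N + b (K + j)%N - beta / (1 - a) =
    a * (u (K + j)%N - beta / (1 - a)) - (beta - b (K + j)%N).
    by field; rewrite gt_eqF.
  rewrite (le_trans (ler_normB _ _))// normrM (ger0_norm a0).
  have H1 : `|beta - b (K + j)%N| <= e / 2 * (1 - a).
    by apply: HK => /=; rewrite (leq_trans (leq_maxr k0 K1))// leq_addr.
  have H2 : a * `|u (K + j)%N - beta / (1 - a)| <= a * (a ^+ j * v K + e / 2).
    by rewrite ler_wpM2l.
  by apply: (le_trans (lerD H2 H1)); rewrite /v exprS; lra.
have : (fun j => a ^+ j * v K) @ \oo --> 0 * v K.
  by apply: cvgM; [apply: cvg_expr; rewrite ger0_norm|exact: cvg_cst].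
have e2' : 0 < e / 2 by rewrite divr_gt0.
rewrite mul0r => /cvgr0Pnorm_le/(_ _ e2')[J _ HJ].
exists (K + J)%N => //= n Kn.
rewrite distrC -(subnKC (leq_trans (leq_addr J K) Kn)) (le_trans (step _))//.
rewrite [leRHS]splitr lerD2r (le_trans (ler_norm _))// HJ//=.
by rewrite leq_subRL// (leq_trans (leq_addr J K)).
Qed.

Lemma cubic_poly a b c e :
  cubic (fun x => a * x%:R ^+ 3 + b * x%:R ^+ 2 + c * x%:R + e).
Proof.
apply: cubicD; last exact: cubic_cst.
apply: cubicD; last exact: cubicZ cubic_id.
by apply: cubicD; apply: cubicZ; exact: cubicX.
Qed.

Definition mom p k := \int[P]_t (Y k t)%:R ^+ p.

Lemma integral_Y_poly k (a b c e : R) :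
  \int[P]_t (a * (Y k t)%:R ^+ 3 + b * (Y k t)%:R ^+ 2 + c * (Y k t)%:R + e) =
  a * mom 3 k + b * mom 2 k + c * mom 1 k + e.
Proof.
have i3 := integrable_Y k _ (cubicX 3 isT).
have i2 := integrable_Y k _ (cubicX 2 isT).
have i1 := integrable_Y k _ cubic_id.
have j3 := integrableRZ P a _ i3; have j2 := integrableRZ P b _ i2.
have j1 := integrableRZ P c _ i1.
have je := integrable_cstR P (e).
rewrite (RintegralD _ (integrableRD _ _ _ (integrableRD _ _ _ j3 j2) j1) je)//.
rewrite (RintegralD _ (integrableRD _ _ _ j3 j2) j1)// (RintegralD _ j3 j2)//.
by rewrite Rintegral_prob_cst (RintegralZl _ _ i3)// (RintegralZl _ _ i2)// (RintegralZl _ _ i1)//.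
Qed.

Lemma tower_Kop k f : (s0 <= k)%N -> cubic f ->
  \int[P]_t f (Y k.+1 t) = \int[P]_t Kop f (Y k t).
Proof. by move=> sk [C fC]; apply: (tower0 k (fun=> f) C). Qed.

Lemma mom1S k : (s0 <= k)%N -> mom 1 k.+1 = alpha * mom 1 k + mu.
Proof.
move=> sk; rewrite {1}/mom (tower_Kop k (fun x => x%:R ^+ 1))//; last exact: cubicX.
rewrite (_ : _ + _ = 0 * mom 3 k + 0 * mom 2 k + alpha * mom 1 k + mu); last by ring.
rewrite -integral_Y_poly; apply: eq_Rintegral => t _.
by rewrite [LHS]Kop_mean; ring.
Qed.

Lemma mom2S k : (s0 <= k)%N -> mom 2 k.+1 = alpha ^+ 2 * mom 2 k +
  ((alpha * (1 - alpha) + 2 * alpha * mu) * mom 1 k + e2).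
Proof.
move=> sk; rewrite {1}/mom (tower_Kop k (fun x => x%:R ^+ 2))//; last exact: cubicX.
rewrite (_ : _ + _ = 0 * mom 3 k + alpha ^+ 2 * mom 2 k + (alpha * (1 - alpha) + 2 * alpha * mu) * mom 1 k + e2); last by ring.
rewrite -integral_Y_poly; apply: eq_Rintegral => t _.
by rewrite Kop_sqr; ring.
Qed.

Lemma mom3S k : (s0 <= k)%N -> mom 3 k.+1 = alpha ^+ 3 * mom 3 k +
  (k32 * mom 2 k + k31 * mom 1 k + e3).
Proof.
move=> sk; rewrite {1}/mom (tower_Kop k (fun x => x%:R ^+ 3))//; last exact: cubicX.
rewrite (_ : _ + _ = alpha ^+ 3 * mom 3 k + k32 * mom 2 k + k31 * mom 1 k + e3); last by ring.
rewrite -integral_Y_poly; apply: eq_Rintegral => t _.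
by rewrite Kop_cube; ring.
Qed.

(** [m1], [m2] and [m3] are the limits of the three affine moment recursions; [pim1], [pim2] and
    [pim3] identify them with the moments of [pi]. *)
Definition m1 := mu / (1 - alpha).
Definition m2 := ((alpha * (1 - alpha) + 2 * alpha * mu) * m1 + e2) / (1 - alpha ^+ 2).
Definition m3 := (k32 * m2 + k31 * m1 + e3) / (1 - alpha ^+ 3).

Lemma alphaX_lt1 p : (0 < p)%N -> 0 <= alpha ^+ p < 1.
Proof.
have /andP[a0 a1] := alpha01.
by move=> p0; rewrite exprn_ge0 ?(ltW a0)//= exprn_ilt1// ?(ltW a0)// -lt0n.
Qed.

Lemma cvg_mom1 : mom 1 @ \oo --> m1.
Proof.
apply: (cvg_affine_rec (mom 1) (fun=> mu) alpha mu s0); first exact: (alphaX_lt1 1 isT).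
  exact: mom1S.
exact: cvg_cst.
Qed.

Lemma cvg_mom2 : mom 2 @ \oo --> m2.
Proof.
apply: (cvg_affine_rec (mom 2) (fun k => (alpha * (1 - alpha) + 2 * alpha * mu) * mom 1 k + e2) (alpha ^+ 2) _ s0).
- exact: alphaX_lt1.
- exact: mom2S.
- apply: (@cvgD _ R^o); last exact: cvg_cst.
  by apply: (@cvgM _ _ _ _ (cst _)); [exact: cvg_cst|exact: cvg_mom1].
Qed.

Lemma cvg_mom3 : mom 3 @ \oo --> m3.
Proof.
apply: (cvg_affine_rec (mom 3) (fun k => k32 * mom 2 k + k31 * mom 1 k + e3) (alpha ^+ 3) _ s0).
- exact: alphaX_lt1.
- exact: mom3S.
- apply: (@cvgD _ R^o); last exact: cvg_cst.
  apply: (@cvgD _ R^o).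
    by apply: (@cvgM _ _ _ _ (cst k32)); [exact: cvg_cst|exact: cvg_mom2].
  by apply: (@cvgM _ _ _ _ (cst k31)); [exact: cvg_cst|exact: cvg_mom1].
Qed.

Lemma mom_ge0 p k : 0 <= mom p k.
Proof. by apply: Rintegral_ge0 => t _; exact: exprn_ge0. Qed.

Lemma tower_iter f (M : R) N : (forall x, `|f x| <= M) ->
  \int[P]_t f (Y (s0 + N)%N t) = \int[P]_t iter N Kop f (Y s0 t).
Proof.
elim: N f => [|N IH] f fM; first by rewrite addn0.
rewrite addnS (tower_Kop (s0 + N)%N f (leq_addr _ _) (cubic_bounded _ _ fM)).
by rewrite (IH (Kop f)) ?iterSr//; exact: Kop_bounded.
Qed.

(** The mean at time [s0 + N] is that of [iter N Kop f (Y s0)]. The error in [iter_Kop_ell] is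
    linear in the state, hence the normalisation by [1 + mom 1 s0]. *)
Lemma cvg_law f (M : R) : (forall x, `|f x| <= M) ->
  (fun k => \int[P]_t f (Y k t)) @ \oo --> ell f.
Proof.
move=> fM; rewrite -(cvg_shiftn s0); apply/cvgrPdist_le => e e0.
have D0 : 0 < 1 + mom 1 s0 by rewrite ltr_wpDr// mom_ge0.
have e1 : 0 < e / (1 + mom 1 s0) by rewrite divr_gt0.
have := iter_Kop_ell f M _ fM e1; apply: filterS => N HN.
rewrite /= addnC (tower_iter _ M)//.
have iK : P.-integrable setT (EFin \o (fun t => iter N Kop f (Y s0 t))).
  by apply: integrable_Y; apply: cubic_bounded; exact: iter_Kop_bounded.
have ic := integrable_cstR P (ell f).
rewrite distrC -[X in _ - X](Rintegral_prob_cst P) -RintegralB//.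
rewrite (le_trans (le_normr_Rintegral _ (integrableRB _ _ _ iK ic)))//.
have i1 := integrable_Y s0 _ (cubic_poly 0 0 (e / (1 + mom 1 s0)) (e / (1 + mom 1 s0))).
apply: (@le_trans _ _ (\int[P]_t (0 * (Y s0 t)%:R ^+ 3 + 0 * (Y s0 t)%:R ^+ 2 + e / (1 + mom 1 s0) * (Y s0 t)%:R + e / (1 + mom 1 s0)))).
  apply: le_Rintegral => //.
  - exact: (integrable_norm (integrableRB _ _ _ iK ic)).
  - by move=> t _; rewrite (le_trans (HN _))//; lra.
rewrite integral_Y_poly !mul0r !add0r.
by rewrite le_eqVlt; apply/orP; left; apply/eqP; field; rewrite gt_eqF.
Qed.

(** * The stationary law and its moments *)

Context (pi : nat -> R) (Hpi : inar_stationary P eps xi pi).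

Let pi_ge0 n : 0 <= pi n. Proof. by case: Hpi. Qed.

(** Extended-valued, so that moments of [pi] can be handled before they are known to be finite. *)
Definition piE (f : nat -> \bar R) : \bar R := (\sum_(0 <= n <oo) (pi n)%:E * f n)%E.

Lemma piE_ge0 f : (forall x, 0 <= f x)%E -> (0 <= piE f)%E.
Proof. by move=> f0; apply: nneseries_ge0 => n _ _; rewrite mule_ge0// lee_fin. Qed.

Lemma piE_cst (c : R) : 0 <= c -> piE (fun=> c%:E) = c%:E.
Proof.
move=> c0; rewrite /piE; under eq_eseriesr do rewrite muleC.
rewrite nneseriesZl; last by move=> n _; rewrite lee_fin.
by case: Hpi => _ -> _; rewrite mule1.
Qed.

Lemma piE_D f g : (forall x, 0 <= f x)%E -> (forall x, 0 <= g x)%E ->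
  piE (fun x => f x + g x)%E = (piE f + piE g)%E.
Proof.
move=> f0 g0; rewrite /piE -nneseriesD.
- by apply: eq_eseriesr => n _; rewrite ge0_muleDr.
- by move=> n _ _; rewrite mule_ge0// lee_fin.
- by move=> n _ _; rewrite mule_ge0// lee_fin.
Qed.

Lemma piE_Z (c : R) f : (forall x, 0 <= f x)%E ->
  piE (fun x => c%:E * f x)%E = (c%:E * piE f)%E.
Proof.
move=> f0; rewrite /piE -nneseriesZl.
  by apply: eq_eseriesr => n _; rewrite muleCA.
by move=> n _; rewrite mule_ge0// lee_fin.
Qed.

Lemma piE_le f g : (forall x, 0 <= f x)%E -> (forall x, f x <= g x)%E -> (piE f <= piE g)%E.
Proof.
move=> f0 fg; apply: lee_nneseries => n; first by move=> _ _; rewrite mule_ge0// lee_fin.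
by move=> _; rewrite lee_wpmul2l// lee_fin.
Qed.

Lemma piE_stationary (f : nat -> R) : (forall x, 0 <= f x) ->
  piE (fun n => \int[P]_t (f (branch 1 n t))%:E)%E = piE (EFin \o f).
Proof.
move=> f0; rewrite /piE.
transitivity (\sum_(0 <= n <oo) \sum_(0 <= m <oo) ((f m)%:E * (pi n * kern n m)%:E))%E.
  apply: eq_eseriesr => n _.
  rewrite (ge0_integral_discrete_pr (branch 1 n) setT (EFin \o f))//; last exact: discrete_branch.
  rewrite -nneseriesZl; last by move=> m _; rewrite mule_ge0// lee_fin ?pr_ge0//= f0.
  by apply: eq_eseriesr => m _; rewrite setTI -kernE EFinM muleCA.
have kap0 n m : 0 <= kern n m by rewrite kernE pr_ge0.
rewrite nneseries_interchange; last first.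
  by move=> n m; rewrite mule_ge0// lee_fin ?f0// mulr_ge0.
apply: eq_eseriesr => m _; case: Hpi => _ _ /(_ m) <-.
rewrite nneseriesZl; last by move=> n _; rewrite lee_fin mulr_ge0.
rewrite muleC; congr (_ * _)%E; apply: eq_eseriesr => n _.
by rewrite kernE.
Qed.

Lemma piE_Kop f : cubic f -> (forall x, 0 <= f x) -> piE (EFin \o Kop f) = piE (EFin \o f).
Proof.
move=> cf f0; rewrite -(piE_stationary f)// /piE; apply: eq_eseriesr => n _; congr (_ * _)%E.
rewrite /Kop /Rintegral /= fineK//.
by apply: integrable_fin_num => //; exact: integrable_branch.
Qed.

Definition trunc c (f : nat -> R) (x : nat) : R := if (x < c)%N then f x else 0.

Lemma piE_trunc c f : piE (EFin \o trunc c f) = (\sum_(0 <= n < c) pi n * f n)%:E.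
Proof.
rewrite /piE.
have E0 n : (c <= n)%N -> ((pi n)%:E * (EFin \o trunc c f) n = 0)%E.
  by move=> cn; rewrite /= /trunc ltnNge cn mule0.
have -> : (\sum_(0 <= n <oo) ((pi n)%:E * (EFin \o trunc c f) n) =
          \sum_(0 <= n < c) ((pi n)%:E * (EFin \o trunc c f) n))%E.
  apply: cvg_lim => //; apply: cvg_near_cst; near=> N.
  have cN : (c <= N)%N by near: N; exact: nbhs_infty_ge.
  rewrite (big_cat_nat _ (n := c))//= [X in (_ + X)%E]big1_seq ?adde0//.
  by move=> n; rewrite mem_index_iota => /andP[_ /andP[cn _]]; exact: E0.
rewrite -sumEFin; apply: eq_big_nat => n /andP[_ nc].
by rewrite /= /trunc nc EFinM.
Unshelve. all: by end_near. Qed.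

Lemma cvg_pi_sum (f : nat -> R) (r : R) : (forall x, 0 <= f x) -> piE (EFin \o f) = r%:E ->
  (fun c => \sum_(0 <= n < c) pi n * f n) @ \oo --> r.
Proof.
move=> f0 fr.
have H : (fun c => (\sum_(0 <= n < c) (pi n)%:E * (f n)%:E)%E) @ \oo --> r%:E.
  rewrite -fr; apply: is_cvg_nneseries => n _ _.
  by rewrite mule_ge0// lee_fin.
apply: (@fine_cvg _ _ \oo _ (fun c => (\sum_(0 <= n < c) pi n * f n)%:E)).
rewrite (_ : (fun c => _) = fun c => (\sum_(0 <= n < c) (pi n)%:E * (f n)%:E)%E)//.
by apply/funext => c; rewrite -sumEFin; apply: eq_bigr => n _; rewrite EFinM.
Qed.

Lemma piE_iter (f : nat -> R) (M : R) N : (forall x, 0 <= f x <= M) ->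
  piE (EFin \o iter N Kop f) = piE (EFin \o f).
Proof.
move=> fM; elim: N => //= N IH; rewrite piE_Kop//.
- apply: (@cubic_bounded _ M); apply: iter_Kop_bounded => x.
  by case/andP: (fM x) => f0 fM'; rewrite ger0_norm.
- elim: N {IH} => [|N IH] x /=; first by case/andP: (fM x).
  by apply: Rintegral_ge0 => t _; exact: IH.
Qed.

(** Stationarity lets [iter N Kop f] replace [f]. It is within [e] of [ell f] on the states below
    [c], and the other states have [pi]-mass at most [e], which costs at most [M e]. In effect [pi]
    is unique. *)
Lemma piE_ell (f : nat -> R) (M : R) : (forall x, 0 <= f x <= M) -> piE (EFin \o f) = (ell f)%:E.
Proof.
move=> fM.
have f0 x : 0 <= f x by case/andP: (fM x).
have fM' x : `|f x| <= M by case/andP: (fM x) => ? ?; rewrite ger0_norm.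
have M0 : 0 <= M by exact: le_trans (fM' 0%N).
have KN0 N x : 0 <= iter N Kop f x.
  by elim: N x => [|N IH] x //=; apply: Rintegral_ge0 => t _; exact: IH.
have ell0 : 0 <= ell f.
  by apply: limr_ge; [apply/cvg_ex; exists (ell f); exact: cvg_ell fM'|exact: nearW].
have ellM : ell f <= M.
  apply: limr_le; first by apply/cvg_ex; exists (ell f); exact: cvg_ell fM'.
  by apply: nearW => N; rewrite (le_trans (ler_norm _))// iter_Kop_bounded.
pose r := fine (piE (EFin \o f)).
have fr : piE (EFin \o f) = r%:E.
  rewrite fineK// ge0_fin_numE; last by apply: piE_ge0 => x; rewrite lee_fin.
  rewrite (@le_lt_trans _ _ (piE (fun=> M%:E)))//; last by rewrite piE_cst// ltry.
  by apply: piE_le => x; rewrite lee_fin//; case/andP: (fM x).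
rewrite fr; congr EFin.
have dist (e : R) : 0 < e -> `|r - ell f| <= e * (1 + M).
  move=> e0.
  have p1 : piE (EFin \o (fun=> 1)) = 1%:E by rewrite -piE_cst.
  have /cvgrPdist_le/(_ _ e0)[c _ /(_ c (leqnn c)) Hc] := cvg_pi_sum (fun=> 1) 1 (fun=> ler01) p1.
  pose ge_c (x : nat) : R := if (x < c)%N then 0 else 1.
  have ge_c0 x : 0 <= ge_c x by rewrite /ge_c; case: ifP.
  have tail : (piE (EFin \o ge_c) <= e%:E)%E.
    have E1 : (1%:E = piE (EFin \o ge_c) + (\sum_(0 <= n < c) pi n * 1)%:E)%E.
      rewrite -[in LHS]p1 -(piE_trunc c (fun=> 1)) -piE_D.
      - congr piE; apply/funext => x /=; rewrite /ge_c /trunc.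
        by case: ifP => _; rewrite -EFinD; congr EFin; rewrite ?add0r ?addr0.
      - by move=> x /=; rewrite lee_fin.
      - by move=> x /=; rewrite lee_fin /trunc; case: ifP.
    move: Hc E1; rewrite /=; set q := \sum_(_ <= _ < _) _ => Hc.
    case: (piE (EFin \o ge_c)) => [y| |] //.
    rewrite -EFinD => -[E1]; rewrite lee_fin.
    by apply: le_trans Hc; rewrite E1 addrK ler_norm.
  have c10 : 0 < (1 + c%:R : R) by rewrite ltr_pwDl.
  (* With this tolerance the error [e (1 + x) / (1 + c)] is at most [e] for every [x < c]. *)
  have e1 : 0 < e / (1 + c%:R) by rewrite divr_gt0.
  have [N _ /(_ N (leqnn N)) HN] := iter_Kop_ell f M _ fM' e1.
  have near_c x : `|iter N Kop f x - ell f| <= e + M * ge_c x.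
    have [xc|xc] := ltnP x c.
      rewrite /ge_c xc mulr0 addr0 (le_trans (HN x))// mulrAC ler_pdivrMr// ler_wpM2l ?(ltW e0)//.
      by rewrite lerD2l ler_nat ltnW.
    rewrite /ge_c ltnNge xc mulr1 ler_norml.
    have := KN0 N x; have : iter N Kop f x <= M.
      by rewrite (le_trans (ler_norm _))// iter_Kop_bounded.
    by move=> ? ?; apply/andP; split; lra.
  have bnd : (piE (fun x => e%:E + M%:E * (ge_c x)%:E) <= (e + M * e)%:E)%E.
    rewrite piE_D; [|by move=> x; rewrite lee_fin ltW|by move=> x; rewrite lee_fin mulr_ge0].
    rewrite piE_cst ?(ltW e0)// piE_Z; last by move=> x; rewrite lee_fin.
    by rewrite EFinD EFinM leeD2l// lee_wpmul2l// lee_fin.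
  have b0 x : (0 <= e%:E + M%:E * (ge_c x)%:E)%E.
    by rewrite -EFinM -EFinD lee_fin addr_ge0 ?(ltW e0)// mulr_ge0.
  have -> : e * (1 + M) = e + M * e by ring.
  rewrite ler_distl; apply/andP; split.
    rewrite lerBlDr -lee_fin EFinD -fr -(piE_iter f M N fM).
    rewrite -[leLHS]piE_cst//.
    apply: (@le_trans _ _ (piE (fun x => (iter N Kop f x)%:E + (e%:E + M%:E * (ge_c x)%:E))%E)).
      apply: piE_le => x; first by rewrite lee_fin.
      rewrite -EFinM -!EFinD lee_fin.
      by have := near_c x; rewrite ler_distl => /andP[]; lra.
    by rewrite piE_D//; [rewrite leeD2l|move=> x; rewrite lee_fin].
  rewrite -lee_fin EFinD -fr -(piE_iter f M N fM).
  apply: (@le_trans _ _ (piE (fun x => (ell f)%:E + (e%:E + M%:E * (ge_c x)%:E))%E)).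
    apply: piE_le => x; first by rewrite /= lee_fin.
    rewrite -EFinM -!EFinD lee_fin.
    by have := near_c x; rewrite ler_distl => /andP[]; lra.
  by rewrite piE_D// piE_cst// leeD2l.
apply/eqP; rewrite -subr_eq0 -normr_le0; apply/ler_addgt0Pl => e e0.
rewrite addr0 -(@divfK _ (1 + M) _ e) ?dist ?divr_gt0 ?ltr_pwDl//.
by rewrite gt_eqF// ltr_pwDl.
Qed.

Lemma trunc_bounded c f : exists M : R, forall x, `|trunc c f x| <= M.
Proof.
exists (\sum_(0 <= n < c) `|f n|) => x; rewrite /trunc; case: ltnP => xc.
  rewrite (big_cat_nat _ (n := x))//=; last exact: ltnW.
  by rewrite (big_ltn xc) addrCA lerDl addr_ge0// sumr_ge0.
by rewrite normr0 sumr_ge0.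
Qed.

Lemma ell_trunc c f : (forall x, 0 <= f x) -> ell (trunc c f) = \sum_(0 <= n < c) pi n * f n.
Proof.
move=> f0; apply: EFin_inj; rewrite -piE_trunc.
have [M HM] := trunc_bounded c f.
rewrite (piE_ell _ M)// => x; rewrite (le_trans (ler_norm _) (HM x)) andbT.
by rewrite /trunc; case: ifP.
Qed.

(** A truncated moment of [pi] is the limit of truncated moments of the chain, hence at most [m];
    then the level tends to infinity. This is how the moments of [pi] are seen to be finite. *)
Lemma piE_moment_le p (m : R) : (p <= 3)%N -> mom p @ \oo --> m ->
  (piE (fun x => (x%:R ^+ p)%:E) <= m%:E)%E.
Proof.
move=> p3 mcv; pose f (x : nat) : R := x%:R ^+ p.
have f0 x : 0 <= f x by exact: exprn_ge0.
apply: lime_le.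
  by apply: is_cvg_nneseries => n _ _; rewrite mule_ge0// lee_fin.
apply: nearW => c.
rewrite (_ : \sum_(0 <= n < c) _ = (\sum_(0 <= n < c) pi n * f n)%:E); last first.
  by rewrite -sumEFin; apply: eq_bigr => n _; rewrite EFinM.
rewrite -ell_trunc// lee_fin.
have [M HM] := trunc_bounded c f.
apply: (ler_cvg_to (cvg_law _ M HM) mcv); apply: nearW => k.
apply: le_Rintegral => //.
- by apply: integrable_Y; exact: cubic_bounded HM.
- exact: (integrable_Y k f (cubicX p p3)).
- by move=> t _; rewrite /trunc; case: ifP => // _; exact: f0.
Qed.

Definition pim p : R := fine (piE (fun x => (x%:R ^+ p)%:E)).

Lemma pimE p : (0 < p <= 3)%N -> piE (fun x => (x%:R ^+ p)%:E) = (pim p)%:E.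
Proof.
move=> p3; rewrite fineK// ge0_fin_numE; last first.
  by apply: piE_ge0 => x; rewrite lee_fin exprn_ge0.
have [m mcv] : exists m : R, mom p @ \oo --> m.
  case: p p3 => [|[|[|[|p]]]] // _.
  - by exists m1; exact: cvg_mom1.
  - by exists m2; exact: cvg_mom2.
  - by exists m3; exact: cvg_mom3.
by rewrite (le_lt_trans (piE_moment_le p m _ mcv)) ?ltry//; case/andP: p3.
Qed.

Lemma piE_poly a b c e : 0 <= a -> 0 <= b -> 0 <= c -> 0 <= e ->
  piE (fun x => (a * x%:R ^+ 3 + b * x%:R ^+ 2 + c * x%:R ^+ 1 + e)%:E) =
  (a * pim 3 + b * pim 2 + c * pim 1 + e)%:E.
Proof.
move=> a0 b0 c0 e0.
have X0 p (x : nat) : (0 <= (x%:R ^+ p : R)%:E)%E by rewrite lee_fin exprn_ge0.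
have M0 (u : R) p (x : nat) : 0 <= u -> (0 <= u%:E * (x%:R ^+ p : R)%:E)%E.
  by move=> u0; rewrite mule_ge0.
transitivity (piE (fun x => a%:E * (x%:R ^+ 3)%:E + b%:E * (x%:R ^+ 2)%:E + c%:E * (x%:R ^+ 1)%:E + e%:E)%E).
  by congr piE; apply/funext => x; rewrite -!EFinM -!EFinD.
rewrite piE_D; [|by move=> x; rewrite !adde_ge0// M0|by move=> x].
rewrite piE_D; [|by move=> x; rewrite !adde_ge0// M0|by move=> x; exact: M0].
rewrite piE_D; [|by move=> x; exact: M0|by move=> x; exact: M0].
by rewrite !piE_Z// !pimE// piE_cst.
Qed.

Lemma Kop_ge0 f n : (forall x, 0 <= f x) -> 0 <= Kop f n.
Proof. by move=> f0; apply: Rintegral_ge0 => t _. Qed.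

Lemma e2_ge0 : 0 <= e2. Proof. by apply: Kop_ge0 => x; exact: exprn_ge0. Qed.

Lemma e3_ge0 : 0 <= e3. Proof. by apply: Kop_ge0 => x; exact: exprn_ge0. Qed.

Lemma pim_inv p : (0 < p <= 3)%N -> piE (EFin \o Kop (fun x => x%:R ^+ p)) = (pim p)%:E.
Proof.
move=> p3; rewrite piE_Kop//; first by rewrite -pimE.
by apply: cubicX; case/andP: p3.
Qed.

(** Once the moment is known to be finite, stationarity tested on [x] is a linear equation with [m1]
    as its only solution. The higher moments follow the same pattern. *)
Lemma pim1 : pim 1 = m1.
Proof.
have /andP[a0 a1] := alpha01.
have := pim_inv 1 isT.
rewrite (_ : EFin \o _ = fun x : nat => (0 * x%:R ^+ 3 + 0 * x%:R ^+ 2 + alpha * x%:R ^+ 1 + mu)%:E); last first.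
  by apply/funext => x /=; rewrite [Kop _ x]Kop_mean; congr EFin; ring.
rewrite piE_poly ?mu_ge0 ?(ltW a0)// => -[E].
apply: (@mulfI _ (1 - alpha)); first by rewrite subr_eq0 eq_sym lt_eqF.
rewrite /m1 mulrCA divff ?mulr1; last by rewrite subr_eq0 eq_sym lt_eqF.
by rewrite mulrBl mul1r; move: E; lra.
Qed.

Lemma alpha_nat_ge0 : [/\ 0 <= alpha, 0 <= 1 - alpha & 0 <= mu].
Proof. by have /andP[a0 a1] := alpha01; split; rewrite ?subr_ge0 ?mu_ge0// ltW. Qed.

Lemma pim2 : pim 2 = m2.
Proof.
have [a0 a1 u0] := alpha_nat_ge0.
have := pim_inv 2 isT.
pose k21 := alpha * (1 - alpha) + 2 * alpha * mu.
have k0 : 0 <= k21 by rewrite /k21 addr_ge0 ?mulr_ge0.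
rewrite (_ : EFin \o _ = fun x : nat => (0 * x%:R ^+ 3 + alpha ^+ 2 * x%:R ^+ 2 + k21 * x%:R ^+ 1 + e2)%:E); last first.
  by apply/funext => x /=; rewrite Kop_sqr; congr EFin; rewrite /k21; ring.
rewrite piE_poly ?e2_ge0 ?exprn_ge0// => -[E].
have n0 : 1 - alpha ^+ 2 != 0.
  by have /andP[_ H] := alphaX_lt1 2 isT; rewrite subr_eq0 eq_sym lt_eqF.
apply: (@mulfI _ (1 - alpha ^+ 2)) => //.
rewrite /m2 [RHS]mulrCA divff// mulr1 -pim1 -/k21.
by rewrite mulrBl mul1r; move: E; lra.
Qed.

Lemma pim3 : pim 3 = m3.
Proof.
have [a0 a1 u0] := alpha_nat_ge0.
have k0 : 0 <= k32 by rewrite /k32 addr_ge0 ?mulr_ge0 ?exprn_ge0.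
(* [k31] may be negative, while [piE] is handled on nonnegative functions; [|k31| x] is therefore
   added to both sides. *)
have E1 : piE (fun x : nat => (Kop (fun x => x%:R ^+ 3) x)%:E + `|k31|%:E * (x%:R ^+ 1)%:E)%E =
    (pim 3 + `|k31| * pim 1)%:E.
  rewrite piE_D; last 2 first.
  - by move=> x; rewrite lee_fin; apply: Kop_ge0 => y; exact: exprn_ge0.
  - by move=> x; rewrite mule_ge0// lee_fin ?exprn_ge0.
  by rewrite (pim_inv 3 isT) piE_Z ?pimE// => x; rewrite lee_fin exprn_ge0.
have k31' : 0 <= k31 + `|k31| by have := ler_norm (- k31); rewrite normrN; lra.
move: E1; rewrite (_ : (fun x => _) = fun x : nat =>
    (alpha ^+ 3 * x%:R ^+ 3 + k32 * x%:R ^+ 2 + (k31 + `|k31|) * x%:R ^+ 1 + e3)%:E); last first.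
  apply/funext => x; rewrite Kop_cube -EFinM -EFinD; congr EFin; ring.
rewrite piE_poly ?e3_ge0 ?exprn_ge0// => -[E].
have n0 : 1 - alpha ^+ 3 != 0.
  by have /andP[_ H] := alphaX_lt1 3 isT; rewrite subr_eq0 eq_sym lt_eqF.
apply: (@mulfI _ (1 - alpha ^+ 3)) => //.
rewrite /m3 [RHS]mulrCA divff// mulr1 -pim1 -pim2.
by rewrite mulrBl mul1r; move: E; lra.
Qed.

Lemma dist_moment_pim p : dist_moment pi p = pim p.
Proof.
congr fine; apply: eq_eseriesr => n _.
by rewrite -EFinM mulrC.
Qed.

(* Uniform integrability of [Y k ^ 3]: its mean converges to the third moment
   of [pi], and so do the truncated means, to the truncated moments. *)
Lemma tail_cube (e : R) : 0 < e -> exists c k0, forall k, (k0 <= k)%N ->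
  \int[P]_t ((Y k t)%:R ^+ 3 - trunc c (fun x => x%:R ^+ 3) (Y k t)) <= e.
Proof.
move=> e0; have e2' : 0 < e / 2 by rewrite divr_gt0.
pose f (x : nat) : R := x%:R ^+ 3.
have f0 x : 0 <= f x by exact: exprn_ge0.
have /cvgrPdist_le/(_ _ e2')[c _ /(_ c (leqnn c)) Hc] := cvg_pi_sum f (pim 3) f0 (pimE 3 isT).
have [M HM] := trunc_bounded c f.
have : (fun k => mom 3 k - \int[P]_t trunc c f (Y k t)) @ \oo --> m3 - ell (trunc c f).
  by apply: (@cvgB _ R^o); [exact: cvg_mom3|exact: cvg_law _ _ HM].
move=> /cvgrPdist_le/(_ _ e2')[k0 _ Hk].
exists c, k0 => k kk; have := Hk k kk; rewrite /= => {}Hk.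
rewrite RintegralB//; last 2 first.
- exact: (integrable_Y k f (cubicX 3 isT)).
- exact: (integrable_Y k _ (cubic_bounded _ _ HM)).
rewrite -/(mom 3 k) -/f.
move: Hk Hc; rewrite ell_trunc// -pim3 => /ler_normlP[H1 H2] /ler_normlP[H3 H4].
move: H1 H2 H3 H4 => /=.
set a := \int[P]_t _; set b := \sum_(_ <= _ < _) _; move: (mom 3 k) => q.
by move: (pim 3) => z; lra.
Qed.

Lemma mom1_bounded : exists2 C : R, 0 <= C & forall k, mom 1 k <= C.
Proof.
have /cvg_seq_bounded[C [_ HC]] : cvgn (mom 1) by apply/cvg_ex; exists m1; exact: cvg_mom1.
have H k : mom 1 k <= C + 1.
  by rewrite (le_trans (ler_norm _))//; apply: (HC (C + 1)) => //; rewrite ltrDl.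
by exists (C + 1) => //; exact: le_trans (mom_ge0 1 0) (H 0%N).
Qed.

(** * Laws of large numbers with weights *)

Lemma norm_Rintegral_le (X : T -> R) (C : R) : measurable_fun setT X ->
  (forall t, `|X t| <= C) -> `|\int[P]_t X t| <= C.
Proof.
move=> mX XC; have iX := integrable_bounded P X C mX XC.
rewrite (le_trans (le_normr_Rintegral _ iX))// -[leRHS](Rintegral_prob_cst P).
apply: le_Rintegral => //; first exact: (integrable_norm iX).
exact: integrable_cstR.
Qed.

Lemma nat_large (x : R) : exists N, forall n, (N <= n)%N -> x <= n%:R.
Proof.
exists (Num.truncn x).+1 => n Nn; rewrite (le_trans (ltW (truncnS_gt x)))//.
by rewrite ler_nat.
Qed.

Lemma sqrt_large (x : R) : exists N, forall n, (N <= n)%N -> x <= Num.sqrt n%:R.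
Proof.
have [N HN] := nat_large (x ^+ 2).
exists N => n /HN xn; rewrite (le_trans (ler_norm _))// -sqrtr_sqr ler_sqrt//.
Qed.

(** One term of the summation by parts. The Markov property turns [Kop g (Y k)] into [g (Y k.+1)];
    passing from [w] to [w'] costs [D * G], and the defect in the Poisson equation costs
    [C e (1 + m)]. *)
Lemma weighted_step (w w' : T -> R) (f g : nat -> R) (C G e D m : R) k : (s0 <= k)%N ->
  adapted k w -> adapted k.+1 w' -> (forall t, `|w t| <= C) -> (forall t, `|w' t| <= C) ->
  (forall x, `|g x| <= G) -> 0 <= e -> mom 1 k <= m ->
  (forall x, `|f x - ell f - (g x - Kop g x)| <= e * (1 + x%:R)) ->
  \int[P]_t `|w' t - w t| <= D ->
  `|\int[P]_t (w t * (f (Y k t) - ell f)) -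
    (\int[P]_t (w t * g (Y k t)) - \int[P]_t (w' t * g (Y k.+1 t)))| <=
    D * G + C * e * (1 + m).
Proof.
move=> sk aw aw' wC w'C gG e0 mm fg wD.
have [C0 G0] : 0 <= C /\ 0 <= G.
  split; [|exact: le_trans (gG 0%N)].
  by rewrite -(Rintegral_prob_cst P C); apply: Rintegral_ge0 => t _; exact: le_trans (wC t).
have aY (h : nat -> R) i : (i <= k.+1)%N -> adapted k.+1 (fun t => h (Y i t)).
  by move=> ik t t' H; rewrite H.
have mw : measurable_fun setT w by exact: measurable_adapted aw.
have mw' : measurable_fun setT w' by exact: measurable_adapted aw'.
have mY h i : (i <= k.+1)%N -> measurable_fun setT (fun t => h (Y i t) : R).
  by move=> ik; exact: measurable_adapted (aY h i ik).
have ibd (v : T -> R) h i : measurable_fun setT v -> (forall t, `|v t| <= C) ->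
    (i <= k.+1)%N -> (forall x, `|h x| <= G) ->
    P.-integrable setT (EFin \o (fun t => v t * h (Y i t))).
  move=> mv vC ik hG; apply: (integrable_bounded P _ (C * G)).
    by apply: measurable_funM => //; exact: mY.
  by move=> t; rewrite normrM ler_pM.
have KG x : `|Kop g x| <= G by exact: Kop_bounded.
have i1 := ibd w g k mw wC (leqnSn k) gG.
have i2 := ibd w g k.+1 mw wC (leqnn _) gG.
have i3 := ibd w' g k.+1 mw' w'C (leqnn _) gG.
have i4 := ibd w (Kop g) k mw wC (leqnSn k) KG.
have Etower : \int[P]_t (w t * g (Y k.+1 t)) = \int[P]_t (w t * Kop g (Y k t)).
  rewrite (tower0 k (fun t m => w t * g m) (C * G) sk); last 2 first.
  - by move=> x t t' H; rewrite (aw t t' H).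
  - move=> t x; rewrite normrM -[leLHS]mulr1 ler_pM// ?mulr_ge0//; first by rewrite ler_pM.
    by rewrite exprn_ege1// lerDl.
  apply: eq_Rintegral => t _; rewrite KopZ//; exact: cubic_bounded gG.
pose r t := f (Y k t) - ell f - (g (Y k t) - Kop g (Y k t)).
have mr : measurable_fun setT r.
  exact: (mY (fun x => f x - ell f - (g x - Kop g x)) k (leqnSn k)).
have ib : P.-integrable setT (EFin \o (fun t => C * e * (1 + (Y k t)%:R))).
  have cp : cubic (fun x => C * e * (1 + x%:R)).
    by apply: cubicZ; apply: cubicD; [exact: cubic_cst|exact: cubic_id].
  exact: (integrable_Y k _ cp).
have rb t : `|w t * r t| <= C * e * (1 + (Y k t)%:R).
  by rewrite -[leRHS]mulrA normrM ler_pM//; exact: fg.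
have ir : P.-integrable setT (EFin \o (fun t => w t * r t)).
  by apply: (le_integrableR P _ _ _ rb ib); exact: measurable_funM.
have idw : P.-integrable setT (EFin \o (fun t => w' t - w t)).
  apply: (integrable_bounded P _ (C + C)); first exact: measurable_funB.
  by move=> t; rewrite (le_trans (ler_normB _ _))// lerD.
have idg : P.-integrable setT (EFin \o (fun t => w' t * g (Y k.+1 t) - w t * g (Y k.+1 t))).
  exact: integrableRB.
have E1 : \int[P]_t (w t * (f (Y k t) - ell f)) =
    \int[P]_t (w t * g (Y k t)) - \int[P]_t (w t * Kop g (Y k t)) + \int[P]_t (w t * r t).
  rewrite -RintegralB// -RintegralD//; last exact: integrableRB.
  by apply: eq_Rintegral => t _; rewrite /r; ring.
rewrite E1 -Etower.
have -> : \int[P]_t (w t * g (Y k t)) - \int[P]_t (w t * g (Y k.+1 t)) + \int[P]_t (w t * r t) -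
   (\int[P]_t (w t * g (Y k t)) - \int[P]_t (w' t * g (Y k.+1 t))) =
   (\int[P]_t (w' t * g (Y k.+1 t)) - \int[P]_t (w t * g (Y k.+1 t))) + \int[P]_t (w t * r t) by ring.
rewrite -RintegralB// (le_trans (ler_normD _ _))// lerD//.
  rewrite (le_trans (le_normr_Rintegral _ idg))//.
  apply: (@le_trans _ _ (\int[P]_t (G * `|w' t - w t|))).
    apply: le_Rintegral => //.
    - exact: (integrable_norm idg).
    - by apply: integrableRZ; exact: (integrable_norm idw).
    - by move=> t _; rewrite -mulrBl normrM mulrC ler_wpM2r.
  rewrite RintegralZl//; last exact: (integrable_norm idw).
  by rewrite mulrC ler_wpM2r.
rewrite (le_trans (le_normr_Rintegral _ ir))//.
apply: (@le_trans _ _ (\int[P]_t (C * e * (1 + (Y k t)%:R)))).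
  by apply: le_Rintegral => //; exact: (integrable_norm ir).
have iY : P.-integrable setT (EFin \o (fun t => (Y k t)%:R : R)) by exact: (integrable_Y k _ cubic_id).
have ic := integrable_cstR P (1 : R).
rewrite (RintegralZl _ _ (integrableRD _ _ _ ic iY))// (RintegralD _ ic iY)// Rintegral_prob_cst.
by rewrite ler_wpM2l ?mulr_ge0// lerD2l.
Qed.

(* Since [f - ell f = g - Kop g] up to [e], summation by parts moves the
   increments onto the slowly varying weights. *)
Lemma weighted_lln (f : nat -> R) (M C e : R) : (forall x, `|f x| <= M) -> 0 <= C -> 0 < e ->
  exists N0, forall n, (N0 <= n)%N -> forall w : nat -> T -> R,
    (forall k, (s0 <= k)%N -> adapted k (w k)) ->
    (forall k t, (s0 <= k <= n)%N -> `|w k t| <= C) ->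
    (forall k, (s0 <= k < n)%N -> \int[P]_t `|w k.+1 t - w k t| <= C / Num.sqrt n%:R) ->
    `|\sum_(s0 <= k < n) \int[P]_t (w k t * (f (Y k t) - ell f))| <= e * n%:R.
Proof.
move=> fM C0 e0.
have [m m0 Hm] := mom1_bounded.
have D0 : 0 < 3 * (C + 1) * (1 + m) by rewrite mulr_gt0 ?ltr_pwDl// mulr_gt0// ltr_wpDl.
have e1 : 0 < e / (3 * (C + 1) * (1 + m)) by rewrite divr_gt0.
have [g [[G gG] fg]] := approx_poisson f M _ fM e1.
have G0 : 0 <= G by exact: le_trans (gG 0%N).
have [N1 HN1] := nat_large (2 * C * G / (e / 3)).
have [N2 HN2] := sqrt_large (C * G / (e / 3)).
(* [N0] depends on the weights only through [C], since in the applications they change with [n]. The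
   three thirds of [e] pay for the boundary terms, the increments of the weights and the
   approximation error. *)
exists (maxn (maxn s0 1) (maxn N1 N2)) => n.
rewrite (geq_max n (maxn s0 1) (maxn N1 N2)) (geq_max n s0 1) (geq_max n N1 N2).
move=> /andP[/andP[sn n1] /andP[/HN1 n1' /HN2 n2']] w aw wC wD.
have e3' : 0 < e / 3 by rewrite divr_gt0.
have sq0 : 0 < Num.sqrt n%:R :> R by rewrite sqrtr_gt0 ltr0n.
pose u k := \int[P]_t (w k t * g (Y k t)).
pose a k := \int[P]_t (w k t * (f (Y k t) - ell f)).
have ub k : (s0 <= k <= n)%N -> `|u k| <= C * G.
  move=> kn; apply: norm_Rintegral_le.
    apply: measurable_funM; first by apply: measurable_adapted (aw k _); case/andP: kn.
    exact: measurable_fun_nat (discreteY k).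
  by move=> t; rewrite normrM ler_pM// wC.
have step k : (s0 <= k < n)%N -> `|a k - (u k - u k.+1)| <=
    C / Num.sqrt n%:R * G + C * (e / (3 * (C + 1) * (1 + m))) * (1 + m).
  move=> /andP[sk kn]; apply: weighted_step => //.
  - exact: aw.
  - by apply: aw; exact: leqW.
  - by move=> t; rewrite wC// sk ltnW.
  - by move=> t; rewrite wC// leqW.
  - exact: ltW.
  - by rewrite wD// sk.
rewrite (_ : \sum_(_ <= _ < _) _ = \sum_(s0 <= k < n) (a k - (u k - u k.+1)) + (u s0 - u n)); last first.
  have -> : u s0 - u n = \sum_(s0 <= k < n) (u k - u k.+1).
    rewrite -(opprB (u n)) -(telescope_sumr u sn) -sumrN.
    by apply: eq_bigr => k _; rewrite opprB.
  by rewrite -big_split/=; apply: eq_bigr => k _; rewrite subrK.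
rewrite (le_trans (ler_normD _ _))//.
have B1 : `|u s0 - u n| <= e / 3 * n%:R.
  rewrite (le_trans (ler_normB _ _))//.
  have := ub s0; have := ub n; rewrite !leqnn sn => /(_ isT) h1 /(_ isT) h2.
  by move: n1'; rewrite ler_pdivrMr// mulrC; lra.
have B2 : `|\sum_(s0 <= k < n) (a k - (u k - u k.+1))| <= n%:R * (e / 3 + e / 3).
  rewrite (le_trans (ler_norm_sum _ _ _))//.
  apply: (@le_trans _ _ (\sum_(s0 <= k < n) (e / 3 + e / 3))).
    rewrite big_seq [leRHS]big_seq; apply: ler_sum => k; rewrite mem_index_iota => kn.
    rewrite (le_trans (step k kn))// lerD//.
      by rewrite mulrAC ler_pdivrMr// [leRHS]mulrC -ler_pdivrMr.
    have -> : C * (e / (3 * (C + 1) * (1 + m))) * (1 + m) = e / 3 * (C / (C + 1)).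
      by field; do ?[apply/andP; split]; apply/eqP => h; lra.
    by rewrite ler_piMr ?(ltW e3')// ler_pdivrMr ?mul1r ?lerDl// ltr_wpDl.
  rewrite big_const_nat iter_addr_0 -[leLHS]mulr_natl ler_wpM2r ?addr_ge0 ?(ltW e3')//.
  by rewrite ler_nat leq_subr.
by move: B1 B2; lra.
Qed.

Lemma cubic_le_cube f (A : R) : (forall x, 0 <= f x <= A * x%:R ^+ 3) -> cubic f.
Proof.
move=> fA; have [D HD] := cubicZ A _ (cubicX 3 isT); exists D => x.
have /andP[h1 h2] := fA x.
by rewrite ger0_norm// (le_trans h2)// (le_trans (ler_norm _)).
Qed.

Lemma trunc_le c f x : (forall y, 0 <= f y) -> 0 <= f x - trunc c f x.
Proof. by move=> f0; rewrite subr_ge0 /trunc; case: ifP. Qed.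

(** Domination by [A x^3] transfers the uniform integrability of [Y k ^ 3] to [f]. *)
Lemma trunc_approx (f : nat -> R) (A l e : R) :
  (forall x, 0 <= f x <= A * x%:R ^+ 3) -> (fun k => \int[P]_t f (Y k t)) @ \oo --> l ->
  0 < e -> exists c k0, (forall k, (k0 <= k)%N ->
    \int[P]_t (f (Y k t) - trunc c f (Y k t)) <= e) /\ `|l - ell (trunc c f)| <= e.
Proof.
move=> fA fl e0.
have A0 : 0 <= A by have /andP[h1 h2] := fA 1%N; move: (le_trans h1 h2); rewrite expr1n mulr1.
have e1 : 0 < e / (A + 1) by rewrite divr_gt0// ltr_wpDl.
have [c [k0 Hc]] := tail_cube _ e1.
have f0 x : 0 <= f x by case/andP: (fA x).
have cf := cubic_le_cube f A fA.
have [M HM] := trunc_bounded c f.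
have [M' HM'] := trunc_bounded c (fun x => x%:R ^+ 3).
have if1 k := integrable_Y k f cf.
have if2 k := integrable_Y k _ (cubic_bounded _ _ HM).
have ig1 k := integrable_Y k _ (cubicX 3 isT).
have ig2 k := integrable_Y k _ (cubic_bounded _ _ HM').
have tail k : (k0 <= k)%N -> \int[P]_t (f (Y k t) - trunc c f (Y k t)) <= e.
  move=> kk; apply: (@le_trans _ _ (\int[P]_t (A * ((Y k t)%:R ^+ 3 - trunc c (fun x => x%:R ^+ 3) (Y k t))))).
    apply: le_Rintegral => //.
    - exact: (integrableRB _ _ _ (if1 k) (if2 k)).
    - exact: (integrableRZ _ _ _ (integrableRB _ _ _ (ig1 k) (ig2 k))).
    - move=> t _; rewrite /trunc; case: ifP => _; first by rewrite !subrr mulr0.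
      by rewrite !subr0; case/andP: (fA (Y k t)).
  rewrite (RintegralZl _ _ (integrableRB _ _ _ (ig1 k) (ig2 k)))//.
  rewrite (le_trans (ler_wpM2l A0 (Hc k kk)))// mulrCA ler_piMr ?(ltW e0)//.
  by rewrite ler_pdivrMr ?mul1r ?lerDl// ltr_wpDl.
exists c, k0; split => //.
have dcv : (fun k => \int[P]_t (f (Y k t) - trunc c f (Y k t))) @ \oo --> l - ell (trunc c f).
  rewrite (_ : (fun k => _) = fun k => \int[P]_t f (Y k t) - \int[P]_t trunc c f (Y k t)).
    by apply: (@cvgB _ R^o) => //; exact: cvg_law _ _ HM.
  by apply/funext => k; rewrite RintegralB.
rewrite ger0_norm.
  apply: (ler_cvg_to dcv (cvg_cst e)); exists k0 => // k; exact: tail.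
apply: (ler_cvg_to (cvg_cst 0) dcv); apply: nearW => k.
apply: Rintegral_ge0 => t _; exact: trunc_le.
Qed.

Lemma integral_Y_bounded (f : nat -> R) (l : R) : (fun k => \int[P]_t f (Y k t)) @ \oo --> l ->
  exists2 B : R, 0 <= B & forall k, \int[P]_t f (Y k t) <= B.
Proof.
move=> fl.
have /cvg_seq_bounded[C [_ HC]] : cvgn (fun k => \int[P]_t f (Y k t)) by apply/cvg_ex; exists l.
have H k : `|\int[P]_t f (Y k t)| <= C + 1 by apply: (HC (C + 1)) => //; rewrite ltrDl.
by exists (C + 1) => [|k]; [exact: le_trans (H 0%N)|exact: le_trans (ler_norm _) (H k)].
Qed.

(** The tail bound holds only from some time [k0] on; the earlier terms are at most [B] each and
    disappear in [e n / 2] for large [n]. *)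
Lemma tail_sum (f : nat -> R) (A l e : R) :
  (forall x, 0 <= f x <= A * x%:R ^+ 3) -> (fun k => \int[P]_t f (Y k t)) @ \oo --> l ->
  0 < e -> exists c N0, [/\ forall n, (N0 <= n)%N ->
    \sum_(s0 <= k < n) \int[P]_t (f (Y k t) - trunc c f (Y k t)) <= e * n%:R &
    `|l - ell (trunc c f)| <= e].
Proof.
move=> fA fl e0; have e20 : 0 < e / 2 by rewrite divr_gt0.
have [c [k0 [Hc le]]] := trunc_approx f A l _ fA fl e20.
have [B B0 HB] := integral_Y_bounded f l fl.
have [N HN] := nat_large (k0%:R * B / (e / 2)).
have f0 x : 0 <= f x by case/andP: (fA x).
have cf := cubic_le_cube f A fA.
have [M HM] := trunc_bounded c f.
pose a k := \int[P]_t (f (Y k t) - trunc c f (Y k t)).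
have aB k : a k <= B.
  apply: le_trans (HB k); apply: le_Rintegral => //.
  - exact: (integrableRB _ _ _ (integrable_Y k f cf) (integrable_Y k _ (cubic_bounded _ _ HM))).
  - exact: (integrable_Y k f cf).
  - by move=> t _; rewrite gerBl /trunc; case: ifP => // _; exact: f0.
have a0 k : 0 <= a k.
  apply: Rintegral_ge0 => t _; exact: trunc_le.
exists c, N; split; last by rewrite (le_trans le)// ler_pdivrMr// ler_peMr ?(ltW e0)// ler1n.
move=> n /HN; rewrite ler_pdivrMr// => nB.
apply: (@le_trans _ _ (\sum_(0 <= k < n) ((if (k < k0)%N then B else 0) + e / 2))).
  apply: (@le_trans _ _ (\sum_(0 <= k < n) a k)).
    have [sn|ns] := leqP s0 n; last by rewrite big_geq ?sumr_ge0// ltnW.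
    by rewrite [leRHS](big_cat_nat _ (n := s0))//= lerDr sumr_ge0.
  apply: ler_sum => k _; case: ltnP => kk; first by rewrite (le_trans (aB k))// lerDl ltW.
  by rewrite add0r Hc.
rewrite big_split/= big_const_nat iter_addr_0 subn0 -[e / 2 *+ n]mulr_natl.
have : \sum_(0 <= k < n) (if (k < k0)%N then B else 0) <= k0%:R * B.
  rewrite -big_mkcond/=.
  have [nk|kn] := leqP n k0.
    apply: (@le_trans _ _ (\sum_(0 <= k < n) B)).
      by rewrite big_mkcond/=; apply: ler_sum => k _; case: ifP.
    by rewrite big_const_nat iter_addr_0 subn0 -[leLHS]mulr_natl ler_wpM2r ?ler_nat.
  rewrite (big_cat_nat _ (n := k0))/= ?(ltnW kn)//.
  rewrite [X in _ + X <= _]big1_seq ?addr0; last first.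
    by move=> k; rewrite mem_index_iota => /andP[h /andP[h' _]]; rewrite ltnNge h' in h.
  apply: (@le_trans _ _ (\sum_(0 <= k < k0) B)).
    by rewrite big_mkcond/=; apply: ler_sum => k _; case: ifP.
  by rewrite big_const_nat iter_addr_0 subn0 mulr_natl.
by move: nB; lra.
Qed.

(** Reduction to the bounded case: the tails cost [C] times their summed means, and recentring costs
    the distance from [l] to [ell (trunc c f)]. *)
Lemma weighted_lln_cubic (f : nat -> R) (A l C e : R) :
  (forall x, 0 <= f x <= A * x%:R ^+ 3) -> (fun k => \int[P]_t f (Y k t)) @ \oo --> l ->
  0 <= C -> 0 < e ->
  exists N0, forall n, (N0 <= n)%N -> forall w : nat -> T -> R,
    (forall k, (s0 <= k)%N -> adapted k (w k)) ->
    (forall k t, (s0 <= k <= n)%N -> `|w k t| <= C) ->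
    (forall k, (s0 <= k < n)%N -> \int[P]_t `|w k.+1 t - w k t| <= C / Num.sqrt n%:R) ->
    `|\sum_(s0 <= k < n) \int[P]_t (w k t * (f (Y k t) - l))| <= e * n%:R.
Proof.
move=> fA fl C0 e0.
have C10 : 0 < C + 1 by rewrite ltr_wpDl.
have e1 : 0 < e / (3 * (C + 1)) by rewrite divr_gt0// mulr_gt0.
have e3' : 0 < e / 3 by rewrite divr_gt0.
have [c [N1 [Htail le]]] := tail_sum f A l _ fA fl e1.
have [M HM] := trunc_bounded c f.
have [N2 Hlln] := weighted_lln (trunc c f) M C _ HM C0 e3'.
exists (maxn N1 N2) => n; rewrite geq_max => /andP[n1 n2] w aw wC wD.
have f0 x : 0 <= f x by case/andP: (fA x).
have cf := cubic_le_cube f A fA.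
have if1 k := integrable_Y k f cf.
have if2 k := integrable_Y k _ (cubic_bounded _ _ HM).
have id k := integrableRB _ _ _ (if1 k) (if2 k).
pose tf k t := trunc c f (Y k t) - ell (trunc c f).
have step k : (s0 <= k < n)%N -> `|\int[P]_t (w k t * (f (Y k t) - l)) - \int[P]_t (w k t * tf k t)| <=
    C * \int[P]_t (f (Y k t) - trunc c f (Y k t)) + C * (e / (3 * (C + 1))).
  move=> /andP[sk kn].
  have mw : measurable_fun setT (w k) by apply: measurable_adapted (aw k sk).
  have wCk t : `|w k t| <= C by rewrite wC// sk ltnW.
  have ic r := integrable_cstR P r.
  have iw (X : T -> R) : measurable_fun setT X -> P.-integrable setT (EFin \o X) ->
      P.-integrable setT (EFin \o (fun t => w k t * X t)).
    move=> mX iX; apply: (le_integrableR P _ (fun t => C * `|X t|)).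
    - exact: measurable_funM.
    - by move=> t; rewrite normrM ler_wpM2r.
    - by apply: integrableRZ; exact: (integrable_norm iX).
  have mY (h : nat -> R) : measurable_fun setT (fun t => h (Y k t)).
    exact: measurable_fun_nat (discreteY k).
  have i1 := iw _ (mY (fun x => f x - l)) (integrableRB _ _ _ (if1 k) (ic l)).
  have i2 := iw _ (mY (fun x => trunc c f x - ell (trunc c f))) (integrableRB _ _ _ (if2 k) (ic _)).
  rewrite -RintegralB//.
  have i12 := integrableRB _ _ _ i1 i2.
  rewrite (le_trans (le_normr_Rintegral _ i12))//.
  rewrite -[C * (e / _)](Rintegral_prob_cst P) -(RintegralZl C _ (id k))//.
  rewrite -RintegralD//; last exact: integrableRZ.
  apply: le_Rintegral => //.
  - exact: (integrable_norm i12).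
  - by apply: integrableRD => //; exact: integrableRZ.
  move=> t _; rewrite /tf -mulrBr normrM -mulrDr ler_pM//.
  have -> : f (Y k t) - l - (trunc c f (Y k t) - ell (trunc c f)) =
     (f (Y k t) - trunc c f (Y k t)) - (l - ell (trunc c f)) by ring.
  rewrite (le_trans (ler_normB _ _))// lerD// ger0_norm//.
  exact: trunc_le.
rewrite (_ : \sum_(_ <= _ < _) _ = \sum_(s0 <= k < n) (\int[P]_t (w k t * (f (Y k t) - l)) - \int[P]_t (w k t * tf k t)) + \sum_(s0 <= k < n) \int[P]_t (w k t * tf k t)); last first.
  by rewrite -big_split/=; apply: eq_bigr => k _; rewrite subrK.
rewrite (le_trans (ler_normD _ _))//.
have B1 : `|\sum_(s0 <= k < n) \int[P]_t (w k t * tf k t)| <= e / 3 * n%:R by exact: Hlln.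
have E3 : C * (e / (3 * (C + 1))) <= e / 3.
  have -> : C * (e / (3 * (C + 1))) = e / 3 * (C / (C + 1)).
    by field; apply/eqP => h; lra.
  by rewrite ler_piMr ?(ltW e3')// ler_pdivrMr ?mul1r ?lerDl.
have B2 : `|\sum_(s0 <= k < n) (\int[P]_t (w k t * (f (Y k t) - l)) - \int[P]_t (w k t * tf k t))| <= e / 3 * n%:R + e / 3 * n%:R.
  rewrite (le_trans (ler_norm_sum _ _ _))//.
  apply: (@le_trans _ _ (\sum_(s0 <= k < n) (C * \int[P]_t (f (Y k t) - trunc c f (Y k t)) + e / 3))).
    rewrite big_seq [leRHS]big_seq; apply: ler_sum => k; rewrite mem_index_iota => kn.
    by rewrite (le_trans (step k kn))// lerD2l.
  rewrite big_split/= -mulr_sumr lerD//.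
    rewrite (le_trans (ler_wpM2l C0 (Htail n n1)))// mulrA ler_wpM2r//.
  rewrite big_const_nat iter_addr_0 -[leLHS]mulr_natr ler_wpM2l ?(ltW e3')//.
  by rewrite ler_nat leq_subr.
by move: B1 B2; lra.
Qed.

Lemma Rintegral_sum (r : seq nat) (X : nat -> T -> R) :
  (forall k, P.-integrable setT (EFin \o X k)) ->
  P.-integrable setT (EFin \o (fun t => \sum_(k <- r) X k t)) /\
  \int[P]_t (\sum_(k <- r) X k t) = \sum_(k <- r) \int[P]_t X k t.
Proof.
move=> iX; elim: r => [|k r [iS ES]].
  rewrite big_nil (_ : (fun t => _) = cst 0); last by apply/funext => t; rewrite big_nil.
  split; last by exact: (Rintegral_prob_cst P 0).
  exact: (integrable_cstR P 0).
rewrite big_cons (_ : (fun t => _) = fun t => X k t + \sum_(k <- r) X k t); last first.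
  by apply/funext => t; rewrite big_cons.
by split; [exact: integrableRD|rewrite RintegralD// ES].
Qed.

(** A second moment argument. Squaring the partial sum [A] of the centred terms [a] produces cross
    terms [2 A k a k], and these are covered by [weighted_lln] with [A k / n] itself as the weight,
    which moves by at most [B / n] per step. *)
Lemma lln_bounded (f : nat -> R) (M dl : R) : (forall x, `|f x| <= M) -> 0 < dl ->
  exists N0, forall n, (N0 <= n)%N ->
    \int[P]_t `|\sum_(s0 <= k < n) (f (Y k t) - ell f)| <= dl * n%:R.
Proof.
move=> fM d0.
pose B := M + `|ell f|.
have M0 : 0 <= M by exact: le_trans (fM 0%N).
have B0 : 0 <= B by rewrite addr_ge0.
pose a k t := f (Y k t) - ell f.
have aB k t : `|a k t| <= B by rewrite (le_trans (ler_normB _ _))// lerD2r.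
(* Together with [N2], this makes cross terms and squares contribute [dl n / 4] each, beside the
   [dl n / 2] of the final AM-GM inequality. *)
have e1 : 0 < dl ^+ 2 / 4 by rewrite divr_gt0// exprn_gt0.
have [N1 HN1] := weighted_lln f M B _ fM B0 e1.
have [N2 HN2] := nat_large (2 * B ^+ 2 / dl ^+ 2).
exists (maxn (maxn s0 1) (maxn N1 N2)) => n.
rewrite (geq_max n (maxn s0 1) (maxn N1 N2)) (geq_max n s0 1) (geq_max n N1 N2).
move=> /andP[/andP[sn n0] /andP[n1 /HN2 n2]].
have n0' : 0 < n%:R :> R by rewrite ltr0n.
pose A k t := \sum_(s0 <= j < k) a j t.
have aA k : (s0 <= k)%N -> adapted k (A k).
  move=> sk t t' H; apply: eq_big_nat => j /andP[_ jk].
  by rewrite /a H// ltnW.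
have AB k t : (s0 <= k <= n)%N -> `|A k t| <= n%:R * B.
  move=> /andP[sk kn]; rewrite (le_trans (ler_norm_sum _ _ _))//.
  apply: (@le_trans _ _ (\sum_(s0 <= j < k) B)); first exact: ler_sum.
  rewrite big_const_nat iter_addr_0 -[leLHS]mulr_natl ler_wpM2r// ler_nat.
  exact: leq_trans (leq_subr _ _) kn.
have AS k t : (s0 <= k)%N -> A k.+1 t = A k t + a k t.
  by move=> sk; rewrite /A big_nat_recr.
have ma k : measurable_fun setT (a k) by exact: (measurable_fun_nat _ (fun x => f x - ell f) (discreteY k)).
have mA k : (s0 <= k)%N -> measurable_fun setT (A k) by move=> sk; exact: measurable_adapted (aA k sk).
pose w k t := n%:R^-1 * A k t.
have Hw := HN1 n n1 w.
have sqn : n%:R^-1 <= (Num.sqrt n%:R)^-1 :> R.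
  rewrite lef_pV2 ?posrE ?sqrtr_gt0//.
  rewrite -[leLHS]mul1r -[leRHS](sqr_sqrtr (ltW n0')) expr2 ler_wpM2r ?sqrtr_ge0//.
  by rewrite -[leLHS]sqrtr1 ler_sqrt ?ler1n.
have {}Hw : `|\sum_(s0 <= k < n) \int[P]_t (w k t * a k t)| <= dl ^+ 2 / 4 * n%:R.
  apply: Hw.
  - by move=> k sk t t' H; rewrite /w (aA k sk t t' H).
  - move=> k t kn; rewrite /w normrM gtr0_norm ?invr_gt0// ler_pdivrMl//.
    exact: AB.
  - move=> k /andP[sk kn]; rewrite (_ : (fun t => _) = fun t => `|n%:R^-1 * a k t|); last first.
      by apply/funext => t; rewrite /w AS//; congr `|_|; ring.
    apply: (le_trans (ler_norm _)); apply: norm_Rintegral_le.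
      by apply: measurableT_comp => //; exact: measurable_funM.
    by move=> t; rewrite normr_id normrM gtr0_norm ?invr_gt0// mulrC ler_pM// invr_ge0 ltW.
have iA2 k : (s0 <= k <= n)%N -> P.-integrable setT (EFin \o (fun t => A k t ^+ 2)).
  move=> kn; apply: (integrable_bounded P _ ((n%:R * B) ^+ 2)).
    by apply: measurable_funX; apply: mA; case/andP: kn.
  by move=> t; rewrite normrX lerXn2r ?nnegrE ?mulr_ge0// AB.
have iwa k : (s0 <= k <= n)%N -> P.-integrable setT (EFin \o (fun t => w k t * a k t)).
  move=> kn; apply: (integrable_bounded P _ (B * B)).
    by apply: measurable_funM => //; apply: measurable_funM => //; apply: mA; case/andP: kn.
  move=> t; rewrite normrM ler_pM//.
  by rewrite /w normrM gtr0_norm ?invr_gt0// ler_pdivrMl// AB.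
have ia2 k : P.-integrable setT (EFin \o (fun t => a k t ^+ 2)).
  apply: (integrable_bounded P _ (B ^+ 2)); first exact: measurable_funX.
  by move=> t; rewrite normrX lerXn2r ?nnegrE.
have EA : \int[P]_t (A n t ^+ 2) = \sum_(s0 <= k < n) (2 * n%:R * \int[P]_t (w k t * a k t) + \int[P]_t (a k t ^+ 2)).
  rewrite (_ : \int[P]_t (A n t ^+ 2) = \int[P]_t (A n t ^+ 2) - \int[P]_t (A s0 t ^+ 2)); last first.
    rewrite (_ : (fun t => A s0 t ^+ 2) = fun=> 0); first by rewrite Rintegral_prob_cst subr0.
    by apply/funext => t; rewrite /A big_geq// expr0n.
  rewrite -(telescope_sumr (fun k => \int[P]_t (A k t ^+ 2)) sn).
  apply: eq_big_nat => k /andP[sk kn].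
  have kn' : (s0 <= k <= n)%N by rewrite sk ltnW.
  have kn'' : (s0 <= k.+1 <= n)%N by rewrite (leq_trans sk).
  rewrite -RintegralB//; [|exact: iA2..].
  rewrite -(RintegralZl (2 * n%:R) _ (iwa k kn'))//.
  rewrite -(RintegralD _ (integrableRZ _ _ _ (iwa k kn')) (ia2 k))//.
  apply: eq_Rintegral => t _; rewrite AS// /w; field; rewrite gt_eqF//.
have EAn : \int[P]_t (A n t ^+ 2) <= 2 * n%:R * (dl ^+ 2 / 4 * n%:R) + n%:R * B ^+ 2.
  rewrite EA big_split/= -mulr_sumr lerD//.
    by rewrite ler_wpM2l ?mulr_ge0// (le_trans (ler_norm _)).
  apply: (@le_trans _ _ (\sum_(s0 <= k < n) B ^+ 2)).
    apply: ler_sum => k _; apply: (le_trans (ler_norm _)); apply: norm_Rintegral_le.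
      exact: measurable_funX.
    by move=> t; rewrite normrX lerXn2r ?nnegrE.
  by rewrite big_const_nat iter_addr_0 -[leLHS]mulr_natl ler_wpM2r ?exprn_ge0// ler_nat leq_subr.
have sn' : (s0 <= n <= n)%N by rewrite sn leqnn.
have iz := integrable_cstR P (dl * n%:R / 2).
apply: (@le_trans _ _ (\int[P]_t (dl * n%:R / 2 + (2 * dl * n%:R)^-1 * A n t ^+ 2))).
  apply: le_Rintegral => //.
  - apply: (integrable_bounded P _ (n%:R * B)).
      by apply: measurableT_comp => //; exact: mA.
    by move=> t; rewrite normr_id; exact: AB.
  - by apply: integrableRD => //; apply: integrableRZ; exact: iA2.
  (* AM-GM: [|x| <= d n / 2 + x^2 / (2 d n)] *)
  move=> t _; rewrite -/(A n t) -[A n t ^+ 2]real_normK ?num_real//.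
  move: `|A n t| (normr_ge0 (A n t)) => x x0.
  rewrite -subr_ge0.
  have -> : dl * n%:R / 2 + (2 * dl * n%:R)^-1 * x ^+ 2 - x = (2 * dl * n%:R)^-1 * (dl * n%:R - x) ^+ 2.
    by field; rewrite !gt_eqF.
  by rewrite mulr_ge0 ?sqr_ge0// invr_ge0 !mulr_ge0// ltW.
rewrite (RintegralD _ iz (integrableRZ _ _ _ (iA2 n sn')))// (RintegralZl _ _ (iA2 n sn'))//.
rewrite Rintegral_prob_cst.
have : (2 * dl * n%:R)^-1 * \int[P]_t (A n t ^+ 2) <= (2 * dl * n%:R)^-1 * (2 * n%:R * (dl ^+ 2 / 4 * n%:R) + n%:R * B ^+ 2).
  by rewrite ler_wpM2l// invr_ge0 !mulr_ge0// ltW.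
have -> : (2 * dl * n%:R)^-1 * (2 * n%:R * (dl ^+ 2 / 4 * n%:R) + n%:R * B ^+ 2) =
    dl * n%:R / 4 + dl / 4 * (2 * B ^+ 2 / dl ^+ 2).
  by field; rewrite !gt_eqF.
have : dl / 4 * (2 * B ^+ 2 / dl ^+ 2) <= dl / 4 * n%:R by rewrite ler_wpM2l// divr_ge0// ltW.
by move: (\int[P]_t (A n t ^+ 2)) => J; lra.
Qed.

Lemma sqr_le_cube (x : nat) : 0 <= (x%:R ^+ 2 : R) <= 1 * x%:R ^+ 3.
Proof.
rewrite exprn_ge0//= mul1r; case: x => [|x]; first by rewrite !expr0n.
by apply: ler_weXn2l => //; rewrite ler1n.
Qed.

Lemma lln_sqr (e : R) : 0 < e -> exists N0, forall n, (N0 <= n)%N ->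
  \int[P]_t `|\sum_(s0 <= k < n) ((Y k t)%:R ^+ 2 - m2)| <= e * n%:R.
Proof.
move=> e0; have e3' : 0 < e / 3 by rewrite divr_gt0.
pose f (x : nat) : R := x%:R ^+ 2.
have f0 x : 0 <= f x by exact: exprn_ge0.
have [c [N1 [Htail le]]] := tail_sum f 1 m2 _ sqr_le_cube cvg_mom2 e3'.
have [M HM] := trunc_bounded c f.
have [N2 HN2] := lln_bounded (trunc c f) M _ HM e3'.
exists (maxn N1 N2) => n; rewrite geq_max => /andP[n1 n2].
have if1 k := integrable_Y k f (cubicX 2 isT).
have if2 k := integrable_Y k _ (cubic_bounded _ _ HM).
have id k := integrableRB _ _ _ (if1 k) (if2 k).
pose A t := \sum_(s0 <= k < n) (trunc c f (Y k t) - ell (trunc c f)).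
have ic r := integrable_cstR P r.
have [i1 E1] := Rintegral_sum (index_iota s0 n) _ id.
have [i2 _] := Rintegral_sum (index_iota s0 n) (fun k t => trunc c f (Y k t) - ell (trunc c f))
  (fun k => integrableRB _ _ _ (if2 k) (ic _)).
have [i3 _] := Rintegral_sum (index_iota s0 n) (fun k t => (Y k t)%:R ^+ 2 - m2)
  (fun k => integrableRB _ _ _ (if1 k) (ic _)).
apply: (@le_trans _ _ (\int[P]_t (\sum_(s0 <= k < n) (f (Y k t) - trunc c f (Y k t)) + `|A t| + n%:R * (e / 3)))).
  apply: le_Rintegral => //.
  - exact: (integrable_norm i3).
  - by apply: integrableRD => //; apply: integrableRD => //; exact: (integrable_norm i2).
  move=> t _.
  have -> : \sum_(s0 <= k < n) ((Y k t)%:R ^+ 2 - m2) =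
     \sum_(s0 <= k < n) (f (Y k t) - trunc c f (Y k t)) + A t - \sum_(s0 <= k < n) (m2 - ell (trunc c f)).
    by rewrite /A -big_split -sumrB /=; apply: eq_bigr => k _; rewrite /f; ring.
  rewrite (le_trans (ler_normB _ _))// lerD//.
    rewrite (le_trans (ler_normD _ _))// lerD2r ger0_norm// sumr_ge0// => k _.
    exact: trunc_le.
  rewrite big_const_nat iter_addr_0 -[X in `|X|]mulr_natl normrM ger0_norm// ler_pM//.
  by rewrite ler_nat leq_subr.
rewrite (RintegralD _ (integrableRD _ _ _ i1 (integrable_norm i2)) (ic _))//.
rewrite (RintegralD _ i1 (integrable_norm i2))// E1 Rintegral_prob_cst.
have h1 := HN2 n n2; have h2 := Htail n n1.
rewrite (_ : e * n%:R = e / 3 * n%:R + e / 3 * n%:R + n%:R * (e / 3)); last by field.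
by rewrite lerD2r lerD.
Qed.

(** * The martingale limit theorem *)

(** The innovation of a step from [y] to [m], weighted by the regressor [y]. *)
Definition dev (y m : nat) : R := (m%:R - alpha * y%:R - mu) * y%:R.

Definition inc k t : R := dev (Y k t) (Y k.+1 t).

Definition mart n t : R := \sum_(s0 <= k < n) inc k t.

(* Conditional variance of [inc k] given [Y k = y]. *)
Definition cvar (y : nat) : R := alpha * (1 - alpha) * y%:R ^+ 3 + sig2e * y%:R ^+ 2.

Definition cvar_lim : R := alpha * (1 - alpha) * m3 + sig2e * m2.

Lemma adapted_inc k : adapted k.+1 (inc k).
Proof. by move=> t t' H; rewrite /inc !H. Qed.

Lemma adapted_mart n : adapted n (mart n).
Proof.
move=> t t' H; apply: eq_big_nat => k /andP[_ kn]; apply: adapted_inc => i ik.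
by apply: H; exact: leq_trans kn.
Qed.

Lemma measurable_mart n : measurable_fun setT (mart n).
Proof. exact: measurable_adapted (adapted_mart n). Qed.

Lemma martS k t : (s0 <= k)%N -> mart k.+1 t = mart k t + inc k t.
Proof. by move=> sk; rewrite /mart big_nat_recr. Qed.

Lemma cvar_bound x : 0 <= cvar x <= (alpha * (1 - alpha) + sig2e) * x%:R ^+ 3.
Proof.
have [a0 a1 _] := alpha_nat_ge0; have s0' := sig2e_ge0.
rewrite /cvar addr_ge0 ?mulr_ge0 ?exprn_ge0//= mulrDl lerD2l ler_wpM2l//.
by have /andP[_] := sqr_le_cube x; rewrite mul1r.
Qed.

Lemma cubic_cvar : cubic cvar.
Proof. by apply: cubicD; apply: cubicZ; exact: cubicX. Qed.

Lemma cvg_cvar : (fun k => \int[P]_t cvar (Y k t)) @ \oo --> cvar_lim.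
Proof.
rewrite (_ : (fun k => _) = fun k => alpha * (1 - alpha) * mom 3 k + sig2e * mom 2 k); last first.
  apply/funext => k; rewrite /cvar.
  by have := integral_Y_poly k (alpha * (1 - alpha)) sig2e 0 0; rewrite mul0r !addr0 => <-;
    apply: eq_Rintegral => t _; rewrite mul0r !addr0.
by apply: (@cvgD _ R^o); apply: (@cvgM _ _ _ _ (cst _)); [exact: cvg_cst|exact: cvg_mom3|exact: cvg_cst|exact: cvg_mom2].
Qed.

Lemma cvar_lim_ge0 : 0 <= cvar_lim.
Proof.
apply: (ler_cvg_to (cvg_cst 0) cvg_cvar); apply: nearW => k.
by apply: Rintegral_ge0 => t _; case/andP: (cvar_bound (Y k t)).
Qed.

Lemma cubic_dev y : cubic (dev y).
Proof.
rewrite (_ : dev y = fun m : nat => 0 * m%:R ^+ 2 + y%:R * m%:R + - (alpha * y%:R + mu) * y%:R).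
  exact: cubic_linear.
by apply/funext => m; rewrite /dev; ring.
Qed.

Lemma cubic_dev_sqr y : cubic (fun m => dev y m ^+ 2).
Proof.
rewrite (_ : (fun m => _) = fun m : nat => y%:R ^+ 2 * m%:R ^+ 2 +
    (- 2 * (alpha * y%:R + mu) * y%:R ^+ 2) * m%:R + (alpha * y%:R + mu) ^+ 2 * y%:R ^+ 2).
  exact: cubic_linear.
by apply/funext => m; rewrite /dev; ring.
Qed.

Lemma Kop_dev y : Kop (dev y) y = 0.
Proof.
rewrite (_ : dev y = fun m : nat => y%:R * (m%:R - alpha * y%:R - mu)); last first.
  by apply/funext => m; rewrite /dev mulrC.
rewrite KopZ ?Kop_mart ?mulr0//.
rewrite (_ : (fun m => _) = fun m : nat => 0 * m%:R ^+ 2 + 1 * m%:R + - (alpha * y%:R + mu)).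
  exact: cubic_linear.
by apply/funext => m; ring.
Qed.

Lemma Kop_dev_sqr y : Kop (fun m => dev y m ^+ 2) y = cvar y.
Proof.
rewrite (_ : (fun m => _) = fun m : nat => y%:R ^+ 2 * (m%:R - alpha * y%:R - mu) ^+ 2); last first.
  by apply/funext => m; rewrite /dev; ring.
rewrite KopZ ?Kop_mart_sqr /cvar; first by ring.
rewrite (_ : (fun m => _) = fun m : nat => 1 * m%:R ^+ 2 +
    (- 2 * (alpha * y%:R + mu)) * m%:R + (alpha * y%:R + mu) ^+ 2).
  exact: cubic_linear.
by apply/funext => m; ring.
Qed.

(** In general not integrable along the chain, so it enters only truncated, where it is bounded. *)
Definition cub_inc (y : nat) : R := Kop (fun m => `|dev y m| ^+ 3) y.

(** The linear Taylor term vanishes by [Kop_dev] and the quadratic one gives [cvar]. The remainder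
    is chosen by state, as in Lindeberg's argument: cubic for [y < c], quadratic otherwise. *)
Lemma Kop_cos (A r : R) c (y : nat) :
  `|Kop (fun m => cos (A + r * dev y m)) y -
    cos A * (1 - r ^+ 2 / 2 * cvar y)| <=
  `|r| ^+ 3 * trunc c cub_inc y + 2 * r ^+ 2 * (cvar y - trunc c cvar y).
Proof.
pose D := dev y.
pose g m := cos A - r * D m * sin A - (r * D m) ^+ 2 / 2 * cos A.
have cf : cubic (fun m => cos (A + r * D m)).
  by apply: (cubic_bounded _ 1) => m; rewrite ler_norml cos_geN1 cos_le1.
have cD : cubic D by exact: cubic_dev.
have cD2 : cubic (fun m => D m ^+ 2) by exact: cubic_dev_sqr.
have gE : g = fun m => cos A + ((- r * sin A) * D m + (- (r ^+ 2 / 2) * cos A) * D m ^+ 2).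
  by apply/funext => m; rewrite /g; field.
have cg : cubic g.
  by rewrite gE; apply: cubicD; [exact: cubic_cst|apply: cubicD; exact: cubicZ].
have Kg : Kop g y = cos A * (1 - r ^+ 2 / 2 * cvar y).
  rewrite gE KopD ?Kop_cst; [|exact: cubic_cst|by apply: cubicD; exact: cubicZ].
  rewrite KopD ?KopZ ?Kop_dev ?Kop_dev_sqr//; [|exact: cubicZ..].
  by field.
have cfg : cubic (fun m => cos (A + r * D m) - g m).
  rewrite (_ : (fun m => _) = fun m => cos (A + r * D m) + (-1) * g m); last first.
    by apply/funext => m; rewrite mulN1r.
  by apply: cubicD => //; exact: cubicZ.
have KE : Kop (fun m => cos (A + r * D m)) y - Kop g y = Kop (fun m => cos (A + r * D m) - g m) y.
  have -> : Kop (fun m => cos (A + r * D m) - g m) y = Kop (fun m => cos (A + r * D m) + (-1) * g m) y.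
    by congr (Kop _ y); apply/funext => m; rewrite mulN1r.
  by rewrite KopD ?KopZ ?mulN1r//; exact: cubicZ.
have cD3 : cubic (fun m => `|D m| ^+ 3).
  have B0 : 0 <= `|y%:R| + `|(alpha * y%:R + mu) * y%:R| :> R by exact: addr_ge0.
  exists ((`|y%:R| + `|(alpha * y%:R + mu) * y%:R|) ^+ 3) => m.
  rewrite normrX normr_id -exprMn lerXn2r ?nnegrE ?mulr_ge0 ?addr_ge0//.
  rewrite (_ : D m = y%:R * m%:R - (alpha * y%:R + mu) * y%:R); last by rewrite /D /dev; ring.
  rewrite (le_trans (ler_normB _ _))// mulrDr mulr1 [leRHS]addrC lerD//.
    by rewrite normrM [`|m%:R|]normr_nat ler_wpM2r ?lerDl.
  by rewrite lerDr.
rewrite -Kg KE; rewrite /trunc; case: ifP => _.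
  rewrite subrr mulr0 addr0 /cub_inc -KopZ//.
  apply: Kop_norm => //; first exact: cubicZ.
  move=> m; have := cos_taylor A (r * D m); rewrite le_min => /andP[+ _].
  by move=> /le_trans; apply; rewrite normrM exprMn.
rewrite mulr0 add0r subr0 -Kop_dev_sqr -KopZ//.
apply: Kop_norm => //; first exact: cubicZ.
move=> m; have := cos_taylor A (r * D m); rewrite le_min => /andP[_].
by move=> /le_trans; apply; rewrite exprMn mulrA.
Qed.

Lemma mart_cos_bound (r a : R) k t : `|cos (r * mart k t + a)| <= 1.
Proof. by rewrite ler_norml cos_geN1 cos_le1. Qed.

Lemma measurable_mart_cos (r a : R) k : measurable_fun setT (fun t => cos (r * mart k t + a)).
Proof.
apply: (measurableT_comp (f := fun x => cos (r * x + a))); last exact: measurable_mart.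
by apply: continuous_measurable_fun; exact: continuous_cos_affine.
Qed.

Lemma integrable_weighted_cos (b : T -> R) (r a : R) k : adapted s0 b -> (forall t, 0 <= b t <= 1) ->
  let X t := b t * cos (r * mart k t + a) in
  [/\ measurable_fun setT X, forall t, `|X t| <= 1, P.-integrable setT (EFin \o X) &
      P.-integrable setT (EFin \o (fun t => X t * cvar (Y k t)))].
Proof.
move=> ab b01 X.
have mX : measurable_fun setT X.
  by apply: measurable_funM; [exact: measurable_adapted ab|exact: measurable_mart_cos].
have X1 t : `|X t| <= 1.
  have /andP[h1 h2] := b01 t.
  by rewrite normrM -[leRHS]mulr1 ler_pM ?mart_cos_bound// ger0_norm.
split=> //; first exact: (integrable_bounded P _ 1).
apply: (le_integrableR P _ _ _ _ (integrable_Y k cvar cubic_cvar)).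
  by apply: measurable_funM => //; exact: measurable_fun_nat (discreteY k).
move=> t; rewrite normrM [X in _ * X]ger0_norm ?ler_piMl//; by case/andP: (cvar_bound (Y k t)).
Qed.

Lemma cos_step (b : T -> R) (r a M : R) c k : (s0 <= k)%N -> adapted s0 b ->
  (forall t, 0 <= b t <= 1) -> (forall x, `|trunc c cub_inc x| <= M) ->
  `|\int[P]_t (b t * cos (r * mart k.+1 t + a)) -
    (\int[P]_t (b t * cos (r * mart k t + a)) -
     r ^+ 2 / 2 * \int[P]_t (b t * cos (r * mart k t + a) * cvar (Y k t)))| <=
  `|r| ^+ 3 * M + 2 * r ^+ 2 * \int[P]_t (cvar (Y k t) - trunc c cvar (Y k t)).
Proof.
move=> sk ab b01 HM.
have abk : adapted k b by exact: adaptedW ab.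
have mb : measurable_fun setT b by exact: measurable_adapted ab.
have b1 t : `|b t| <= 1 by have /andP[h1 h2] := b01 t; rewrite ger0_norm.
pose f t (m : nat) : R := cos (r * mart k t + a + r * dev (Y k t) m).
have f1 t m : `|f t m| <= 1 by rewrite ler_norml cos_geN1 cos_le1.
have -> : \int[P]_t (b t * cos (r * mart k.+1 t + a)) = \int[P]_t (b t * Kop (f t) (Y k t)).
  transitivity (\int[P]_t (b t * f t (Y k.+1 t))).
    by apply: eq_Rintegral => t _; rewrite martS// /f /inc; congr (_ * cos _); rewrite /dev; ring.
  rewrite (tower0 k (fun t m => b t * f t m) 1 sk); last 2 first.
  - by move=> m t t' H; rewrite (abk t t' H) /f (adapted_mart k t t' H) H.
  - move=> t m; rewrite normrM mul1r; apply: (@le_trans _ _ (1 * 1)); first exact: ler_pM.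
    by rewrite mul1r exprn_ege1// lerDl.
  by apply: eq_Rintegral => t _; rewrite KopZ//; apply: (cubic_bounded _ 1).
have [M' HM'] := trunc_bounded c cvar.
have cvar0 x : 0 <= cvar x by case/andP: (cvar_bound x).
have ic k' := integrable_Y k' cvar cubic_cvar.
have it k' := integrable_Y k' _ (cubic_bounded _ _ HM').
have [_ _ i1 i2] := integrable_weighted_cos b r a k ab b01.
have aK : adapted k (fun t => b t * Kop (f t) (Y k t)).
  move=> t t' H; rewrite (abk t t' H) H//; congr (_ * Kop _ _); apply/funext => m.
  by rewrite /f (adapted_mart k t t' H) H.
have i3 : P.-integrable setT (EFin \o (fun t => b t * Kop (f t) (Y k t))).
  apply: (integrable_bounded P _ 1); first exact: measurable_adapted aK.
  by move=> t; rewrite normrM -[leRHS]mulr1 ler_pM//; exact: Kop_bounded.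
have i4 : P.-integrable setT (EFin \o (fun t => cvar (Y k t) - trunc c cvar (Y k t))).
  exact: integrableRB.
rewrite -(RintegralZl _ _ i2)// -(RintegralB _ i1 (integrableRZ _ _ _ i2))//.
have i12 := integrableRB _ _ _ i1 (integrableRZ _ (r ^+ 2 / 2) _ i2).
rewrite -(RintegralB _ i3 i12)//.
have i := integrableRB _ _ _ i3 i12.
have icst := integrable_cstR P (`|r| ^+ 3 * M).
rewrite (le_trans (le_normr_Rintegral _ i))// -(RintegralZl _ _ i4)//.
rewrite -[`|r| ^+ 3 * M](Rintegral_prob_cst P) -(RintegralD _ icst (integrableRZ _ _ _ i4))//.
apply: le_Rintegral => //; [exact: (integrable_norm i)|by apply: integrableRD => //; exact: integrableRZ|].
move=> t _.
have -> : b t * Kop (f t) (Y k t) - (b t * cos (r * mart k t + a) -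
    r ^+ 2 / 2 * (b t * cos (r * mart k t + a) * cvar (Y k t))) =
    b t * (Kop (f t) (Y k t) - cos (r * mart k t + a) * (1 - r ^+ 2 / 2 * cvar (Y k t))) by ring.
rewrite normrM (le_trans (ler_piMl _ (b1 t)))// (le_trans (Kop_cos _ _ c _))//.
by rewrite lerD2r ler_wpM2l// (le_trans (ler_norm _)).
Qed.

Lemma cos_telescope (b : T -> R) (u a M L : R) c n : L = u ^+ 2 * cvar_lim / 2 -> (maxn s0 1 <= n)%N -> adapted s0 b ->
  (forall t, 0 <= b t <= 1) -> (forall x, `|trunc c cub_inc x| <= M) ->
  `|\int[P]_t (b t * cos (u / Num.sqrt n%:R * mart n t + a)) -
    (\int[P]_t b t) * (expR (- L) * cos a)| <=
  u ^+ 2 / (2 * n%:R) * `|\sum_(s0 <= k < n) \int[P]_t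
      (b t * (expR (L / n%:R * k.+1%:R) * cos (u / Num.sqrt n%:R * mart k t + a)) *
       (cvar (Y k t) - cvar_lim))| +
  expR (2 * L) * (2 * u ^+ 2 / n%:R * \sum_(s0 <= k < n) \int[P]_t (cvar (Y k t) - trunc c cvar (Y k t)) +
    (`|u| ^+ 3 * M + L ^+ 2 + L * s0%:R) / Num.sqrt n%:R).
Proof.
move=> LE; rewrite (geq_max n s0 1) => /andP[sn n1] ab b01 HM.
have n0 : 0 < n%:R :> R by rewrite ltr0n.
have sq0 : 0 < Num.sqrt n%:R :> R by rewrite sqrtr_gt0.
have sq2 : Num.sqrt n%:R ^+ 2 = n%:R :> R by rewrite sqr_sqrtr// ltW.
have sq1 : 1 <= Num.sqrt n%:R :> R by rewrite -[leLHS]sqrtr1 ler_sqrt ?ler1n.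
have L0 : 0 <= L by rewrite LE; apply: divr_ge0 => //; apply: mulr_ge0; [exact: sqr_ge0|exact: cvar_lim_ge0].
set r := u / Num.sqrt n%:R; set lam := L / n%:R.
have lam0 : 0 <= lam by rewrite divr_ge0// ltW.
have lamE : lam = r ^+ 2 / 2 * cvar_lim.
  by rewrite /lam LE /r exprMn exprVn sq2; field; rewrite gt_eqF.
have mb : measurable_fun setT b by exact: measurable_adapted ab.
have b1 t : `|b t| <= 1 by have /andP[h1 h2] := b01 t; rewrite ger0_norm.
pose g k := \int[P]_t (b t * cos (r * mart k t + a)).
pose h k := \int[P]_t (b t * cos (r * mart k t + a) * cvar (Y k t)).
pose G k := expR (lam * k%:R) * g k.
pose w k t := b t * (expR (lam * k.+1%:R) * cos (r * mart k t + a)).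
pose tl k := \int[P]_t (cvar (Y k t) - trunc c cvar (Y k t)).
have mbc k : measurable_fun setT (fun t => b t * cos (r * mart k t + a)).
  by case: (integrable_weighted_cos b r a k ab b01).
have bc1 k t : `|b t * cos (r * mart k t + a)| <= 1.
  by case: (integrable_weighted_cos b r a k ab b01).
have i1 k : P.-integrable setT (EFin \o (fun t => b t * cos (r * mart k t + a))).
  by case: (integrable_weighted_cos b r a k ab b01).
have i2 k : P.-integrable setT (EFin \o (fun t => b t * cos (r * mart k t + a) * cvar (Y k t))).
  by case: (integrable_weighted_cos b r a k ab b01).
have cvar0 x : 0 <= cvar x by case/andP: (cvar_bound x).
have g1 k : `|g k| <= 1 by exact: norm_Rintegral_le.
have wE k : \int[P]_t (w k t * (cvar (Y k t) - cvar_lim)) = expR (lam * k.+1%:R) * (h k - cvar_lim * g k).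
  rewrite /h /g -(RintegralZl cvar_lim _ (i1 k))// -(RintegralB _ (i2 k) (integrableRZ _ _ _ (i1 k)))//.
  rewrite -(RintegralZl _ _ (integrableRB _ _ _ (i2 k) (integrableRZ _ _ _ (i1 k))))//.
  by apply: eq_Rintegral => t _; rewrite /w; ring.
have EL k : (k < n)%N -> expR (lam * k.+1%:R) <= expR (2 * L).
  move=> kn; rewrite ler_expR (@le_trans _ _ L)//; last by rewrite ler_peMl// ler1n.
  by rewrite /lam mulrAC ler_pdivrMr// ler_wpM2l// ler_nat.
have E0 := expR_ge0 (2 * L).
have tl0 k : 0 <= tl k.
  by apply: Rintegral_ge0 => t _; exact: trunc_le.
have M0 : 0 <= M by exact: le_trans (HM 0%N).
have step k : (s0 <= k < n)%N -> `|G k.+1 - G k + r ^+ 2 / 2 * \int[P]_t (w k t * (cvar (Y k t) - cvar_lim))| <=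
    expR (2 * L) * (`|r| ^+ 3 * M + 2 * r ^+ 2 * tl k + lam ^+ 2).
  move=> /andP[sk kn]; rewrite wE /G.
  (* Factoring out the later exponential, whence [k.+1] in the weights, leaves the remainder of
     [cos_step] and [g k] times the error of [exp (-lam)] against [1 - lam]. *)
  have -> : expR (lam * k.+1%:R) * g k.+1 - expR (lam * k%:R) * g k +
      r ^+ 2 / 2 * (expR (lam * k.+1%:R) * (h k - cvar_lim * g k)) =
      expR (lam * k.+1%:R) * ((g k.+1 - (g k - r ^+ 2 / 2 * h k)) + g k * (1 - lam - expR (- lam))).
    have -> : expR (lam * k%:R) = expR (lam * k.+1%:R) * expR (- lam).
      by rewrite -expRD; congr expR; rewrite -natr1; ring.
    by rewrite lamE; ring.
  rewrite normrM gtr0_norm ?expR_gt0// ler_pM ?expR_ge0//; first exact: EL.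
  rewrite (le_trans (ler_normD _ _))// lerD//; first exact: cos_step.
  by rewrite normrM (le_trans (ler_piMl _ (g1 k)))// expRN_approx.
have sumG : `|G n - G s0| <= r ^+ 2 / 2 * `|\sum_(s0 <= k < n) \int[P]_t (w k t * (cvar (Y k t) - cvar_lim))| +
    expR (2 * L) * (n%:R * (`|r| ^+ 3 * M + lam ^+ 2) + 2 * r ^+ 2 * \sum_(s0 <= k < n) tl k).
  rewrite -(telescope_sumr G sn).
  rewrite (_ : \sum_(_ <= _ < _) _ = \sum_(s0 <= k < n) (G k.+1 - G k + r ^+ 2 / 2 * \int[P]_t (w k t * (cvar (Y k t) - cvar_lim))) - r ^+ 2 / 2 * \sum_(s0 <= k < n) \int[P]_t (w k t * (cvar (Y k t) - cvar_lim))); last first.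
    by rewrite mulr_sumr -sumrB; apply: eq_bigr => k _; rewrite addrK.
  rewrite (le_trans (ler_normB _ _))// addrC lerD//.
    by rewrite normrM ger0_norm// divr_ge0// sqr_ge0.
  rewrite (le_trans (ler_norm_sum _ _ _))//.
  apply: (@le_trans _ _ (\sum_(s0 <= k < n) expR (2 * L) * (`|r| ^+ 3 * M + 2 * r ^+ 2 * tl k + lam ^+ 2))).
    by rewrite big_seq [leRHS]big_seq; apply: ler_sum => k; rewrite mem_index_iota; exact: step.
  rewrite -mulr_sumr ler_wpM2l//.
  rewrite (eq_bigr (fun k => (`|r| ^+ 3 * M + lam ^+ 2) + 2 * r ^+ 2 * tl k)); last by move=> k _; ring.
  rewrite big_split/= -mulr_sumr lerD2r big_const_nat iter_addr_0 -[leLHS]mulr_natl.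
  rewrite ler_wpM2r ?ler_nat ?leq_subr//.
  by rewrite addr_ge0 ?mulr_ge0 ?exprn_ge0.
(* [mart s0] is an empty sum, so the telescope starts at the mean of [b] times [cos a], up to a
   factor [exp (lam s0)] that tends to 1. *)
have Gs0 : G s0 = expR (lam * s0%:R) * ((\int[P]_t b t) * cos a).
  rewrite /G /g; congr (_ * _); rewrite mulrC -RintegralZl//; last exact: (integrable_bounded P _ 1).
  by apply: eq_Rintegral => t _; rewrite /mart big_geq// mulr0 add0r mulrC.
have Gn : G n = expR L * g n by rewrite /G /lam divfK// gt_eqF.
have gE : g n = expR (- L) * G n.
  by rewrite Gn mulrA -expRD addNr expR0 mul1r.
have pc1 : `|(\int[P]_t b t) * cos a| <= 1.
  by rewrite normrM -[leRHS]mulr1 ler_pM//; [exact: norm_Rintegral_le|rewrite ler_norml cos_geN1 cos_le1].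
rewrite -/(g n) gE.
have -> : expR (- L) * G n - \int[P]_t b t * (expR (- L) * cos a) =
   expR (- L) * ((G n - G s0) + (expR (lam * s0%:R) - 1) * (\int[P]_t b t * cos a)).
  by rewrite Gs0; ring.
rewrite normrM (le_trans (ler_piMl _ _))//.
  by rewrite gtr0_norm ?expR_gt0// -expR0 ler_expR oppr_le0.
rewrite (le_trans (ler_normD _ _))//.
have es : `|(expR (lam * s0%:R) - 1) * (\int[P]_t b t * cos a)| <= expR (2 * L) * (L * s0%:R / n%:R).
  rewrite normrM -[leRHS]mulr1 ler_pM// ger0_norm; last first.
    by rewrite subr_ge0 -expR0 ler_expR mulr_ge0.
  rewrite (le_trans (expR_sub1_le _))// mulrC ler_pM ?expR_ge0 ?mulr_ge0//.
    rewrite ler_expR (@le_trans _ _ L)//; last by rewrite ler_peMl// ler1n.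
    by rewrite /lam mulrAC ler_pdivrMr// ler_wpM2l// ler_nat.
  by rewrite /lam mulrAC.
rewrite (le_trans (lerD sumG es))// -addrA -mulrDr.
have r2 : r ^+ 2 = u ^+ 2 / n%:R by rewrite /r exprMn exprVn sq2.
have -> : r ^+ 2 / 2 = u ^+ 2 / (2 * n%:R) by rewrite r2; field; rewrite gt_eqF.
rewrite lerD2l ler_wpM2l// addrAC r2 addrC mulrA lerD2l.
have -> : `|r| ^+ 3 = `|u| ^+ 3 / (Num.sqrt n%:R * n%:R).
  by rewrite /r normrM normfV (gtr0_norm sq0) exprMn exprVn [Num.sqrt _ ^+ 3]exprS sq2.
have -> : n%:R * (`|u| ^+ 3 / (Num.sqrt n%:R * n%:R) * M + lam ^+ 2) + L * s0%:R / n%:R =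
   (`|u| ^+ 3 * M) / Num.sqrt n%:R + (L ^+ 2 + L * s0%:R) / n%:R.
  by rewrite /lam; field; rewrite !gt_eqF.
rewrite -[in leRHS]addrA [leRHS]mulrDl lerD2l ler_wpM2l ?addr_ge0 ?mulr_ge0 ?sqr_ge0//.
by rewrite lef_pV2 ?posrE// -[leRHS]sq2 expr2 ler_peMr// ltW.
Qed.

Lemma inc_bound k t : `|inc k t| <= (Y k.+1 t)%:R ^+ 2 + (2 + mu) * (Y k t)%:R ^+ 2.
Proof.
have [a0 a1 mu0] := alpha_nat_ge0.
have yy : ((Y k t)%:R : R) <= (Y k t)%:R ^+ 2.
  by case: (Y k t) => [|y]; rewrite ?expr0n// ler_eXnr// ler1n.
rewrite /inc /dev normrM normr_nat.
move: ((Y k t)%:R) ((Y k.+1 t)%:R) (ler0n R (Y k t)) (ler0n R (Y k.+1 t)) yy => y y' y0 y'0 yy.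
apply: (@le_trans _ _ ((y' + y + mu) * y)).
  rewrite ler_wpM2r// (le_trans (ler_normB _ _))// (ger0_norm mu0) lerD2r.
  rewrite (le_trans (ler_normB _ _))// (ger0_norm y'0) lerD2l normrM (ger0_norm a0) (ger0_norm y0).
  by rewrite ler_piMl//; lra.
have h1 : mu * y <= mu * y ^+ 2 by rewrite ler_wpM2l.
have h2 : y' * y <= y' ^+ 2 + y ^+ 2.
  by have := sqr_ge0 (y' - y); have := sqr_ge0 y; have := sqr_ge0 y'; nra.
rewrite (_ : (y' + y + mu) * y = y' * y + y ^+ 2 + mu * y); last by ring.
rewrite (_ : _ + _ * _ ^+ 2 = y' ^+ 2 + y ^+ 2 + y ^+ 2 + mu * y ^+ 2); last by ring.
by rewrite lerD// lerD2r.
Qed.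

Lemma integral_inc_le : exists2 D : R, 0 <= D & forall k,
  P.-integrable setT (EFin \o inc k) /\ \int[P]_t `|inc k t| <= D.
Proof.
have [B B0 HB] := integral_Y_bounded (fun x => x%:R ^+ 2) m2 cvg_mom2.
have [_ _ mu0] := alpha_nat_ge0.
exists (B + (2 + mu) * B); first by rewrite addr_ge0// mulr_ge0// addr_ge0.
move=> k.
have i2 j := integrable_Y j _ (cubicX 2 isT).
have ib := integrableRD _ _ _ (i2 k.+1) (integrableRZ _ (2 + mu) _ (i2 k)).
have ii : P.-integrable setT (EFin \o inc k).
  by apply: (le_integrableR P _ _ _ (inc_bound k) ib); exact: measurable_adapted (adapted_inc k).
split=> //.
apply: (@le_trans _ _ (\int[P]_t ((Y k.+1 t)%:R ^+ 2 + (2 + mu) * (Y k t)%:R ^+ 2))).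
  by apply: le_Rintegral => //; [exact: (integrable_norm ii)|move=> t _; exact: inc_bound].
rewrite (RintegralD _ (i2 k.+1) (integrableRZ _ (2 + mu) _ (i2 k)))//.
by rewrite (RintegralZl _ _ (i2 k))// lerD// ler_wpM2l// addr_ge0.
Qed.

Lemma cvg_mart_cos (b : T -> R) (u a : R) : adapted s0 b -> (forall t, 0 <= b t <= 1) ->
  (fun n => \int[P]_t (b t * cos (u * (mart n t / Num.sqrt n%:R) + a))) @ \oo -->
  (\int[P]_t b t) * (expR (- (u ^+ 2 * cvar_lim / 2)) * cos a).
Proof.
move=> ab b01; apply/cvgrPdist_le => e e0.
have [L LE] : exists L, L = u ^+ 2 * cvar_lim / 2 by eexists.
have L0 : 0 <= L by rewrite LE; apply: divr_ge0 => //; apply: mulr_ge0; [exact: sqr_ge0|exact: cvar_lim_ge0].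
have [D D0 HD] := integral_inc_le.
have E0 : 0 < expR (2 * L) by exact: expR_gt0.
have b1 t : `|b t| <= 1 by have /andP[h1 h2] := b01 t; rewrite ger0_norm.
(* One constant for both requirements of the weighted law: the 1 covers the size of the weights,
   while [L] and [|u| D] cover the mean change of the exponential and of the cosine, times
   [sqrt n]. *)
pose C := expR (2 * L) * (1 + L + `|u| * D).
have C0 : 0 <= C by rewrite /C mulr_ge0 ?(ltW E0)// !addr_ge0// mulr_ge0.
have u0 := sqr_ge0 u.
have u1 : 0 < u ^+ 2 + 1 by rewrite ltr_wpDl.
have u2 : 0 < 2 * u ^+ 2 + 1 by rewrite ltr_wpDl// mulr_ge0.
have e1 : 0 < 2 * e / (3 * (u ^+ 2 + 1)) by rewrite divr_gt0// mulr_gt0// ltr_wpDl.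
have e2' : 0 < e / (3 * (2 * u ^+ 2 + 1)) / expR (2 * L) by rewrite !divr_gt0// mulr_gt0// ltr_wpDl// mulr_ge0.
have [N1 H1] := weighted_lln_cubic cvar _ _ C _ cvar_bound cvg_cvar C0 e1.
have [c [N2 [H2 _]]] := tail_sum cvar _ _ _ cvar_bound cvg_cvar e2'.
have [M HM] := trunc_bounded c cub_inc.
have [N3 H3] := sqrt_large ((`|u| ^+ 3 * M + L ^+ 2 + L * s0%:R) * expR (2 * L) / (e / 3)).
exists (maxn (maxn s0 1) (maxn N1 (maxn N2 N3))) => // n /=.
rewrite (geq_max n (maxn s0 1)) (geq_max n N1) (geq_max n N2) => /and4P[sn n1 n2 /H3 n3].
have n0 : (0 < n)%N by move: sn; rewrite (geq_max n s0 1) => /andP[].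
have n0' : 0 < n%:R :> R by rewrite ltr0n.
have sq0 : 0 < Num.sqrt n%:R :> R by rewrite sqrtr_gt0.
have sqn : n%:R^-1 <= (Num.sqrt n%:R)^-1 :> R.
  rewrite lef_pV2 ?posrE// -[leRHS](sqr_sqrtr (ltW n0')) expr2 ler_peMr ?sqrtr_ge0//.
  by rewrite -[leLHS]sqrtr1 ler_sqrt ?ler1n.
pose w k t := b t * (expR (L / n%:R * k.+1%:R) * cos (u / Num.sqrt n%:R * mart k t + a)).
(* The weights are needed up to [k = n], and [k.+1 <= 2 n] there, which explains the [2 L]. *)
have EL k : (k <= n)%N -> expR (L / n%:R * k.+1%:R) <= expR (2 * L).
  move=> kn; rewrite ler_expR mulrAC ler_pdivrMr// -mulrA mulrCA ler_wpM2l//.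
  by rewrite -natrM ler_nat mul2n -addnn; apply: leq_ltn_trans kn _; rewrite -addn1 leq_add2l.
have w1 : `|\sum_(s0 <= k < n) \int[P]_t (w k t * (cvar (Y k t) - cvar_lim))| <= 2 * e / (3 * (u ^+ 2 + 1)) * n%:R.
  apply: (H1 n n1).
  - by move=> k sk t t' H; rewrite /w (adaptedW _ _ _ sk ab t t' H) (adapted_mart k t t' H).
  - move=> k t /andP[sk kn]; rewrite /w !normrM (gtr0_norm (expR_gt0 _)).
    rewrite (le_trans (ler_piMl _ (b1 t))) ?mulr_ge0 ?expR_ge0//.
    rewrite (@le_trans _ _ (expR (2 * L) * 1))//.
      by rewrite ler_pM ?expR_ge0 ?EL ?mart_cos_bound.
    by rewrite ler_wpM2l ?(ltW E0)// -addrA lerDl addr_ge0// mulr_ge0.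
  move=> k /andP[sk kn].
  have [ik Dk] := HD k.
  have mw j : (s0 <= j)%N -> measurable_fun setT (w j).
    move=> sj; apply: (measurable_adapted j) => t t' H.
    by rewrite /w (adaptedW _ _ _ sj ab t t' H) (adapted_mart j t t' H).
  (* The exponential changes by a relative amount of order [1 / n], the cosine, being 1-Lipschitz,
     by at most [|u| |inc k| / sqrt n]. *)
  have wd t : `|w k.+1 t - w k t| <= expR (2 * L) / Num.sqrt n%:R * (L + `|u| * `|inc k t|).
    have -> : w k.+1 t - w k t = b t * (expR (L / n%:R * k.+1%:R) *
        ((expR (L / n%:R) - 1) * cos (u / Num.sqrt n%:R * mart k.+1 t + a) +
        (cos (u / Num.sqrt n%:R * mart k.+1 t + a) - cos (u / Num.sqrt n%:R * mart k t + a)))).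
      have -> : w k.+1 t = b t * (expR (L / n%:R * k.+1%:R) * expR (L / n%:R) * cos (u / Num.sqrt n%:R * mart k.+1 t + a)).
        by rewrite /w -expRD; congr (_ * (expR _ * _)); rewrite -[k.+2%:R]natr1; ring.
      by rewrite /w; ring.
    rewrite normrM (le_trans (ler_piMl _ (b1 t)))// normrM (gtr0_norm (expR_gt0 _)).
    apply: (@le_trans _ _ (expR (L / n%:R * k.+1%:R) * (L / n%:R * expR (L / n%:R) + `|u| / Num.sqrt n%:R * `|inc k t|))).
      rewrite ler_wpM2l ?expR_ge0// (le_trans (ler_normD _ _))// lerD//.
        rewrite normrM -[leRHS]mulr1 ler_pM ?mart_cos_bound// ger0_norm ?expR_sub1_le//.
        by rewrite subr_ge0 -expR0 ler_expR divr_ge0// ltW.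
      rewrite (le_trans (lip_cos _ _))// martS// [X in `|X|](_ : _ = u / Num.sqrt n%:R * inc k t); last by ring.
      by rewrite !normrM normfV (gtr0_norm sq0).
    rewrite mulrDr mulrDr lerD//.
      rewrite [leLHS](_ : _ = L * (expR (L / n%:R * k.+1%:R) * expR (L / n%:R) * n%:R^-1)); last by ring.
      rewrite [leRHS]mulrC -expRD ler_wpM2l//.
      rewrite ler_pM ?invr_ge0 ?expR_ge0 ?(ltW n0')//.
      rewrite (_ : _ + _ = L / n%:R * k.+2%:R); last by rewrite -[k.+2%:R]natr1; ring.
      rewrite ler_expR mulrAC ler_pdivrMr// -mulrA mulrCA ler_wpM2l//.
      rewrite -natrM ler_nat mul2n -addnn; exact: (leq_add n0 kn).
    rewrite [leRHS](_ : _ = expR (2 * L) * (`|u| / Num.sqrt n%:R * `|inc k t|)); last by ring.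
    by apply: ler_wpM2r; [rewrite !mulr_ge0 ?invr_ge0 ?(ltW sq0)|exact: EL (ltnW kn)].
  have ic := integrable_cstR P (L).
  have ib := integrableRZ _ (expR (2 * L) / Num.sqrt n%:R) _ (integrableRD _ _ _ ic (integrableRZ _ `|u| _ (integrable_norm ik))).
  apply: (@le_trans _ _ (\int[P]_t (expR (2 * L) / Num.sqrt n%:R * (L + `|u| * `|inc k t|)))).
    apply: le_Rintegral => //.
    apply: (le_integrableR P _ _ _ _ ib).
      by apply: measurableT_comp => //; apply: measurable_funB; apply: mw => //; exact: leqW.
    by move=> t; rewrite normr_id.
  rewrite (RintegralZl _ _ (integrableRD _ _ _ ic (integrableRZ _ `|u| _ (integrable_norm ik))))//.
  rewrite (RintegralD _ ic (integrableRZ _ `|u| _ (integrable_norm ik)))// (RintegralZl _ _ (integrable_norm ik))//.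
  rewrite Rintegral_prob_cst /C mulrAC ler_wpM2r ?invr_ge0 ?(ltW sq0)// ler_wpM2l ?(ltW E0)//.
  by rewrite lerD// ?lerDr// ler_wpM2l.
rewrite -LE; have := cos_telescope b u a M L c n LE sn ab b01 HM.
rewrite distrC.
rewrite (_ : (fun t => b t * cos (u * (mart n t / Num.sqrt n%:R) + a)) =
   (fun t => b t * cos (u / Num.sqrt n%:R * mart n t + a))); last first.
  by apply/funext => t; rewrite mulrA mulrAC.
move=> /le_trans; apply.
have h1 : u ^+ 2 / (2 * n%:R) * `|\sum_(s0 <= k < n) \int[P]_t (w k t * (cvar (Y k t) - cvar_lim))| <= e / 3.
  apply: (@le_trans _ _ (u ^+ 2 / (2 * n%:R) * (2 * e / (3 * (u ^+ 2 + 1)) * n%:R))).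
    by rewrite ler_wpM2l// divr_ge0// mulr_ge0// ltW.
  have -> : u ^+ 2 / (2 * n%:R) * (2 * e / (3 * (u ^+ 2 + 1)) * n%:R) = e / 3 * (u ^+ 2 / (u ^+ 2 + 1)).
    by field; rewrite (gt_eqF n0') (gt_eqF u1).
  by rewrite ler_piMr ?divr_ge0 ?(ltW e0)// ler_pdivrMr ?mul1r ?lerDl// ltr_wpDl.
have h2 : expR (2 * L) * (2 * u ^+ 2 / n%:R * \sum_(s0 <= k < n) \int[P]_t (cvar (Y k t) - trunc c cvar (Y k t))) <= e / 3.
  apply: (@le_trans _ _ (expR (2 * L) * (2 * u ^+ 2 / n%:R * (e / (3 * (2 * u ^+ 2 + 1)) / expR (2 * L) * n%:R)))).
    by apply: ler_wpM2l; [exact: ltW|apply: ler_wpM2l; [by apply: divr_ge0 => //; exact: mulr_ge0|exact: H2]].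
  have -> : expR (2 * L) * (2 * u ^+ 2 / n%:R * (e / (3 * (2 * u ^+ 2 + 1)) / expR (2 * L) * n%:R)) =
     e / 3 * (2 * u ^+ 2 / (2 * u ^+ 2 + 1)).
    by field; rewrite (gt_eqF n0') (gt_eqF E0) (gt_eqF u2).
  by rewrite ler_piMr ?divr_ge0 ?(ltW e0)// ler_pdivrMr ?mul1r ?lerDl// ltr_wpDl// mulr_ge0.
have h3 : expR (2 * L) * ((`|u| ^+ 3 * M + L ^+ 2 + L * s0%:R) / Num.sqrt n%:R) <= e / 3.
  move: n3; rewrite ler_pdivrMr ?divr_gt0// => n3.
  by rewrite mulrA ler_pdivrMr// mulrC [leRHS]mulrC.
rewrite mulrDr; move: h1 h2 h3; rewrite /w.
set q1 := _ * `|_|; set q2 := _ * (_ * \sum_(_ <= _ < _) _); set q3 := _ * (_ / Num.sqrt _).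
by lra.
Qed.

(** * Second moments, tightness and the limit law of the martingale *)

(** Orthogonality of the increments. The extended-real form matters because the square integrability
    of [mart] is deduced from it by induction. *)
Lemma ge0_integral_martS k : (s0 <= k)%N ->
  (\int[P]_t (mart k.+1 t ^+ 2)%:E = \int[P]_t (mart k t ^+ 2)%:E + \int[P]_t (cvar (Y k t))%:E)%E.
Proof.
move=> sk.
pose F t (m : nat) : R := (mart k t + dev (Y k t) m) ^+ 2.
have FE t : F t = fun m => mart k t ^+ 2 + ((2 * mart k t) * dev (Y k t) m + dev (Y k t) m ^+ 2).
  by apply/funext => m; rewrite /F; ring.
have cF t : cubic (F t).
  rewrite FE; apply: cubicD; first exact: cubic_cst.
  by apply: cubicD; [apply: cubicZ; exact: cubic_dev|exact: cubic_dev_sqr].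
transitivity (\int[P]_t (F t (Y k.+1 t))%:E)%E.
  by apply: eq_integral => t _; rewrite martS.
rewrite ge0_tower_cubic//; last 2 first.
- by move=> t m; exact: sqr_ge0.
- by move=> m t t' H; rewrite /F (adapted_mart k t t' H) H.
rewrite -ge0_integralD//=; last 4 first.
- by move=> t _; rewrite lee_fin sqr_ge0.
- by apply/measurable_EFinP; apply: measurable_funX; exact: measurable_mart.
- by move=> t _; rewrite lee_fin; case/andP: (cvar_bound (Y k t)).
- by apply/measurable_EFinP; exact: measurable_fun_nat (discreteY k).
apply: eq_integral => t _; rewrite -EFinD; congr EFin.
rewrite shift0// (_ : (fun x => _) = F t); last by apply/funext => x; rewrite addn0.
rewrite FE KopD; [|exact: cubic_cst|].
  rewrite KopD; [|by apply: cubicZ; exact: cubic_dev|exact: cubic_dev_sqr].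
  by rewrite KopZ ?Kop_cst ?Kop_dev ?Kop_dev_sqr ?mulr0 ?add0r//; exact: cubic_dev.
by apply: cubicD; [apply: cubicZ; exact: cubic_dev|exact: cubic_dev_sqr].
Qed.

Lemma mart_second_moment : exists2 B : R, 0 <= B & forall n,
  P.-integrable setT (EFin \o (fun t => mart n t ^+ 2)) /\ \int[P]_t (mart n t ^+ 2) <= B * n%:R.
Proof.
have [B B0 HB] := integral_Y_bounded cvar cvar_lim cvg_cvar.
exists B => // n.
have cvar0 t k : 0 <= cvar (Y k t) by case/andP: (cvar_bound (Y k t)).
have H : (\int[P]_t (mart n t ^+ 2)%:E <= (B * n%:R)%:E)%E.
  have [sn|ns] := leqP s0 n; last first.
    rewrite (eq_integral (fun=> 0%E)) ?integral0 ?lee_fin ?mulr_ge0//.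
    by move=> t _; rewrite /mart big_geq ?expr0n// ltnW.
  elim: n sn => [|n IH].
    rewrite leqn0 => /eqP s00; rewrite (eq_integral (fun=> 0%E)) ?integral0 ?lee_fin ?mulr_ge0//.
    by move=> t _; rewrite /mart s00 big_geq ?expr0n.
  rewrite leq_eqVlt => /predU1P[sn|sn].
    rewrite (eq_integral (fun=> 0%E)) ?integral0 ?lee_fin ?mulr_ge0//.
    by move=> t _; rewrite /mart sn big_geq ?expr0n.
  rewrite ge0_integral_martS// -natr1 mulrDr mulr1 EFinD leeD//; first exact: IH.
  rewrite -[leLHS]fineK ?lee_fin; first exact: (HB n).
  by apply: integrable_fin_num => //; exact: (integrable_Y n cvar cubic_cvar).
have mm : measurable_fun setT (fun t => mart n t ^+ 2) by apply: measurable_funX; exact: measurable_mart.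
have ii : P.-integrable setT (EFin \o (fun t => mart n t ^+ 2)).
  apply/integrableP; split; first exact/measurable_EFinP.
  rewrite (eq_integral (fun t => (mart n t ^+ 2)%:E)).
    exact: le_lt_trans H (ltry _).
  by move=> t _; rewrite /= ger0_norm// sqr_ge0.
by split => //; rewrite -lee_fin /Rintegral fineK//; exact: integrable_fin_num.
Qed.

Lemma mart_tight (e : R) : 0 < e -> exists2 K : R, 0 < K &
  forall n, fine (P [set t | K < `|mart n t / Num.sqrt n%:R|]) <= e.
Proof.
move=> e0; have [B B0 HB] := mart_second_moment.
(* Chebyshev's inequality with [K^2 = (B + 1) / e]; the 1 keeps [K] positive when [B] is 0. *)
have Be : 0 < (B + 1) / e by rewrite divr_gt0// ltr_wpDl.
exists (Num.sqrt ((B + 1) / e)); first by rewrite sqrtr_gt0.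
move=> n; set K := Num.sqrt _.
have K0 : 0 < K by rewrite sqrtr_gt0.
have K2 : K ^+ 2 = (B + 1) / e by rewrite sqr_sqrtr// ltW.
have mX : measurable_fun setT (fun t => mart n t / Num.sqrt n%:R).
  by apply: measurable_funM => //; exact: measurable_mart.
have [ii Hn] := HB n.
have K20 : 0 < K ^+ 2 by exact: exprn_gt0.
have mX2 := measurable_funX 2 mX.
have X2E t : (mart n t / Num.sqrt n%:R) ^+ 2 = n%:R^-1 * mart n t ^+ 2.
  by rewrite exprMn exprVn sqr_sqrtr// mulrC.
have iX2 : P.-integrable setT (EFin \o (fun t => (mart n t / Num.sqrt n%:R) ^+ 2)).
  by rewrite (_ : (fun t => _) = fun t => n%:R^-1 * mart n t ^+ 2); [exact: integrableRZ|exact/funext].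
apply: (@le_trans _ _ (fine (P [set t | K ^+ 2 < `|(mart n t / Num.sqrt n%:R) ^+ 2|]))).
  apply: prob_subset_le; [exact: measurable_gt_norm|exact: (measurable_gt_norm _ _ mX2)|].
  by move=> t /= h; rewrite normrX ltrXn2r// ?nnegrE ltW.
rewrite (le_trans (markov_gt_norm P _ _ mX2 K20 iX2))// ler_pdivrMl// K2 divfK ?gt_eqF//.
rewrite (_ : \int[P]_t _ = \int[P]_t (n%:R^-1 * mart n t ^+ 2)); last first.
  by apply: eq_Rintegral => t _; rewrite -X2E ger0_norm// sqr_ge0.
rewrite (RintegralZl _ _ ii)//.
(* At [n = 0] the inverse is 0 by convention. *)
have [->|n0] := posnP n; first by rewrite invr0 mul0r addr_ge0.
by rewrite ler_pdivrMl ?ltr0n// (le_trans Hn)// mulrC ler_wpM2l// lerDl.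
Qed.

Lemma cvg_mart (b : T -> R) (g : R -> R) : adapted s0 b -> (forall t, 0 <= b t <= 1) ->
  continuous g -> (exists M : R, forall x, `|g x| <= M) ->
  (fun n => \int[P]_t (b t * g (mart n t / Num.sqrt n%:R))) @ \oo -->
  (\int[P]_t b t) * \int[normal_prob 0 1]_x g (Num.sqrt cvar_lim * x).
Proof.
move=> ab b01 cg bg.
apply: (cvg_normal_cos P b (fun n t => mart n t / Num.sqrt n%:R)) => //.
- exact: measurable_adapted ab.
- by move=> n; apply: measurable_funM => //; exact: measurable_mart.
- exact: cvar_lim_ge0.
- by apply: Rintegral_ge0 => t _; case/andP: (b01 t).
- by move=> t c; exact: cvg_mart_cos.
- exact: mart_tight.
Qed.

Context (eps_neq0 : (0 < P (eps 1%N @^-1` [set m | m != 0%N]))%E).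

Lemma mu_gt0 : 0 < mu.
Proof.
pose A := eps 1%N @^-1` [set m | m != 0%N].
have mA : measurable A.
  by apply: (measurable_discrete_preimage (eps 1%N) (eps 1%N)) => //; exact: meps.
have A0 : 0 < fine (P A) by rewrite fine_gt0// eps_neq0/= ltey_eq fin_num_measure.
apply: (lt_le_trans A0); rewrite -(Rintegral_indic P _ mA).
apply: le_Rintegral => //.
- exact: integrable_indicR.
- exact: (integrable_eps _ cubic_id).
- move=> t _; rewrite indicE ler_nat; case: (boolP (t \in A)) => //.
  by rewrite inE /A/= lt0n.
Qed.

(** On natural numbers [x <= x^2], so the second moment of an innovation is at least its positive
    mean. Hence the normalised denominator has a nonzero limit. *)
Lemma m2_gt0 : 0 < m2.
Proof.
have [a0 a1 mu0] := alpha_nat_ge0; have /andP[_ aX] := alphaX_lt1 2 isT.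
have e20 : 0 < e2.
  apply: (lt_le_trans mu_gt0); rewrite -Kop_mean0 /e2; apply: Kop_le; [exact: cubic_id|exact: cubicX|].
  by move=> x; rewrite -natrX ler_nat; case: x => // x; rewrite leq_pmulr.
rewrite divr_gt0 ?subr_gt0// ltr_wpDl// mulr_ge0//.
  by rewrite addr_ge0 ?mulr_ge0.
have /andP[_ a1'] := alphaX_lt1 1 isT.
by rewrite divr_ge0// subr_ge0 ltW// -[alpha]expr1.
Qed.

(** * The estimators *)

Definition ols_num n t : R := \sum_(1 <= k < n.+1 | (k != s1) && (k != s2)) ((Y k t)%:R - mu) * (Y k.-1 t)%:R.
Definition ols_den n t : R := \sum_(1 <= k < n.+1 | (k != s1) && (k != s2)) ((Y k.-1 t)%:R) ^+ 2.

Lemma adapted_sum_outlier n (f : nat -> nat -> R) :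
  adapted n (fun t => \sum_(1 <= k < n.+1 | (k != s1) && (k != s2)) f (Y k t) (Y k.-1 t)).
Proof.
move=> t t' H; rewrite big_nat_cond [RHS]big_nat_cond; apply: eq_bigr => k /andP[/andP[k1 kn] _].
by rewrite !H// (leq_trans (leq_pred k)).
Qed.

(** The tail is indexed by the time of the regressor, one less than that of the response, to match
    [mart]. *)
Lemma sum_no_outlier n (f : nat -> R) : (s0 <= n)%N ->
  \sum_(1 <= k < n.+1 | (k != s1) && (k != s2)) f k =
  \sum_(1 <= k < s0.+1 | (k != s1) && (k != s2)) f k + \sum_(s0 <= k < n) f k.+1.
Proof.
move=> sn; rewrite (big_cat_nat _ (n := s0.+1))//=; congr (_ + _).
rewrite big_add1/= big_nat_cond [RHS]big_nat_cond; apply: eq_bigl => k.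
rewrite andbT; case: (boolP (s0 <= k < n)%N) => //= /andP[].
rewrite geq_max => /andP[h1 h2] _.
by rewrite !gtn_eqF ?ltnS.
Qed.

(** What the steps up to [s0] leave in the numerator: a variable independent of [n], negligible
    after division by [sqrt n]. *)
Definition head_num t : R := ols_num s0 t - alpha * ols_den s0 t.

Lemma ols_numE n t : (s0 <= n)%N -> ols_num n t - alpha * ols_den n t = head_num t + mart n t.
Proof.
move=> sn; rewrite /head_num /ols_num /ols_den (sum_no_outlier n)// [in X in alpha * X](sum_no_outlier n)//.
rewrite [alpha * (_ + _)]mulrDr opprD addrACA; congr (_ + _).
by rewrite mulr_sumr -sumrB; apply: eq_bigr => k _; rewrite /= /inc /dev; ring.
Qed.

Lemma ols_denE n t : (s0 <= n)%N -> ols_den n t - n%:R * m2 =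
  (ols_den s0 t - s0%:R * m2) + \sum_(s0 <= k < n) ((Y k t)%:R ^+ 2 - m2).
Proof.
move=> sn; rewrite {1}/ols_den (sum_no_outlier n)// sumrB big_const_nat iter_addr_0.
by rewrite -[m2 *+ _]mulr_natl natrB//=; rewrite /ols_den; ring.
Qed.

Lemma measurable_ols_num n : measurable_fun setT (ols_num n).
Proof. exact: (measurable_adapted n _ (adapted_sum_outlier n (fun x y => (x%:R - mu) * y%:R))). Qed.

Lemma measurable_ols_den n : measurable_fun setT (ols_den n).
Proof. exact: (measurable_adapted n _ (adapted_sum_outlier n (fun _ y => y%:R ^+ 2))). Qed.

Lemma measurable_alpha_tilde n : measurable_fun setT (alpha_tilde Y mu s1 s2 n).
Proof.
apply: (measurable_adapted n) => t t' H; rewrite /alpha_tilde.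
by rewrite (adapted_sum_outlier n (fun x y => (x%:R - mu) * y%:R) t t' H)
  (adapted_sum_outlier n (fun _ y => y%:R ^+ 2) t t' H).
Qed.

(** The head is a single tight variable divided by [n]; the rest is Markov's inequality applied to
    [lln_sqr]. *)
Lemma cvg_prob_ols_den (dl e : R) : 0 < dl -> 0 < e -> exists N, forall n, (N <= n)%N ->
  fine (P [set t | dl < `|ols_den n t / n%:R - m2|]) <= e.
Proof.
move=> dl0 e0.
pose D t := ols_den s0 t - s0%:R * m2.
have mD : measurable_fun setT D by apply: measurable_funB => //; exact: measurable_ols_den.
have e20 : 0 < e / 2 by rewrite divr_gt0.
have [K K0 HK] := tight1 P D _ mD e20.
have [N1 HN1] := lln_sqr (e / 2 * (dl / 2)) (mulr_gt0 e20 (divr_gt0 dl0 (ltr0Sn _ 1))).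
have [N2 HN2] := nat_large (K / (dl / 2)).
exists (maxn (maxn s0 1) (maxn N1 N2)) => n.
rewrite (geq_max n (maxn s0 1)) (geq_max n s0) (geq_max n N1) => /andP[/andP[sn n0] /andP[n1 /HN2 n2]].
have n0' : 0 < n%:R :> R by rewrite ltr0n.
pose Q t := \sum_(s0 <= k < n) ((Y k t)%:R ^+ 2 - m2).
have mQ : measurable_fun setT Q.
  by apply: (measurable_adapted n) => t t' H; apply: eq_big_nat => k /andP[_ kn]; rewrite H// ltnW.
have mKD := measurable_gt_norm _ K mD.
have mKQ := measurable_gt_norm _ (n%:R * (dl / 2)) mQ.
have mV : measurable [set t | dl < `|ols_den n t / n%:R - m2|].
  apply: (measurable_gt_norm (fun t => ols_den n t / n%:R - m2)).
  by apply: measurable_funB => //; apply: measurable_funM => //; exact: measurable_ols_den.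
apply: (@le_trans _ _ (fine (P ([set t | K < `|D t|] `|` [set t | n%:R * (dl / 2) < `|Q t|])))).
  apply: prob_subset_le => //; first exact: measurableU.
  move=> t /=; have [KD|DK] := ltP K `|D t|; first by left.
  move=> h; right; move: h.
  rewrite (_ : ols_den n t / n%:R - m2 = (D t + Q t) / n%:R); last first.
    by rewrite /D /Q -ols_denE//; field; rewrite gt_eqF.
  rewrite normrM normfV (gtr0_norm n0') ltr_pdivlMr//.
  have := ler_normD (D t) (Q t); move: n2; rewrite ler_pdivrMr ?divr_gt0//.
  by lra.
rewrite (le_trans (prob_setU_le _ _ _ mKD mKQ))//.
suff : fine (P [set t | n%:R * (dl / 2) < `|Q t|]) <= e / 2 by move: HK; lra.
have nd0 : 0 < n%:R * (dl / 2) by rewrite mulr_gt0// divr_gt0.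
have [iQ _] := Rintegral_sum (index_iota s0 n) (fun k t => (Y k t)%:R ^+ 2 - m2)
  (fun k => integrable_Y k (fun x => x%:R ^+ 2 - m2) (cubicD _ (fun=> - m2) (cubicX 2 isT) (cubic_cst _))).
rewrite (le_trans (markov_gt_norm _ _ _ mQ nd0 iQ))// ler_pdivrMl// (le_trans (HN1 n n1))//.
by rewrite le_eqVlt; apply/orP; left; apply/eqP; ring.
Qed.

Definition ae_err n t : R := Num.sqrt n%:R * (alpha_tilde Y mu s1 s2 n t - alpha).

Lemma cvg_ae_err (b : T -> R) (g : R -> R) : adapted s0 b -> (forall t, 0 <= b t <= 1) ->
  continuous g -> (exists M : R, forall x, `|g x| <= M) ->
  (fun n => \int[P]_t (b t * g (ae_err n t))) @ \oo -->
  (\int[P]_t b t) * \int[normal_prob 0 1]_x g (Num.sqrt (cvar_lim / m2 ^+ 2) * x).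
Proof.
move=> ab b01 cg bg; have m20 := m2_gt0.
have b1 t : `|b t| <= 1 by have /andP[h1 h2] := b01 t; rewrite ger0_norm.
have mb : measurable_fun setT b by exact: measurable_adapted ab.
have sqE : Num.sqrt (cvar_lim / m2 ^+ 2) = Num.sqrt cvar_lim / m2.
  by rewrite sqrtrM ?cvar_lim_ge0// sqrtrV ?sqr_ge0// sqrtr_sqr gtr0_norm.
have cg' : continuous (fun x : R => g (x / m2)).
  move=> x; apply: (@continuous_comp _ _ _ (fun x : R => x / m2) g); last exact: cg.
  by apply: (@cvgM _ _ _ _ (fun x : R => x) (cst m2^-1)); [exact: cvg_id|exact: cvg_cst].
have [M HM] := bg.
have main := cvg_mart b (fun x : R => g (x / m2)) ab b01 cg' (ex_intro _ M (fun x => HM (x / m2))).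
have mU n : measurable_fun setT (fun t => mart n t / Num.sqrt n%:R).
  by apply: measurable_funM => //; exact: measurable_mart.
have mV n : measurable_fun setT (fun t => ols_den n t / n%:R).
  by apply: measurable_funM => //; exact: measurable_ols_den.
have mZ n : measurable_fun setT (ae_err n).
  by apply: measurable_funM => //; apply: measurable_funB => //; exact: measurable_alpha_tilde.
have mh : measurable_fun setT head_num.
  apply: measurable_funB; first exact: measurable_ols_num.
  by apply: measurable_funM => //; exact: measurable_ols_den.
have mcg := continuous_measurable_fun cg.
(* A positive denominator selects the branch of [alpha_tilde] other than the default 0; then
   numerator and denominator are rescaled by [sqrt n] and [n]. *)
have ZE n t : (maxn s0 1 <= n)%N -> 0 < ols_den n t / n%:R ->
    ae_err n t = (mart n t / Num.sqrt n%:R + head_num t / Num.sqrt n%:R) / (ols_den n t / n%:R).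
  rewrite (geq_max n s0) => /andP[sn n0].
  have n0' : 0 < n%:R :> R by rewrite ltr0n.
  have q0 : 0 < Num.sqrt n%:R :> R by rewrite sqrtr_gt0.
  rewrite pmulr_lgt0 ?invr_gt0// => den0.
  rewrite /ae_err /alpha_tilde -/(ols_num n t) -/(ols_den n t) den0.
  rewrite -mulrDl [mart n t + _]addrC -ols_numE//.
  rewrite -[X in _ / (_ / X)](sqr_sqrtr (ltW n0')).
  by field; rewrite !gt_eqF.
have dif e : 0 < e -> exists N, forall n, (N <= n)%N ->
    \int[P]_t `|g (mart n t / Num.sqrt n%:R / m2) - g (ae_err n t)| <= e.
  apply: (slutsky P _ (fun n t => ols_den n t / n%:R) _ head_num m2 g (maxn s0 1)) => //.
  - exact: mart_tight.
  - exact: cvg_prob_ols_den.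
rewrite sqE.
rewrite (_ : (fun x : R => g (Num.sqrt cvar_lim / m2 * x)) = fun x : R => g (Num.sqrt cvar_lim * x / m2)); last first.
  by apply/funext => x; rewrite mulrAC.
apply/cvgrPdist_le => e e0; have e20 : 0 < e / 2 by rewrite divr_gt0.
have /cvgrPdist_le/(_ _ e20)[N1 _ HN1] := main.
have [N2 HN2] := dif _ e20.
exists (maxn N1 N2) => // n /=; rewrite geq_max => /andP[/HN1/= n1 /HN2 n2].
have i1 : P.-integrable setT (EFin \o (fun t => b t * g (mart n t / Num.sqrt n%:R / m2))).
  apply: (integrable_bounded P _ M).
    by apply: measurable_funM => //; apply: measurableT_comp => //; exact: measurable_funM.
  by move=> t; rewrite normrM (le_trans (ler_piMl _ (b1 t))).
have i2 : P.-integrable setT (EFin \o (fun t => b t * g (ae_err n t))).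
  apply: (integrable_bounded P _ M).
    by apply: measurable_funM => //; exact: measurableT_comp.
  by move=> t; rewrite normrM (le_trans (ler_piMl _ (b1 t))).
have i12 := integrableRB _ _ _ i1 i2.
have d12 : `|\int[P]_t (b t * g (mart n t / Num.sqrt n%:R / m2)) - \int[P]_t (b t * g (ae_err n t))| <= e / 2.
  rewrite -RintegralB// (le_trans (le_normr_Rintegral _ i12))// (le_trans _ n2)//.
  apply: le_Rintegral => //; first exact: (integrable_norm i12).
    apply: (integrable_bounded P _ (M + M)).
      apply: measurableT_comp => //; apply: measurable_funB; apply: measurableT_comp => //.
      exact: measurable_funM.
    by move=> t; rewrite normr_id (le_trans (ler_normB _ _))// lerD.
  by move=> t _; rewrite -mulrBr normrM ler_piMl.
rewrite (le_trans (ler_distD (\int[P]_t (b t * g (mart n t / Num.sqrt n%:R / m2))) _ _))//.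
by move: n1 d12; lra.
Qed.

Lemma sigma2_aeE : sigma2_ae alpha sig2e pi = cvar_lim / m2 ^+ 2.
Proof. by rewrite /sigma2_ae !dist_moment_pim pim2 pim3. Qed.

Lemma EFin_Rintegral_bounded {d'} {U : measurableType d'} (Q : probability U R) (f : U -> R) (M : R) :
  measurable_fun setT f -> (forall x, `|f x| <= M) ->
  (\int[Q]_x (f x)%:E)%E = (\int[Q]_x f x)%:E.
Proof.
by move=> mf fM; rewrite /Rintegral fineK// integrable_fin_num//; exact: integrable_bounded mf fM.
Qed.

Lemma measurable_ae_err n : measurable_fun setT (ae_err n).
Proof.
by apply: measurable_funM => //; apply: measurable_funB => //; exact: measurable_alpha_tilde.
Qed.

Lemma cvg_dist_ae_err : cvg_dist_normal1 P ae_err (sigma2_ae alpha sig2e pi).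
Proof.
move=> g cg [M gM]; rewrite sigma2_aeE /gauss1_expect.
have mg := continuous_measurable_fun cg.
rewrite (EFin_Rintegral_bounded (normal_prob 0 1) (fun x : R => g (Num.sqrt (cvar_lim / m2 ^+ 2) * x)) M)//; last first.
  by apply: measurableT_comp => //; exact: measurable_funM.
rewrite (_ : (fun n => _) = fun n => (\int[P]_t (1 * g (ae_err n t)))%:E); last first.
  apply/funext => n; rewrite (EFin_Rintegral_bounded _ _ M)//.
    by congr EFin; apply: eq_Rintegral => t _; rewrite mul1r.
  by apply: measurableT_comp => //; exact: measurable_ae_err.
apply: cvg_EFin; first exact: nearW.
have := cvg_ae_err (fun=> 1) g (fun _ _ _ => erefl) _ cg (ex_intro _ M gM).
by rewrite Rintegral_prob_cst mul1r; apply => t; rewrite ler01 lexx.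
Qed.

(** On the event both coordinates are fixed multiples of [ae_err], so a test function of the plane
    becomes the function sending [x] to [g (- m.1 x, - m.2 x)], and [cvg_ae_err] applies. *)
Lemma cond_cvg_dist_ae_err (m : nat * nat) :
  (0 < P [set t | Y s1.-1 t = m.1 /\ Y s2.-1 t = m.2])%E ->
  cond_cvg_dist_normal2 P [set t | Y s1.-1 t = m.1 /\ Y s2.-1 t = m.2]
    (fun n t => (- (Y s1.-1 t)%:R * ae_err n t, - (Y s2.-1 t)%:R * ae_err n t))
    (sigma2_ae alpha sig2e pi *: \matrix_(i < 2, j < 2)
        ((if i == 0 then m.1 else m.2)%:R * (if j == 0 then m.1 else m.2)%:R)).
Proof.
set B := [set t | _] => PB0 g cg [M gM] A.
rewrite sigma2_aeE => AA.
have v0 : 0 <= cvar_lim / m2 ^+ 2 by rewrite divr_ge0 ?cvar_lim_ge0 ?sqr_ge0.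
have [a [b [abv [[A00 A01] [A10 A11]]]]] : exists a b : R, a ^+ 2 + b ^+ 2 = cvar_lim / m2 ^+ 2 /\
    (A 0 0 = - m.1%:R * a /\ A 0 1 = - m.1%:R * b) /\ (A 1 0 = - m.2%:R * a /\ A 1 1 = - m.2%:R * b).
  apply: sqrt_rank1 v0; rewrite AA; congr (_ *: _).
  by apply/matrixP => i j; rewrite !mxE; case: ifP; case: ifP.
pose G (x : R) := g (- m.1%:R * x, - m.2%:R * x).
have cG : continuous G.
  move=> x; apply: (@continuous_comp _ _ _ (fun x : R => (- m.1%:R * x, - m.2%:R * x)) g); last exact: cg.
  have H (c : R) : (fun y : R => c * y) @ x --> c * x.
    by apply: (@cvgM _ _ _ _ (cst c)); [exact: cvg_cst|exact: cvg_id].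
  exact: (cvg_pair (H _) (H _)).
have GM x : `|G x| <= M by exact: gM.
have mG := continuous_measurable_fun cG.
(* The indicator of the event serves as weight: it is known by time [s0], since [s1.-1] and [s2.-1]
   are at most [s0]. *)
pose b1B t : R := ((Y s1.-1 t == m.1) && (Y s2.-1 t == m.2))%:R.
have bE t : b1B t = \1_B t.
  rewrite indicE /b1B; congr (nat_of_bool _)%:R; apply/idP/idP.
    by move=> /andP[/eqP h1 /eqP h2]; rewrite inE.
  by rewrite inE => -[-> ->]; rewrite !eqxx.
have ab1B : adapted s0 b1B.
  by move=> t t' H; rewrite /b1B !H// (leq_trans (leq_pred _))// leq_max leqnn// orbT.
have b01 t : 0 <= b1B t <= 1 by rewrite /b1B ler0n lern1 leq_b1.
have mb : measurable_fun setT b1B by exact: measurable_adapted ab1B.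
have mB : measurable B.
  rewrite (_ : B = (Y s1.-1 @^-1` [set m.1]) `&` (Y s2.-1 @^-1` [set m.2])); last by [].
  by apply: measurableI; exact: discreteY.
have pB : \int[P]_t b1B t = fine (P B).
  by rewrite -(Rintegral_indic P _ mB); apply: eq_Rintegral => t _; exact: bE.
have pB0 : 0 < fine (P B) by rewrite fine_gt0// PB0/= ltey_eq fin_num_measure.
rewrite (_ : (fun n => _) = fun n => (\int[P]_t (b1B t * G (ae_err n t)) * (fine (P B))^-1)%:E); last first.
  apply/funext => n.
  rewrite EFinM -(EFin_Rintegral_bounded _ _ M); last 2 first.
  - by apply: measurable_funM => //; apply: measurableT_comp => //; exact: measurable_ae_err.
  - move=> t; rewrite normrM ger0_norm; last by case/andP: (b01 t).
    by rewrite (le_trans (ler_piMl _ _))//; case/andP: (b01 t).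
  congr (_ * _)%E; rewrite integral_mkcond; apply: eq_integral => t _.
  rewrite patchE bE indicE; case: ifPn => tB; last by rewrite mul0r.
  move: tB; rewrite inE => -[h1 h2].
  by rewrite mul1r /G h1 h2.
pose N2 : probability _ R := (normal_prob (0 : R) 1 \x normal_prob (0 : R) 1)%E.
(* [mat2_apply A w] equals [(- m.1 x, - m.2 x)] for [x = a w.1 + b w.2], a centred normal variable
   of variance [a^2 + b^2]. *)
have -> : (\int[(normal_prob (0:R) 1 \x normal_prob (0:R) 1)%E]_w (g (mat2_apply A w))%:E =
    (\int[normal_prob 0 1]_x G (Num.sqrt (cvar_lim / m2 ^+ 2) * x))%:E)%E.
  rewrite -(normal2_linear_comb a b _ G abv cG); last by exists M.
  rewrite -(EFin_Rintegral_bounded N2 (fun w => G (a * w.1 + b * w.2)) M)//.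
    apply: eq_integral => w _; congr (g _)%:E.
    by rewrite /mat2_apply A00 A01 A10 A11; congr (_, _); ring.
  by apply: measurableT_comp => //; apply: measurable_funD; exact: measurable_funM.
apply: cvg_EFin; first exact: nearW.
have := cvg_ae_err b1B G ab1B b01 cG (ex_intro _ M GM); rewrite pB => H.
rewrite (_ : \int[normal_prob 0 1]_x G (Num.sqrt (cvar_lim / m2 ^+ 2) * x) =
  fine (P B) * (\int[normal_prob 0 1]_x G (Num.sqrt (cvar_lim / m2 ^+ 2) * x)) * (fine (P B))^-1); last first.
  by rewrite mulrAC divff ?mul1r// gt_eqF.
by apply: (@cvgM _ _ _ _ _ (cst (fine (P B))^-1)); [exact: H|exact: cvg_cst].
Qed.

End inar.

Theorem theorem4p4p2 (d : measure_display) (T : measurableType d) (R : realType)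
  (P : probability T R) (alpha : R)
  (eps : nat -> T -> nat) (xi : nat -> nat -> T -> bool) (Y0 : T -> nat)
  (s1 s2 th1 th2 : nat) (pi : nat -> R) :
  0 < alpha < 1 ->
  (* measurability of the primitive variables *)
  (forall k m, measurable (eps k @^-1` [set m])) ->
  (forall k j, measurable (xi k j @^-1` [set true])) ->
  (forall m, measurable (Y0 @^-1` [set m])) ->
  (* mutual independence of Y_0, (eps_k)_{k>=1}, (xi_{k,j})_{k,j>=1} *)
  mutually_independent_discrete P inar_idx_valid (inar_prim Y0 eps xi) ->
  (* eps_k identically distributed *)
  (forall k m, (0 < k)%N -> P (eps k @^-1` [set m]) = P (eps 1%N @^-1` [set m])) ->
  (* xi_{k,j} Bernoulli(alpha) *)
  (forall k j, (0 < k)%N -> (0 < j)%N -> P (xi k j @^-1` [set true]) = alpha%:E) ->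
  (* moment assumptions *)
  (\int[P]_t (((eps 1%N t)%:R : R) ^+ 2)%:E < +oo)%E ->
  (0 < P (eps 1%N @^-1` [set m | m != 0%N]))%E ->
  (\int[P]_t (((Y0 t)%:R : R) ^+ 3)%:E < +oo)%E ->
  (\int[P]_t (((eps 1%N t)%:R : R) ^+ 3)%:E < +oo)%E ->
  (* outliers *)
  (0 < s1)%N -> (0 < s2)%N -> s1 != s2 -> (0 < th1)%N -> (0 < th2)%N ->
  (* pi is the stationary distribution of the INAR(1) chain *)
  inar_stationary P eps xi pi ->
  let mu := rv_mean P (eps 1%N) in
  let sig2 := sigma2_ae alpha (rv_var P (eps 1%N)) pi in
  let Y := Yproc Y0 eps xi s1 s2 th1 th2 in
  cvg_dist_normal1 P
    (fun n t => Num.sqrt (n%:R) * (alpha_tilde Y mu s1 s2 n t - alpha)) sig2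
  /\
  forall m : nat * nat,
    (0 < P [set t | Y s1.-1 t = m.1 /\ Y s2.-1 t = m.2])%E ->
    cond_cvg_dist_normal2 P [set t | Y s1.-1 t = m.1 /\ Y s2.-1 t = m.2]
      (fun n t =>
         (Num.sqrt (n%:R) * (theta_tilde Y mu s1 s2 s1 n t
                               - ((Y s1 t)%:R - alpha * (Y s1.-1 t)%:R - mu)),
          Num.sqrt (n%:R) * (theta_tilde Y mu s1 s2 s2 n t
                               - ((Y s2 t)%:R - alpha * (Y s2.-1 t)%:R - mu))))
      (sig2 *: \matrix_(i < 2, j < 2)
          ((if i == 0 then m.1 else m.2)%:R * (if j == 0 then m.1 else m.2)%:R)).
Proof.
move=> alpha01 meps mxi mY0 indep ident bern _ eps_neq0 Y03 eps3 _ _ _ _ _ Hpi mu sig2 Y.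
split=> [|m PB]; first exact: (@cvg_dist_ae_err d T R P alpha eps xi Y0 s1 s2 th1 th2).
have := @cond_cvg_dist_ae_err d T R P alpha eps xi Y0 s1 s2 th1 th2 alpha01 meps mxi mY0
  indep ident bern eps3 Y03 pi Hpi eps_neq0 m PB.
congr cond_cvg_dist_normal2; apply/funext => n; apply/funext => t.
(* The observation at the outlier and [mu] cancel, leaving the preceding value times minus the error
   of [alpha_tilde]. *)
by congr (_, _); rewrite /theta_tilde /ae_err -/Y -/mu; ring.
Qed.
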